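(* Let $p$ be a prime and let $G = E_1 \times \ldots \times E_r$ be a finite direct product of finitely generated pro-$p$ groups $E_j$, each of which is either free or Demushkin. Suppose that at least one factor $E_j$ is non-soluble. Let $\mathcal{S}$ be an iterated verbal filtration of $G$ and, for $1 \le j \le r$, set $\alpha_j = \mathrm{hdim}_G^{\mathcal{S}}(E_j)$. Then $G$ has normal Hausdorff spectrum $$\mathrm{hspec}_\trianglelefteq^{\mathcal{S}}(G) = \Big\{ \sum\nolimits_{j \in J} \alpha_j \;\Big|\; J \subseteq \{1,\ldots,r\} \Big\}$$ with respect to $\mathcal{S}$.
   Context: Subgroups of pro-$p$ groups are understood to be closed and generation is topological. ''Free'' means free pro-$p$. A Demushkin pro-$p$ group is a Poincaré duality pro-$p$ group of dimension $2$ (i.e. a pro-$p$ group $D$ of cohomological dimension $2$ with $H^1(D,\mathbb{F}_p)$ finite, $\dim_{\mathbb{F}_p} H^2(D,\mathbb{F}_p)=1$, and non-degenerate cup product $H^1(D,\mathbb{F}_p)\times H^1(D,\mathbb{F}_p)\to H^2(D,\mathbb{F}_p)$). A filtration of a finitely generated infinite pro-$p$ group $G$ is a descending chain $\mathcal{S}\colon G_i$, $i\in\mathbb{N}_0$, of open normal subgroups with trivial intersection. It is an iterated verbal filtration if $G_0=G$ and $G_i$ is a verbal subgroup of $G_{i-1}$ for each $i\in\mathbb{N}$. Here a verbal subgroup of a pro-$p$ group $H$ is a closed subgroup (topologically) generated by all values $w(h_1,\ldots,h_k)$, $h_1,\ldots,h_k\in H$, of group words $w$ in a given set of words $\mathcal{W}$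 (which may depend on $i$). The Hausdorff dimension of a closed subgroup $H\le G$ with respect to $\mathcal{S}$ is $$\mathrm{hdim}_G^{\mathcal{S}}(H) = \liminf_{i\to\infty} \frac{\log_p |HG_i:G_i|}{\log_p |G:G_i|}.$$ The normal Hausdorff spectrum is $\mathrm{hspec}_\trianglelefteq^{\mathcal{S}}(G) = \{\mathrm{hdim}_G^{\mathcal{S}}(N) \mid N \text{ a closed normal subgroup of } G\}$. *)

(* Defs.v *)
From HB Require Import structures.
From mathcomp Require Import all_boot all_order all_algebra.
From mathcomp Require Import finmap all_classical all_reals all_analysis.

Set Implicit Arguments.
Unset Strict Implicit.
Unset Printing Implicit Defensive.

Import Order.TTheory GRing.Theory Num.Theory.
Import numFieldNormedType.Exports.

Local Open Scope classical_set_scope.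
Local Open Scope group_scope.

HB.mixin Record isTopologicalGroup G of Group G & Topological G := {
  mulg_continuous : continuous (fun x : G * G => x.1 * x.2);
  invg_continuous : continuous (fun x : G => x^-1)
}.

#[short(type="topGroupType")]
HB.structure Definition TopologicalGroup :=
  {G of Group G & Topological G & isTopologicalGroup G}.

Section DirectProduct.
Context {I : Type} (E : I -> topGroupType).
Implicit Types x y z : prod_topology E.

Let prod_one : prod_topology E := fun i => 1.
Let prod_inv x : prod_topology E := fun i => (x i)^-1.
Let prod_mul x y : prod_topology E := fun i => x i * y i.

Let prod_mulgA : associative prod_mul.
Proof. by move=> x y z; apply: functional_extensionality_dep => i; exact: mulgA. Qed.

Let prod_mul1g : left_id prod_one prod_mul.
Proof. by move=> x; apply: functional_extensionality_dep => i; exact: mul1g. Qed.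

Let prod_mulg1 : right_id prod_one prod_mul.
Proof. by move=> x; apply: functional_extensionality_dep => i; exact: mulg1. Qed.

Let prod_mulVg : left_inverse prod_one prod_inv prod_mul.
Proof. by move=> x; apply: functional_extensionality_dep => i; exact: mulVg. Qed.

Let prod_mulgV : right_inverse prod_one prod_inv prod_mul.
Proof. by move=> x; apply: functional_extensionality_dep => i; exact: mulgV. Qed.

HB.instance Definition _ := isGroup.Build (prod_topology E)
  prod_mulgA prod_mul1g prod_mulg1 prod_mulVg prod_mulgV.

Let continuous_coord (i : I) : continuous (fun x => x i).
Proof.
move=> f; have /cvg_sup/(_ i) h : f --> f by apply: cvg_id.
move=> A; rewrite nbhsE => -[B [oB Bf] BA].
apply: (filterS (P := (fun x => x i) @^-1` B)); first by move=> x /BA.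
by apply: h; exists ((fun x => x i) @^-1` B); split => //; exists B.
Qed.

Let continuous_prod (T : topologicalType) (h : T -> prod_topology E) :
  (forall i, continuous (fun t => h t i)) -> continuous h.
Proof.
move=> hc t; apply/cvg_sup => i A.
case=> B [[C oC <-] Cht] BA.
apply: (filterS (P := (fun s => h s i) @^-1` C)) => [s /BA //|].
by apply: hc; exact: open_nbhs_nbhs.
Qed.

Let prod_mulg_continuous :
  continuous (fun u : prod_topology E * prod_topology E => u.1 * u.2).
Proof.
apply: continuous_prod => i u.
apply: (@continuous2_cvg _ _ _ _ _ _
  (fun u : prod_topology E * prod_topology E => u.1 i)
  (fun u : prod_topology E * prod_topology E => u.2 i) (fun a b => a * b)).
- exact: (@mulg_continuous (E i) (u.1 i, u.2 i)).
- by apply: (cvg_comp fst (fun x => x i)); [exact: cvg_fst|exact: continuous_coord].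
- by apply: (cvg_comp snd (fun x => x i)); [exact: cvg_snd|exact: continuous_coord].
Qed.

Let prod_invg_continuous : continuous (fun x => x^-1).
Proof.
apply: continuous_prod => i x.
apply: (cvg_comp (fun x => x i) (fun a => a^-1)); first exact: continuous_coord.
exact: (@invg_continuous (E i)).
Qed.

HB.instance Definition _ := isTopologicalGroup.Build (prod_topology E)
  prod_mulg_continuous prod_invg_continuous.

Definition direct_factor (j : I) : set (prod_topology E) :=
  [set x | forall i, i <> j -> x i = 1].

End DirectProduct.

Arguments direct_factor {I} E j.

Section Subgroups.
Context {G : topGroupType}.
Implicit Types (H K N : set G) (S : set G).

Definition is_subgroup H :=
  [/\ H 1, (forall x y, H x -> H y -> H (x * y)) & forall x, H x -> H x^-1].

Definition is_normal N := forall x g, N x -> N (x ^ g).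

Definition generated S : set G := smallest is_subgroup S.

Definition closed_generated S : set G :=
  smallest (fun H => is_subgroup H /\ closed H) S.

Definition set_mul H K : set G := [set x * y | x in H & y in K].

Definition left_coset (x : G) K : set G := [set x * y | y in K].

(* |H : K|, with the junk value 0 when there are infinitely many cosets *)
Definition group_index H K : nat := #|` fset_set [set left_coset x K | x in H]|%fset.

End Subgroups.

Section GroupProperties.
Variable G : topGroupType.

Definition topologically_fg := exists s : seq G, closed_generated [set` s] = setT.

Fixpoint derived_series (n : nat) : set G :=
  if n is m.+1 then
    generated [set [~ x, y] | x in derived_series m & y in derived_series m]
  else setT.

(* for profinite groups this agrees with the closed derived series reaching 1 *)
Definition soluble := exists n, derived_series n = [set 1].

Definition profinite :=
  [/\ compact [set: G], hausdorff_space G &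
      forall U : set G, nbhs 1 U ->
        exists H : set G, [/\ is_subgroup H, open H & H `<=` U]].

Definition pro_p (p : nat) :=
  profinite /\
  forall N : set G, is_subgroup N -> is_normal N -> open N ->
    exists k, group_index setT N = (p ^ k)%N.

End GroupProperties.

Section FreeProP.
Variable p : nat.

Definition continuous_hom (G H : topGroupType) (f : G -> H) :=
  continuous f /\ {morph f : x y / x * y}.

(* a family (not just its set of values) converging to 1 *)
Definition converges_to_1 (X : Type) (G : topGroupType) (f : X -> G) :=
  forall U : set G, is_subgroup U -> open U -> finite_set [set x | ~ U (f x)].

Definition is_free_pro_p_on (X : Type) (F : topGroupType) (iota : X -> F) :=
  converges_to_1 iota /\
  forall H : topGroupType, pro_p H p ->
  forall phi : X -> H, converges_to_1 phi ->
  exists! f : F -> H, continuous_hom f /\ (forall x, f (iota x) = phi x).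

Definition free_pro_p (F : topGroupType) :=
  pro_p F p /\ exists (X : Type) (iota : X -> F), is_free_pro_p_on iota.

End FreeProP.

(* Continuous cohomology, computed with inhomogeneous cochains. *)
Section Cohomology.
Local Open Scope ring_scope.
Variable G : topGroupType.

(* Continuity of a map to a discrete space *)
Definition locally_constant (T : topologicalType) (A : Type) (f : T -> A) :=
  forall x, \forall y \near x, f y = f x.

Record discrete_module (A : zmodType) (act : G -> A -> A) : Prop := {
  act1 : forall a, act 1%g a = a;
  actM : forall g h a, act (g * h)%g a = act g (act h a);
  actD : forall g a b, act g (a + b) = act g a + act g b;
  act_continuous : forall a, locally_constant (fun g => act g a)
}.

Definition power (n : nat) := prod_topology (fun _ : 'I_n => G).

Section Coefficients.
Variables (A : zmodType) (act : G -> A -> A).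

(* (x_0, ..., x_n) |-> (x_0, ..., x_k x_(k+1), ..., x_n) *)
Definition merge_at (n : nat) (k : 'I_n) (x : power n.+1) : power n :=
  fun i : 'I_n =>
    if (i < k)%N then x (widen_ord (leqnSn n) i)
    else if i == k then (x (widen_ord (leqnSn n) i) * x (lift ord0 i))%g
    else x (lift ord0 i).

Definition differential (n : nat) (f : power n -> A) (x : power n.+1) : A :=
  act (x ord0) (f (fun i => x (lift ord0 i)))
  + \sum_(k < n) f (merge_at k x) *~ (-1) ^+ k.+1
  + f (fun i => x (widen_ord (leqnSn n) i)) *~ (-1) ^+ n.+1.

Definition cocycle (n : nat) (f : power n -> A) :=
  locally_constant f /\ forall x, differential f x = 0.

Definition coboundary (n : nat) : (power n -> A) -> Prop :=
  match n with
  | 0 => fun f => forall x, f x = 0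
  | m.+1 => fun f => exists h : power m -> A,
      locally_constant h /\ forall x, f x = differential h x
  end.

(* the elements of H^n(G, A), as cosets of coboundaries *)
Definition cohomology (n : nat) : set (set (power n -> A)) :=
  [set [set f' | cocycle f' /\ coboundary (f' \- f)] | f in [set f | cocycle f]].

End Coefficients.

Definition torsion (A : zmodType) := forall a : A, exists2 n, (0 < n)%N & a *+ n = 0.

(* cd(G) is the supremum over all primes l of cd_l(G), so the whole of H^q(G, A)
   has to vanish, for every discrete torsion module A. *)
Definition cd_le (n : nat) :=
  forall (A : zmodType) (act : G -> A -> A), discrete_module act -> torsion A ->
  forall q, (n < q)%N -> forall f : power q -> A, cocycle act f -> coboundary act f.

Definition cohomological_dimension (n : nat) :=
  cd_le n /\ forall m, cd_le m -> (n <= m)%N.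

Section FpCoefficients.
Variable p : nat.

Definition trivial_act (_ : G) (a : 'F_p) : 'F_p := a.

Definition dim_cohomology_Fp (n d : nat) :=
  exists2 c : 'I_d -> power n -> 'F_p,
    (forall i, cocycle trivial_act (c i)) &
    forall z, cocycle trivial_act z ->
      exists! k : 'rV['F_p]_d,
        coboundary trivial_act (fun x => z x - \sum_(i < d) k 0 i * c i x).

Definition cup (m n : nat) (a : power m -> 'F_p) (b : power n -> 'F_p)
    (x : power (m + n)) : 'F_p :=
  a (fun i => x (lshift n i)) * b (fun j => x (rshift m j)).

Definition cup11_nondegenerate :=
  (forall a : power 1 -> 'F_p, cocycle trivial_act a ->
    (forall b : power 1 -> 'F_p, cocycle trivial_act b ->
      coboundary trivial_act (cup a b)) -> coboundary trivial_act a) /\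
  (forall b : power 1 -> 'F_p, cocycle trivial_act b ->
    (forall a : power 1 -> 'F_p, cocycle trivial_act a ->
      coboundary trivial_act (cup a b)) -> coboundary trivial_act b).

Definition demushkin :=
  [/\ pro_p G p, cohomological_dimension 2,
      finite_set (@cohomology _ trivial_act 1), dim_cohomology_Fp 2 1 &
      cup11_nondegenerate].

End FpCoefficients.
End Cohomology.

Section Filtrations.
Context {G : topGroupType}.
Implicit Types (H V : set G) (S : nat -> set G).

(* a letter (k, e) stands for X_k if e = false, and for the inverse of X_k if
   e = true *)
Definition word := seq (nat * bool).

Definition eval_word (w : word) (h : nat -> G) : G :=
  \prod_(l <- w) (if l.2 then (h l.1)^-1 else h l.1).

Definition is_verbal_subgroup H V :=
  exists W : set word,
    V = closed_generated
          [set g | exists2 w, W w & exists2 h, (forall k, H (h k)) & g = eval_word w h].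

Definition is_filtration S :=
  [/\ forall i, [/\ is_subgroup (S i), is_normal (S i) & open (S i)],
      forall i, S i.+1 `<=` S i &
      \bigcap_i S i = [set 1]].

Definition iterated_verbal_filtration S :=
  [/\ is_filtration S, S 0 = setT & forall i, is_verbal_subgroup (S i) (S i.+1)].

End Filtrations.

Section HausdorffDimension.
Local Open Scope ring_scope.
Variables (R : realType) (p : nat) (G : topGroupType) (S : nat -> set G).

Definition logp (x : R) : R := ln x / ln p%:R.

(* the quotients lie in [0, 1] for a filtration by open normal subgroups of a
   profinite group, so the real-valued limit inferior is meaningful; the
   finitely many i with S i = G, where the quotient is 0 / 0 = 0, do not
   affect it when G is infinite *)
Definition hdim (H : set G) : R :=
  limn_inf (fun i =>
    logp (group_index (set_mul H (S i)) (S i))%:R / logp (group_index setT (S i))%:R).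

Definition normal_hspec : set R :=
  [set hdim N | N in [set N | [/\ is_subgroup N, is_normal N & closed N]]].

End HausdorffDimension.

Arguments hdim R p {G} S H.
Arguments normal_hspec R p {G} S.

(* Main.v *)
(* A factor E_j is big if it is free of rank at least 2 or Demushkin of rank at
   least 3; the other factors are metabelian and H^1(U, F_p) has dimension at
   most 2 for all their open subgroups U.  An open subgroup U of a big E_j has
   dim H^1(U, F_p) >= |E_j : U|, and U maps onto every finite p-group with at most
   a quarter as many generators: lift the generators along hyperbolic pairs
   for the cup product.  Now let the words W define V from U inside E_j, let
   B' be normal and contain the W-values of B in some other pro-p group, and let
   dim H^1(B, F_p) <= m with 4 K m <= |E_j : U|.  Then U maps onto (B / B')^K with
   V in the kernel, so that |B : B'|^K <= |U : V|.

   By this comparison the logarithmic indices of any two factors along the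
   filtration are either negligible with respect to each other or asymptotic, so
   the quotients defining alpha_j converge, with alpha_j = 0 for small factors; it
   also shows that a normal subgroup of a big factor that meets every term of
   the filtration non-trivially has full dimension there.  Finally open subgroups
   of a big factor have trivial centraliser, so a closed normal subgroup of G
   projecting non-trivially to E_j meets E_j in such a subgroup (by commutators),
   and its dimension is squeezed to the sum of the corresponding alpha_j. *)

Require Import Defs.
From HB Require Import structures.
From mathcomp Require Import all_boot all_order all_algebra all_fingroup all_solvable.
From mathcomp Require Import mxrepresentation mxabelem zify ring lra.
From mathcomp Require Import finmap all_classical all_reals all_analysis.

Set Implicit Arguments.
Unset Strict Implicit.
Unset Printing Implicit Defensive.

Import Order.TTheory GRing.Theory Num.Theory.
Import numFieldNormedType.Exports.
Local Open Scope classical_set_scope.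
Local Open Scope ring_scope.

(** * Dimensions of sets of vectors *)

(** The obstacle is that Demushkin groups are not projective: lifting a hom through a central
    extension by Z meets a class in H^2(U, Z). The kernel is therefore taken to be Z = [t, X] with t
    in the second centre of X. Multiplying a set-theoretic lift by powers of t adds to its cocycle a
    cup product with values in Z. This cancels the class if the homs carrying the generators have
    dual homs spanning an isotropic space: hence the hyperbolic pairs. These homs serve as
    exponents, so they must lift from F_p to Z/p^a. As H^2 has dimension at most 1, the liftable
    ones have codimension at most 1 in H^1; lifting to Z/p^2 also makes the cup form alternating on
    them when p = 2. What is needed about open subgroups is derived from G: a representation of a
    p-group over F_p is an iterated extension of trivial ones, so duality passes to all
    coefficients, and Shapiro's lemma turns coefficients into subgroups. As dim H^1(B, F_p) is at
    most a constant times the index of B, the comparison only requires that one logarithmic index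
    lead another by a constant, and such a lead persists. *)

Section Dimension.
Variable F : fieldType.
Implicit Types V W : lmodType F.

Definition lincomb V k (v : 'I_k -> V) (c : 'rV[F]_k) : V := \sum_i c 0 i *: v i.

Definition lin_indep V k (v : 'I_k -> V) := forall c, lincomb v c = 0 -> c = 0.

Definition subspace V (P : set V) :=
  P 0 /\ forall a x y, P x -> P y -> P (a *: x + y).

(** The spaces are function spaces of possibly infinite dimension, so dimensions are only bounded:
    from below by independent families inside the set, from above by spanning families, whose
    members may lie outside it. *)
Definition dim_ge V (P : set V) k :=
  exists v : 'I_k -> V, (forall i, P (v i)) /\ lin_indep v.

Definition spans V (P : set V) k (v : 'I_k -> V) := forall x, P x -> exists c, x = lincomb v c.

Definition dim_le V (P : set V) k := exists v : 'I_k -> V, spans P v.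

Definition linear_on V W (P : set V) (L : V -> W) :=
  forall a x y, P x -> P y -> L (a *: x + y) = a *: L x + L y.

Lemma lincomb0 V k (v : 'I_k -> V) : lincomb v 0 = 0.
Proof. by rewrite /lincomb big1 // => i _; rewrite mxE scale0r. Qed.

Lemma lincombP V k (v : 'I_k -> V) a c d :
  lincomb v (a *: c + d) = a *: lincomb v c + lincomb v d.
Proof.
rewrite /lincomb scaler_sumr -big_split /=; apply: eq_bigr => i _.
by rewrite !mxE scalerDl scalerA.
Qed.

Lemma lincomb_mul V k m (v : 'I_k -> V) (A : 'M[F]_(m, k)) c :
  lincomb (fun i => lincomb v (row i A)) c = lincomb v (c *m A).
Proof.
rewrite /lincomb; under eq_bigr => i _ do rewrite scaler_sumr.
rewrite exchange_big /=; apply: eq_bigr => j _.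
rewrite mxE scaler_suml; apply: eq_bigr => i _.
by rewrite mxE scalerA.
Qed.

Lemma lincomb_delta V k (v : 'I_k -> V) i : lincomb v (delta_mx 0 i) = v i.
Proof.
rewrite /lincomb (bigD1 i) //= big1 => [|j ji]; rewrite mxE eqxx ?eqxx /=.
  by rewrite scale1r addr0.
by rewrite (negbTE ji) scale0r.
Qed.

Lemma subspace_lincomb V (P : set V) k (v : 'I_k -> V) c :
  subspace P -> (forall i, P (v i)) -> P (lincomb v c).
Proof.
move=> [P0 PD] Pv; rewrite /lincomb; elim/big_ind: _ => // [x y Px Py|i _].
  by rewrite -[x]scale1r; apply: PD.
by rewrite -[_ *: _]addr0; apply: PD.
Qed.

Lemma linear_on0 V W (P : set V) (L : V -> W) : subspace P -> linear_on P L -> L 0 = 0.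
Proof.
move=> [P0 _] lL; have := lL 1 0 0 P0 P0.
by rewrite scaler0 addr0 scale1r => /(congr1 (fun z => z - L 0)); rewrite subrr addrK.
Qed.

Lemma linear_on_lincomb V W (P : set V) (L : V -> W) k (v : 'I_k -> V) c :
  subspace P -> linear_on P L -> (forall i, P (v i)) ->
  L (lincomb v c) = lincomb (L \o v) c.
Proof.
move=> sP lL Pv.
have L0 := linear_on0 sP lL.
rewrite /lincomb; suff [] : P (\sum_i c 0 i *: v i) /\
  L (\sum_i c 0 i *: v i) = \sum_i c 0 i *: (L \o v) i by [].
have [P0 PD] := sP.
elim/big_rec2: _ => // i y2 y1 _ [Py e]; split; first exact: PD.
by rewrite lL // e.
Qed.

Lemma dim_ge_le V (P : set V) a b : dim_ge P a -> dim_le P b -> (a <= b)%N.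
Proof.
move=> [v [Pv iv]] [w sw]; rewrite leqNgt; apply/negP => ba.
have /choice[A AE] : forall i, exists c, v i = lincomb w c by move=> i; apply: sw.
pose B := \matrix_i A i.
have vE c : lincomb v c = lincomb w (c *m B).
  rewrite -lincomb_mul; congr lincomb; apply/funext => i; by rewrite AE rowK.
have : kermx B != 0 by rewrite kermx_eq0 /row_free neq_ltn (leq_ltn_trans (rank_leq_col _)).
case/matrix0Pn => i [j] /eqP; apply.
have c0 : row i (kermx B) = 0.
  by apply: iv; rewrite vE -row_mul mulmx_ker row0 lincomb0.
by have /rowP/(_ j) := c0; rewrite !mxE.
Qed.

Definition fcons T k (x : T) (v : 'I_k -> T) (i : 'I_k.+1) : T := oapp v x (unlift ord0 i).

Lemma fcons0 T k (x : T) (v : 'I_k -> T) : fcons x v ord0 = x.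
Proof. by rewrite /fcons unlift_none. Qed.

Lemma fconsS T k (x : T) (v : 'I_k -> T) i : fcons x v (lift ord0 i) = v i.
Proof. by rewrite /fcons liftK. Qed.

Lemma lincomb_fcons V k x (v : 'I_k -> V) c :
  lincomb (fcons x v) c = c 0 ord0 *: x + lincomb v (\row_i c 0 (lift ord0 i)).
Proof.
rewrite /lincomb big_ord_recl fcons0; congr (_ + _); apply: eq_bigr => i _.
by rewrite fconsS mxE.
Qed.

Lemma lin_indep_fcons V k x (v : 'I_k -> V) :
  lin_indep v -> ~ (exists c, x = lincomb v c) -> lin_indep (fcons x v).
Proof.
move=> iv xv c; rewrite lincomb_fcons => e.
have c0 : c 0 ord0 = 0.
  apply: contrapT => /eqP c0; apply: xv.
  exists (- (c 0 ord0)^-1 *: (\row_i c 0 (lift ord0 i))).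
  have := lincombP v (- (c 0 ord0)^-1) (\row_i c 0 (lift ord0 i)) 0.
  rewrite lincomb0 !addr0 => ->.
  move/eqP: e; rewrite addrC addr_eq0 => /eqP ->.
  by rewrite scalerN scaleNr opprK scalerA mulVf // scale1r.
rewrite c0 scale0r add0r in e; have /rowP e' := iv _ e.
apply/rowP => i; rewrite mxE; case: (unliftP ord0 i) => [j ->|->//].
by have := e' j; rewrite !mxE.
Qed.

Definition is_basis V (P : set V) k (v : 'I_k -> V) :=
  [/\ forall i, P (v i), lin_indep v & spans P v].

Lemma dim_ge0 V (P : set V) : dim_ge P 0.
Proof. by exists (fun=> 0); split=> [[]//|c _]; apply/rowP => -[]. Qed.

(** A longest independent family spans. Bounding independent families is what [dim_le_im] can check:
    its spanning family may leave the set on which the map is linear. *)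
Lemma basis_exists V (P : set V) m : (forall k, dim_ge P k -> (k <= m)%N) ->
  exists r, (r <= m)%N /\ exists v : 'I_r -> V, is_basis P v.
Proof.
move=> bnd.
have ex : exists k, `[<dim_ge P k>] by exists 0%N; apply/asboolP; exact: dim_ge0.
have bd : forall k, `[<dim_ge P k>] -> (k <= m)%N by move=> k /asboolP /bnd.
case: (ex_maxnP ex bd) => r /asboolP dr mx; exists r; split; first exact: bnd.
case: dr => v [Pv iv]; exists v; split=> // x Px; apply: contrapT => nx.
have : (r.+1 <= r)%N; last by rewrite ltnn.
apply: mx; apply/asboolP; exists (fcons x v); split; last exact: lin_indep_fcons.
by move=> i; case: (unliftP ord0 i) => [j ->|->]; rewrite ?fcons0 ?fconsS.
Qed.

Lemma basis_dim_le V (P : set V) m : dim_le P m ->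
  exists r, (r <= m)%N /\ exists v : 'I_r -> V, is_basis P v.
Proof. by move=> sP; apply: basis_exists => k /dim_ge_le; apply. Qed.

Lemma dim_geS V (P Q : set V) k : P `<=` Q -> dim_ge P k -> dim_ge Q k.
Proof. by move=> PQ [v [Pv iv]]; exists v; split=> // i; apply/PQ. Qed.

Lemma dim_leS V (P Q : set V) k : P `<=` Q -> dim_le Q k -> dim_le P k.
Proof. by move=> PQ [v sv]; exists v => x /PQ /sv. Qed.

Lemma dim_ge_leq V (P : set V) k l : (l <= k)%N -> dim_ge P k -> dim_ge P l.
Proof.
move=> lk [v [Pv iv]]; exists (v \o widen_ord lk); split=> [i|c c0]; first exact: Pv.
pose d : 'rV[F]_k := \row_i (if insub (val i) is Some j then c 0 j else 0).
have dE i : d 0 (widen_ord lk i) = c 0 i by rewrite mxE /= valK.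
have /iv : lincomb v d = 0.
  rewrite -c0 /lincomb (bigID (fun i : 'I_k => (i < l)%N)) /= [X in _ + X]big1 ?addr0.
    rewrite (big_ord_narrow lk); apply: eq_bigr => i _; by rewrite dE.
  by move=> i li; rewrite mxE insubN ?scale0r.
by move/rowP => d0; apply/rowP => i; rewrite -dE d0 !mxE.
Qed.

Lemma dim_le_leq V (P : set V) k l : (k <= l)%N -> dim_le P k -> dim_le P l.
Proof.
move=> kl sP; have [r [rk [v [Pv iv sv]]]] := basis_dim_le sP.
have rl := leq_trans rk kl.
exists (fun i : 'I_l => if insub (val i) is Some j then v j else 0) => x /sv [c ->].
exists (\row_(i < l) (if insub (val i) is Some j then c 0 j else 0)).
rewrite /lincomb [RHS](bigID (fun i : 'I_l => (i < r)%N)) /= [X in _ = _ + X]big1 ?addr0.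
  rewrite (big_ord_narrow rl); apply: eq_bigr => i _; by rewrite mxE /= valK.
by move=> i li; rewrite insubN ?scaler0.
Qed.

Lemma lincomb_split V a b (v : 'I_a -> V) (w : 'I_b -> V) c :
  lincomb (fun i => match fintype.split i with inl j => v j | inr j => w j end) c =
  lincomb v (lsubmx c) + lincomb w (rsubmx c).
Proof.
rewrite /lincomb big_split_ord /=; congr (_ + _); apply: eq_bigr => i _;
  rewrite mxE; by rewrite ?(unsplitK (inl i)) ?(unsplitK (inr i)).
Qed.

Section RankNullity.
Variables (V W : lmodType F) (P : set V) (L : V -> W).
Hypotheses (sP : subspace P) (lL : linear_on P L).

Lemma dim_ge_ker_im a b : dim_ge [set x | P x /\ L x = 0] a -> dim_ge (L @` P) b ->
  dim_ge P (a + b).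
Proof.
move=> [v [Pv iv]] [w' [Pw' iw]].
have /choice[w wP] : forall i, exists x, P x /\ L x = w' i.
  by move=> i; by have [x Px e] := Pw' i; exists x.
exists (fun i => match fintype.split i with inl j => v j | inr j => w j end).
split=> [i|c]; first by case: fintype.split => j; [case: (Pv j)|case: (wP j)].
rewrite lincomb_split => e.
have Pv' i : P (v i) by case: (Pv i).
have Pw i : P (w i) by case: (wP i).
have r0 : rsubmx c = 0.
  apply: iw.
  have := congr1 L e; rewrite -[lincomb v _]scale1r lL; try exact: subspace_lincomb.
  rewrite scale1r !(linear_on_lincomb _ sP lL) //.
  have -> : L \o v = (fun=> 0) by apply/funext => i /=; case: (Pv i).
  have -> : L \o w = w' by apply/funext => i /=; case: (wP i).
  rewrite {1}/lincomb big1 => [|i _]; last by rewrite scaler0.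
  by rewrite add0r (linear_on0 sP lL).
rewrite r0 lincomb0 addr0 in e.
by rewrite -[c]hsubmxK (iv _ e) r0 row_mx0.
Qed.

Lemma dim_le_ker_im a b : dim_le [set x | P x /\ L x = 0] a -> dim_le (L @` P) b ->
  dim_le P (a + b).
Proof.
move=> [v sv] sI.
(* The family given for the image may leave it; a basis inside the image can be lifted to [P]. *)
have [r [rb [w' [Pw' _ sw]]]] := basis_dim_le sI.
suff : dim_le P (a + r) by apply: dim_le_leq; rewrite leq_add2l.
have /choice[w wP] : forall i, exists x, P x /\ L x = w' i.
  by move=> i; by have [x Px e] := Pw' i; exists x.
have Pw i : P (w i) by case: (wP i).
exists (fun i => match fintype.split i with inl j => v j | inr j => w j end) => x Px.
have [d dE] : exists d, L x = lincomb w' d by apply: sw; exists x.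
have [c cE] : exists c, x - lincomb w d = lincomb v c.
  have Pl := subspace_lincomb d sP Pw.
  apply: sv; split.
    by rewrite addrC -scaleN1r; apply: sP.2.
  rewrite addrC -scaleN1r lL // dE (linear_on_lincomb _ sP lL) //.
  have -> : L \o w = w' by apply/funext => i /=; case: (wP i).
  by rewrite scaleN1r addrC subrr.
exists (row_mx c d); rewrite lincomb_split row_mxKl row_mxKr -cE.
by rewrite subrK.
Qed.

End RankNullity.

Lemma dim_ge_im V W (P : set V) (L : V -> W) a b : subspace P -> linear_on P L ->
  dim_ge P a -> dim_le [set x | P x /\ L x = 0] b -> dim_ge (L @` P) (a - b).
Proof.
move=> sP lL [v [Pv iv]] kb.
(* [P] itself may have infinite dimension; the span of the [a] independent vectors has an image with
   a finite basis. *)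
pose Q := [set x | exists c, x = lincomb v c].
have QP : Q `<=` P by move=> _ [c ->]; apply: subspace_lincomb.
have [r [ra [w [Pw iw sw]]]] : exists r, (r <= a)%N /\ exists w : 'I_r -> W, is_basis (L @` Q) w.
  apply: basis_dim_le; exists (L \o v) => _ [_ [c ->] <-]; exists c.
  exact: (linear_on_lincomb _ sP lL).
suff abr : (a <= b + r)%N.
  apply: (@dim_ge_leq _ _ r); first by rewrite leq_subLR.
  exists w; split=> // i; have [x Qx <-] := Pw i; exists x => //; exact: QP.
have sQ : subspace Q.
  split; first by exists 0; rewrite lincomb0.
  by move=> t _ _ [c ->] [d ->]; exists (t *: c + d); rewrite lincombP.
have dQ : dim_ge Q a.
  exists v; split=> // i; exists (delta_mx 0 i); by rewrite lincomb_delta.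
apply: (dim_ge_le dQ).
have lQ : linear_on Q L by move=> t x y /QP Px /QP Py; apply: lL.
have kQ : dim_le [set x | Q x /\ L x = 0] b.
  by apply: dim_leS kb => x [/QP].
have iQ : dim_le (L @` Q) r by exists w.
exact: (dim_le_ker_im sQ lQ kQ iQ).
Qed.

Lemma dim_le_im V W (P : set V) (L : V -> W) a b : subspace P -> linear_on P L ->
  dim_le P a -> dim_ge [set x | P x /\ L x = 0] b -> dim_le (L @` P) (a - b).
Proof.
move=> sP lL aP kb.
have [r [ra [w [Pw iw sw]]]] : exists r, (r <= a)%N /\ exists w : 'I_r -> W, is_basis (L @` P) w.
  have [v sv] := aP.
  apply: basis_exists => k [w' [Pw' iw']].
  apply: (dim_ge_le _ aP); rewrite -[k]add0n; apply: (dim_ge_ker_im sP lL).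
    exact: dim_ge0.
  by exists w'.
apply: (@dim_le_leq _ _ r); last by exists w.
have : dim_ge P (b + r) by apply: (dim_ge_ker_im sP lL) => //; exists w.
by move=> /dim_ge_le /(_ aP); lia.
Qed.

(* The hypothesis says that [Q] has codimension at most one in [P]. *)
Lemma dim_ge_codim1 V (P Q : set V) k : subspace P ->
  (forall x y, P x -> P y -> ~ Q x -> exists c, Q (y - c *: x)) ->
  dim_ge P k.+1 -> dim_ge Q k.
Proof.
move=> sP cod [v [Pv iv]].
have [allQ|/existsNP[i0 ni0]] := pselect (forall i, Q (v i)).
  by apply: (@dim_ge_leq _ _ k.+1) => //; exists v.
have /choice[c cE] : forall j, exists c, Q (v (lift i0 j) - c *: v i0).
  by move=> j; apply: cod.
exists (fun j => v (lift i0 j) - c j *: v i0); split=> // d e.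
pose d' : 'rV[F]_k.+1 := \row_i (if unlift i0 i is Some j then d 0 j else - \sum_j d 0 j * c j).
have : lincomb v d' = 0.
  rewrite -e /lincomb (bigD1_ord i0) //= mxE unlift_none scaleNr scaler_suml.
  rewrite [RHS](eq_bigr (fun j => d 0 j *: v (lift i0 j) - (d 0 j * c j) *: v i0)).
    by rewrite sumrB addrC; congr (_ - _); apply: eq_bigr => j _; rewrite mxE liftK.
  by move=> j _; rewrite scalerBr scalerA.
move/iv/rowP => d0; apply/rowP => j.
by have := d0 (lift i0 j); rewrite !mxE liftK.
Qed.

Lemma dim_le_proper V (P Q : set V) k : subspace P -> subspace Q -> Q `<=` P ->
  (exists2 x, P x & ~ Q x) -> dim_le P k.+1 -> dim_le Q k.
Proof.
move=> sP sQ QP [x Px nQx] dP.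
have [r [rk [w [Pw iw sw]]]] := basis_dim_le (dim_leS QP dP).
suff : (r.+1 <= k.+1)%N by rewrite ltnS => rk'; apply: (dim_le_leq rk'); exists w.
apply: (dim_ge_le _ dP); exists (fcons x w); split.
  by move=> i; case: (unliftP ord0 i) => [j ->|->]; rewrite ?fcons0 ?fconsS //; exact: QP.
apply: lin_indep_fcons => // -[c xE]; apply: nQx; rewrite xE.
exact: subspace_lincomb.
Qed.

End Dimension.

(** * Cochains factoring through a chain of normal subgroups *)

(** The content of [is_subgroup] for abstract groups. The algebra that follows uses no topology: a
    chain of normal subgroups stands for a base of neighbourhoods of 1. *)
Definition sgrp (G : groupType) (H : set G) :=
  [/\ H 1%g, (forall x y, H x -> H y -> H (x * y)%g) & forall x, H x -> H x^-1%g].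

Record normal_chain (G : groupType) (N : nat -> set G) : Prop := NormalChain {
  chain_sgrp : forall k, sgrp (N k);
  chain_normal : forall k x g, N k x -> N k (x ^ g)%g;
  chain_dec : forall k, N k.+1 `<=` N k
}.

Section Smooth.
Variables (G : groupType) (N : nat -> set G).
Hypothesis ncN : normal_chain N.

(* [f] factors through some quotient [G / N k]; for a filtration of a compact
   group by open normal subgroups this is local constancy. *)
Definition smooth T (f : G -> T) :=
  exists k, forall x n, N k n -> f (x * n)%g = f x.

Definition smooth2 T (c : G -> G -> T) :=
  exists k, forall x y n m, N k n -> N k m -> c (x * n)%g (y * m)%g = c x y.

Lemma chain_le k l : (k <= l)%N -> N l `<=` N k.
Proof.
move=> /subnK <-; elim: (l - k)%N => // m IH x; rewrite addSn => /(chain_dec ncN).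
exact: IH.
Qed.

Lemma smooth_cst T (t : T) : smooth (fun=> t).
Proof. by exists 0%N. Qed.

Lemma smooth_comp T T' (h : T -> T') f : smooth f -> smooth (fun x => h (f x)).
Proof. by move=> [k fk]; exists k => x n nk; rewrite fk. Qed.

Lemma smooth_pair T T' (f : G -> T) (g : G -> T') :
  smooth f -> smooth g -> smooth (fun x => (f x, g x)).
Proof.
move=> [k fk] [l gl]; exists (maxn k l) => x n nn.
by rewrite fk ?gl //; apply: chain_le nn; rewrite ?leq_maxl ?leq_maxr.
Qed.

Lemma smooth_op T T' T'' (h : T -> T' -> T'') f g :
  smooth f -> smooth g -> smooth (fun x => h (f x) (g x)).
Proof. by move=> sf sg; apply: (smooth_comp (fun t => h t.1 t.2) (smooth_pair sf sg)). Qed.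

Lemma smooth_common (I : finType) T (f : I -> G -> T) : (forall i, smooth (f i)) ->
  exists k, forall i x n, N k n -> f i (x * n)%g = f i x.
Proof.
move=> /choice[k fk]; exists (\max_i k i)%N => i x n nk.
by apply: fk; apply: chain_le nk; exact: leq_bigmax.
Qed.

Lemma smooth_sum (I : finType) (V : nmodType) (f : I -> G -> V) :
  (forall i, smooth (f i)) -> smooth (fun x => \sum_i f i x).
Proof.
by move=> /smooth_common[k fk]; exists k => x n nk; apply: eq_bigr => i _; rewrite fk.
Qed.

Lemma smooth_mx m n T (f : G -> 'M[T]_(m, n)) :
  (forall i j, smooth (fun x => f x i j)) -> smooth f.
Proof.
move=> sf; have [k fk] := @smooth_common ('I_m * 'I_n)%type T
  (fun ij x => f x ij.1 ij.2) (fun ij => sf ij.1 ij.2).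
by exists k => x g gk; apply/matrixP => i j; have := fk (i, j) x g gk.
Qed.

Lemma smooth2_cst T (t : T) : smooth2 (fun _ _ => t).
Proof. by exists 0%N. Qed.

Lemma smooth2_comp T T' (h : T -> T') f : smooth2 f -> smooth2 (fun x y => h (f x y)).
Proof. by move=> [k fk]; exists k => x y n m nk mk; rewrite fk. Qed.

Lemma smooth2_op T T' T'' (h : T -> T' -> T'') f g :
  smooth2 f -> smooth2 g -> smooth2 (fun x y => h (f x y) (g x y)).
Proof.
move=> [k fk] [l gl]; exists (maxn k l) => x y n m nn mm.
by rewrite fk ?gl //; (apply: chain_le nn || apply: chain_le mm);
  rewrite ?leq_maxl ?leq_maxr.
Qed.

Lemma smooth2_fst T (f : G -> T) : smooth f -> smooth2 (fun x _ => f x).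
Proof. by move=> [k fk]; exists k => x y n m nk mk; rewrite fk. Qed.

Lemma smooth2_snd T (f : G -> T) : smooth f -> smooth2 (fun _ y => f y).
Proof. by move=> [k fk]; exists k => x y n m nk mk; rewrite fk. Qed.

Lemma smooth2_mul T (f : G -> T) : smooth f -> smooth2 (fun x y => f (x * y)%g).
Proof.
move=> [k fk]; exists k => x y n m nk mk.
have -> : (x * n * (y * m) = x * y * ((n ^ y) * m))%g.
  by rewrite -[(x * n * _)%g]mulgA [(n * (_ * _))%g]mulgA (conjgC n y) !mulgA.
have [_ NM _] := chain_sgrp ncN k; apply: fk; apply: NM => //; exact: chain_normal.
Qed.

End Smooth.

#[export] Hint Resolve smooth_cst smooth2_cst : core.

Section Cochains.
Variables (p : nat) (G : groupType) (N : nat -> set G).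
Hypothesis ncN : normal_chain N.
Local Notation F := 'F_p.
Local Notation smooth := (smooth N).
Local Notation smooth2 := (smooth2 N).
Implicit Types (U : set G) (f : G -> F) (c : G -> G -> F).

(** Cochains on [U] are functions on the whole group whose identities are required on [U] only, so
    that subgroups need no type of their own. *)
Definition hom_on U f :=
  smooth f /\ forall x y, U x -> U y -> f (x * y)%g = f x + f y.

Definition cocycle_on U c := smooth2 c /\ forall x y z, U x -> U y -> U z ->
  c x y + c (x * y)%g z = c y z + c x (y * z)%g.

Definition coboundary_on U c := exists2 s : G -> F, smooth s &
  forall x y, U x -> U y -> c x y = s x + s y - s (x * y)%g.

Definition cupf f g : G -> G -> F := fun x y => f x * g y.

Lemma eq_coboundary_on U c c' : (forall x y, U x -> U y -> c x y = c' x y) ->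
  coboundary_on U c -> coboundary_on U c'.
Proof. by move=> e [s ss sE]; exists s => // x y Ux Uy; rewrite -e ?sE. Qed.

Lemma coboundary_lin U a c c' : coboundary_on U c -> coboundary_on U c' ->
  coboundary_on U (fun x y => a * c x y + c' x y).
Proof.
move=> [s ss sE] [s' ss' sE']; exists (fun x => a * s x + s' x).
  exact: (smooth_op ncN (fun u v => a * u + v)).
move=> x y Ux Uy; rewrite sE // sE' //; ring.
Qed.

Lemma coboundary0 U : coboundary_on U (fun _ _ => 0).
Proof. by exists (fun=> 0) => // x y _ _; rewrite addr0 subr0. Qed.

Lemma coboundaryZ U a c : coboundary_on U c -> coboundary_on U (fun x y => a * c x y).
Proof.
move=> /(coboundary_lin a)/(_ (coboundary0 U)).
by apply: eq_coboundary_on => x y _ _; rewrite addr0.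
Qed.

Lemma coboundaryD U c c' : coboundary_on U c -> coboundary_on U c' ->
  coboundary_on U (fun x y => c x y + c' x y).
Proof.
move=> /(coboundary_lin 1) h /h.
by apply: eq_coboundary_on => x y _ _; rewrite mul1r.
Qed.

Lemma coboundaryB U c c' : coboundary_on U c -> coboundary_on U c' ->
  coboundary_on U (fun x y => c x y - c' x y).
Proof.
move=> h /(coboundary_lin (-1)) /(_ h).
by apply: eq_coboundary_on => x y _ _; rewrite mulN1r addrC.
Qed.

Lemma coboundary_sum U (I : finType) (c : I -> G -> G -> F) :
  (forall i, coboundary_on U (c i)) -> coboundary_on U (fun x y => \sum_i c i x y).
Proof.
move=> h; elim: (index_enum I) => [|i r IH].
  by apply: eq_coboundary_on (coboundary0 U) => x y _ _; rewrite big_nil.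
apply: eq_coboundary_on (coboundaryD (h i) IH) => x y _ _.
by rewrite big_cons.
Qed.

Lemma cocycle_lin U a c c' : cocycle_on U c -> cocycle_on U c' ->
  cocycle_on U (fun x y => a * c x y + c' x y).
Proof.
move=> [s cE] [s' cE']; split; first exact: (smooth2_op ncN (fun u v => a * u + v)).
by move=> x y z Ux Uy Uz; rewrite addrACA -mulrDr cE // cE' //; ring.
Qed.

Lemma cupf_cocycle U f g : hom_on U f -> hom_on U g -> cocycle_on U (cupf f g).
Proof.
move=> [sf fM] [sg gM]; split.
  apply: (smooth2_op ncN (fun u v => u * v)); first exact: smooth2_fst.
  exact: smooth2_snd.
move=> x y z Ux Uy Uz; rewrite /cupf fM // gM //; ring.
Qed.

(** The primitive is minus the pointwise product of [f] and [g]. *)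
Lemma cupf_skew U f g : hom_on U f -> hom_on U g ->
  coboundary_on U (fun x y => cupf f g x y + cupf g f x y).
Proof.
move=> [sf fM] [sg gM]; exists (fun x => - (f x * g x)).
  exact: (smooth_op ncN (fun u v => - (u * v))).
move=> x y Ux Uy; rewrite /cupf fM // gM //; ring.
Qed.

End Cochains.

Lemma eq_smooth (G : groupType) (N : nat -> set G) T (f g : G -> T) :
  g =1 f -> smooth N f -> smooth N g.
Proof. by move=> /funext ->. Qed.

Lemma eq_smooth2 (G : groupType) (N : nat -> set G) T (f g : G -> G -> T) :
  g =2 f -> smooth2 N f -> smooth2 N g.
Proof. by move=> e [k fk]; exists k => x y n m nk mk; rewrite !e fk. Qed.

(** * Duality with coefficients in representations *)

Section Modules.
Variables (p : nat) (G : groupType) (N : nat -> set G).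
Hypothesis p_pr : prime p.
Hypothesis ncN : normal_chain N.
Local Notation F := 'F_p.
Local Notation smooth := (smooth N).
Local Notation smooth2 := (smooth2 N).

Record is_rep d (rho : G -> 'M[F]_d) : Prop := IsRep {
  rep1 : rho 1%g = 1%:M;
  repM : forall x y, rho (x * y)%g = rho x *m rho y;
  rep_smooth : smooth rho
}.

(** Rows form the dual of the module of columns, with the group acting on the right. A row times a
    column is a scalar, so [cupm] is a cup product with values in the trivial module. *)
Definition row_cocycle d (rho : G -> 'M[F]_d) (a : G -> 'rV[F]_d) :=
  smooth a /\ forall x y, a (x * y)%g = a x *m rho y + a y.

Definition col_cocycle d (rho : G -> 'M[F]_d) (b : G -> 'cV[F]_d) :=
  smooth b /\ forall x y, b (x * y)%g = b x + rho x *m b y.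

Definition col_coboundary d (rho : G -> 'M[F]_d) (b : G -> 'cV[F]_d) :=
  exists v, forall x, b x = rho x *m v - v.

Definition cupm d (a : G -> 'rV[F]_d) (b : G -> 'cV[F]_d) : G -> G -> F :=
  fun x y => (a x *m b y) 0 0.

Definition row_cocycle2 d (rho : G -> 'M[F]_d) (C : G -> G -> 'rV[F]_d) :=
  smooth2 C /\ forall x y z,
  C x y *m rho z + C (x * y)%g z = C y z + C x (y * z)%g.

Definition row_coboundary2 d (rho : G -> 'M[F]_d) (C : G -> G -> 'rV[F]_d) :=
  exists2 S, smooth S & forall x y, C x y = S x *m rho y + S y - S (x * y)%g.

Definition ext_rep d (rho : G -> 'M[F]_d) (kappa : G -> 'cV[F]_d) (x : G) : 'M[F]_(1 + d) :=
  block_mx 1%:M 0 (kappa x) (rho x).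

Definition p_images := forall (gT : finGroupType) (f : G -> gT) (H : {group gT}),
  smooth f -> {morph f : x y / (x * y)%g} -> (forall x, f x \in H) ->
  (forall h, h \in H -> exists x, f x = h) -> (p.-group H)%g.

Hypothesis pimg : p_images.

Lemma rep_unit d (rho : G -> 'M[F]_d) x : is_rep rho -> rho x \in unitmx.
Proof.
move=> [r1 rM _]; have : rho x *m rho x^-1%g = 1%:M by rewrite -rM mulgV.
by case/mulmx1_unit => u _; exact: u.
Qed.

(** The image is a finite p-group of invertible matrices, and a p-group acting on a non-zero space
    in characteristic p fixes a non-zero vector. *)
Lemma fixed_row d (rho : G -> 'M[F]_d.+1) : is_rep rho ->
  exists2 v : 'rV_d.+1, v != 0 & forall x, v *m rho x = v.
Proof.
move=> rr; have [r1 rM rs] := rr.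
have GE (u : {'GL_d.+1[F]}) : GLval u = val u by case: u.
have [f fE] : exists f : G -> {'GL_d.+1[F]}, forall x, val (f x) = rho x.
  exists (fun x => insubd (1%g : {'GL_d.+1[F]}) (rho x)) => x.
  by rewrite insubdK //; exact: rep_unit.
have fM : {morph f : x y / (x * y)%g}.
  by move=> x y; apply: val_inj; rewrite fE rM -!fE.
have gH : group_set [set h | `[<exists x, f x = h>]]%SET.
  apply/group_setP; split.
    rewrite inE; apply/asboolP; exists 1%g.
    by apply: (@mulgI _ (f 1%g)); rewrite -fM !mulg1.
  move=> h k; rewrite !finset.in_set => /asboolP[x xE] /asboolP[y yE]; apply/asboolP.
  by exists (x * y)%g; rewrite fM xE yE.
pose H := Group gH.
have pH : (p.-group H)%g.
  apply: (pimg (f := f)) => //.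
  - by case: rs => k rk; exists k => x n nk; apply: val_inj; rewrite !fE rk.
  - by move=> x; rewrite inE; apply/asboolP; exists x.
  - by move=> h; rewrite inE => /asboolP.
have cF : p \in [pchar F] by apply: pchar_Fp.
have := rfix_pgroup_pchar cF (GLrepr F d) (n := d.+1) (ltn0Sn _) pH (finset.subsetT _).
set W := rfix_mx _ _; move=> W0; exists (nz_row W); first by rewrite nz_row_eq0.
have /rfix_mxP fx := nz_row_sub W => x; have := fx (f x); rewrite /= GE fE; apply.
by rewrite inE; apply/asboolP; exists x.
Qed.

Lemma ext_rep_is d (rho : G -> 'M[F]_d) kappa :
  is_rep rho -> col_cocycle rho kappa -> is_rep (ext_rep rho kappa).
Proof.
move=> [r1 rM rs] [ks kM]; split.
- have k1 : kappa 1%g = 0.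
    by have := kM 1%g 1%g; rewrite mulg1 r1 mul1mx => /(congr1 (fun z => z - kappa 1%g)); rewrite subrr addrK.
  by rewrite /ext_rep r1 k1 -scalar_mx_block.
- move=> x y; by rewrite /ext_rep mulmx_block !mul1mx !mul0mx !mulmx1 !mulmx0 !addr0 add0r rM kM.
- exact: (smooth_op ncN (fun k r => block_mx 1%:M 0 k r) ks rs).
Qed.

(** A fixed row, taken as first basis vector, brings [rho] into lower triangular block form with 1
    in the corner; the block below the corner is then a column cocycle. So every representation
    arises from dimension 0 by extensions and changes of basis. *)
Lemma rep_ind (Q : forall d, (G -> 'M[F]_d) -> Prop) :
  (forall rho : G -> 'M[F]_0, Q 0%N rho) ->
  (forall d (rho : G -> 'M[F]_d) kappa, is_rep rho -> col_cocycle rho kappa ->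
     Q d rho -> Q (1 + d)%N (ext_rep rho kappa)) ->
  (forall d (B : 'M[F]_d) rho, B \in unitmx -> is_rep rho -> Q d rho ->
     Q d (fun x => B *m rho x *m invmx B)) ->
  forall d (rho : G -> 'M[F]_d), is_rep rho -> Q d rho.
Proof.
move=> Q0 Qext Qconj; elim=> [|d IH] rho rr; first exact: Q0.
have [v v0 vfix] := fixed_row rr.
have [r1 rM rs] := rr.
(* An invertible matrix whose first row is proportional to [v]. *)
pose B : 'M[F]_(1 + d) := row_ebase v.
have uB : B \in unitmx by exact: row_ebase_unit.
pose rho' x : 'M[F]_(1 + d) := B *m rho x *m invmx B.
have rho'M x y : rho' (x * y)%g = rho' x *m rho' y.
  by rewrite /rho' rM !mulmxA mulmxKV.
have rs' : smooth rho' by apply: (smooth_comp (fun M => B *m M *m invmx B)).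
pose e0 : 'rV[F]_(1 + d) := delta_mx 0 0.
have e0B : exists2 c : F, c != 0 & c *: (e0 *m B) = v.
  have rk : \rank v = 1%N by rewrite rank_rV v0.
  exists (col_ebase v 0 0).
    have := col_ebase_unit v; rewrite unitmxE (_ : \det _ = col_ebase v 0 0) ?unitfE //.
    by rewrite [col_ebase v]mx11_scalar det_scalar1 !mxE.
  rewrite -[RHS]mulmx_ebase rk -/B scalemxAl; set c := col_ebase v 0 0.
  suff -> : col_ebase v *m pid_mx 1 = c *: e0 by [].
  rewrite [col_ebase v]mx11_scalar mul_scalar_mx -/c; apply/rowP => j.
  by rewrite !mxE /= ltnS leqn0 andbT eq_sym.
have e0fix x : e0 *m rho' x = e0.
  have [c c0 cE] := e0B.
  have : (e0 *m B) *m rho x = e0 *m B.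
    by apply: (scalerI c0); rewrite scalemxAl cE.
  by rewrite /rho' !mulmxA => ->; rewrite mulmxK.
pose kappa x := dlsubmx (rho' x); pose rho'' x := drsubmx (rho' x).
have rho'E x : rho' x = ext_rep rho'' kappa x.
  have r0 j : rho' x 0 j = (j == 0)%:R.
    by have /rowP/(_ j) := e0fix x; rewrite -rowE !mxE eqxx.
  have l0 : lshift d 0 = 0 :> 'I_(1 + d) by apply: val_inj.
  rewrite /ext_rep -[LHS]submxK; congr block_mx.
    by apply/matrixP => i j; rewrite !ord1 [LHS]mxE [LHS]mxE l0 r0 mxE.
  by apply/matrixP => i j; rewrite !ord1 [LHS]mxE [LHS]mxE l0 r0 mxE.
have blk x y : ext_rep rho'' kappa (x * y)%g =
    ext_rep rho'' kappa x *m ext_rep rho'' kappa y by rewrite -!rho'E.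
have k_s : smooth kappa by apply: (smooth_comp (fun M : 'M[F]_(1 + d) => dlsubmx M)).
have r_s : smooth rho'' by apply: (smooth_comp (fun M : 'M[F]_(1 + d) => drsubmx M)).
have rr'' : is_rep rho''.
  split=> //.
    by rewrite /rho'' /rho' r1 mulmx1 mulmxV // scalar_mx_block block_mxKdr.
  move=> x y; have := blk x y; rewrite /ext_rep mulmx_block => /eq_block_mx[_ _ _ ->].
  by rewrite mulmx0 add0r.
have kk : col_cocycle rho'' kappa.
  split=> // x y; have := blk x y; rewrite /ext_rep mulmx_block => /eq_block_mx[_ _ -> _].
  by rewrite mulmx1.
have rr' : is_rep (ext_rep rho'' kappa) by exact: ext_rep_is.
have Q' : Q _ (ext_rep rho'' kappa) by apply: Qext => //; exact: IH.
have := @Qconj _ (invmx B) _ _ rr' Q'.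
rewrite unitmx_inv => /(_ uB); congr (Q _ _); apply/funext => x.
by rewrite -rho'E invmxK /rho' !mulmxA mulVmx // mul1mx mulmxKV.
Qed.

End Modules.

Section Duality.
Variables (p : nat) (G : groupType) (N : nat -> set G).
Hypothesis p_pr : prime p.
Hypothesis ncN : normal_chain N.
Hypothesis pimg : p_images p N.
Local Notation F := 'F_p.
Local Notation smooth := (smooth N).
Local Notation smooth2 := (smooth2 N).
Local Notation cob := (@coboundary_on p G N setT).
Local Notation coc := (@cocycle_on p G N setT).
Local Notation hom1 := (@hom_on p G N setT).
Local Notation is_rep := (@is_rep p G N _).
Local Notation row_cocycle := (@row_cocycle p G N _).
Local Notation col_cocycle := (@col_cocycle p G N _).
Local Notation row_cocycle2 := (@row_cocycle2 p G N _).
Local Notation row_coboundary2 := (@row_coboundary2 p G N _).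

(* Demushkin groups satisfy [H2_le1] and [cup_nondegenerate], free pro-p groups
   satisfy [H2_zero]. *)
Definition H2_le1 (U : set G) := forall c c' : G -> G -> F,
  cocycle_on N U c -> cocycle_on N U c' -> ~ coboundary_on N U c ->
  exists lam, coboundary_on N U (fun x y => c' x y - lam * c x y).

Definition H2_zero (U : set G) := forall c : G -> G -> F,
  cocycle_on N U c -> coboundary_on N U c.

Definition cup_nondegenerate (U : set G) := forall b : G -> F, hom_on N U b ->
  (forall a, hom_on N U a -> coboundary_on N U (cupf a b)) -> forall x, U x -> b x = 0.

Lemma cupm_cocycle d (rho : G -> 'M[F]_d) a b :
  row_cocycle rho a -> col_cocycle rho b -> coc (cupm a b).
Proof.
move=> [sa aM] [sb bM]; split.
  apply: (smooth2_op ncN (fun (u : 'rV_d) (v : 'cV_d) => (u *m v) 0 0)).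
    exact: smooth2_fst.
  exact: smooth2_snd.
move=> x y z _ _ _; rewrite /cupm aM bM mulmxDl mulmxDr mulmxA !mxE /=.
ring.
Qed.

Lemma row_cocycle_lin d (rho : G -> 'M[F]_d) t a a' :
  row_cocycle rho a -> row_cocycle rho a' -> row_cocycle rho (fun x => t *: a x + a' x).
Proof.
move=> [sa aM] [sa' aM']; split; first exact: (smooth_op ncN (fun u v => t *: u + v)).
move=> x y; rewrite aM aM' mulmxDl -scalemxAl scalerDr !addrA; congr (_ + _).
by rewrite -!addrA; congr (_ + _); rewrite addrC.
Qed.

Lemma row_cocycle0 d (rho : G -> 'M[F]_d) : row_cocycle rho (fun=> 0).
Proof. by split=> // x y; rewrite mul0mx addr0. Qed.

Lemma col_cocycle_lin d (rho : G -> 'M[F]_d) t a a' :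
  col_cocycle rho a -> col_cocycle rho a' -> col_cocycle rho (fun x => t *: a x + a' x).
Proof.
move=> [sa aM] [sa' aM']; split; first exact: (smooth_op ncN (fun u v => t *: u + v)).
move=> x y; rewrite aM aM' mulmxDr -scalemxAr scalerDr !addrA; congr (_ + _).
by rewrite -!addrA; congr (_ + _); rewrite addrC.
Qed.

Section Extension.
Variables (d : nat) (rho : G -> 'M[F]_d) (kappa : G -> 'cV[F]_d).
Local Notation R := (ext_rep rho kappa).

(** Cupping with [kappa] is the connecting map of the extension: a row cocycle of [rho] extends to
    [ext_rep] when its cup product with [kappa] is a coboundary, the added entry being a primitive
    up to sign. [ext_row_inv] is the converse. *)
Lemma ext_row_cocycle a0 a : row_cocycle rho a ->
  smooth a0 -> (forall x y, cupm a kappa x y = a0 (x * y)%g - a0 x - a0 y) ->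
  row_cocycle R (fun x => row_mx (a0 x)%:M (a x)).
Proof.
move=> [sa aM] s0 e; split.
  exact: (smooth_op ncN (fun t v => row_mx t%:M v)).
move=> x y; rewrite /ext_rep mul_row_block mulmx1 mulmx0 add0r add_row_mx -aM.
congr row_mx; have := e x y; rewrite /cupm; move: (a x *m kappa y) => X eX.
apply/matrixP => i j; rewrite !ord1 !mxE !mulr1n eX; ring.
Qed.

Lemma ext_row_lift a : row_cocycle rho a -> cob (cupm a kappa) ->
  exists a0, row_cocycle R (fun x => row_mx (a0 x)%:M (a x)).
Proof.
move=> ra [s ss sE]; exists (fun x => - s x); apply: ext_row_cocycle => //.
  exact: (smooth_comp (fun t => - t)).
by move=> x y; rewrite sE //; ring.
Qed.

Lemma ext_row_inv a : row_cocycle R a -> row_cocycle rho (fun x => rsubmx (a x)) /\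
  cob (cupm (fun x => rsubmx (a x)) kappa).
Proof.
move=> [sa aM].
have aE x y : row_mx (lsubmx (a (x * y)%g)) (rsubmx (a (x * y)%g)) =
    row_mx (lsubmx (a x) + rsubmx (a x) *m kappa y + lsubmx (a y))
      (rsubmx (a x) *m rho y + rsubmx (a y)).
  rewrite hsubmxK aM -{1}[a x]hsubmxK /ext_rep mul_row_block mulmx1 mulmx0 add0r.
  by rewrite -{1}[a y]hsubmxK add_row_mx.
split; first split.
- exact: (smooth_comp (fun u : 'rV_(1 + d) => rsubmx u)).
- by move=> x y; have /eq_row_mx[_ ->] := aE x y.
exists (fun x => - (lsubmx (a x) 0 0)).
  exact: (smooth_comp (fun u : 'rV_(1 + d) => - (lsubmx u 0 0))).
move=> x y _ _; have /eq_row_mx[-> _] := aE x y; rewrite /cupm.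
move: (rsubmx (a x) *m kappa y) (lsubmx (a x)) (lsubmx (a y)) => X Y Z.
rewrite !mxE; ring.
Qed.

End Extension.

Lemma conj_row_cocycle d (rho : G -> 'M[F]_d) B a : B \in unitmx -> row_cocycle rho a ->
  row_cocycle (fun x => B *m rho x *m invmx B) (fun x => a x *m invmx B).
Proof.
move=> uB [sa aM]; split; first exact: (smooth_comp (fun u => u *m invmx B)).
by move=> x y; rewrite aM mulmxDl !mulmxA mulmxKV.
Qed.

Lemma conj_row_cocycleV d (rho : G -> 'M[F]_d) B a : B \in unitmx ->
  row_cocycle (fun x => B *m rho x *m invmx B) a ->
  row_cocycle rho (fun x => a x *m B).
Proof.
move=> uB [sa aM]; split; first exact: (smooth_comp (fun u => u *m B)).
by move=> x y; rewrite aM mulmxDl !mulmxA mulmxKV.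
Qed.

Section Nondegenerate.
Hypothesis h2 : H2_le1 setT.
Hypothesis nd : cup_nondegenerate setT.

(** Induction over extensions. Cocycles with only a first entry show that the top entry [u] of [b]
    vanishes, so the rest [w] is a cocycle of [rho], orthogonal to every [a] orthogonal to [kappa].
    Then [w] minus a multiple of [kappa] is orthogonal to everything and the induction hypothesis
    applies. *)
Lemma row_dual_nondegenerate d (rho : G -> 'M[F]_d) : is_rep rho ->
  forall b, col_cocycle rho b ->
  (forall a, row_cocycle rho a -> cob (cupm a b)) -> col_coboundary rho b.
Proof.
move: d rho; apply: (rep_ind p_pr ncN pimg (Q := fun d rho => forall b, col_cocycle rho b ->
  (forall a, row_cocycle rho a -> cob (cupm a b)) -> col_coboundary rho b)).
- by move=> rho b _ _; exists 0 => x; rewrite !flatmx0.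
- move=> d rho kappa rr kk IH b [sb bM] bK.
  pose u x := usubmx (b x); pose w x := dsubmx (b x).
  have bE x : b x = col_mx (u x) (w x) by rewrite vsubmxK.
  have su : smooth u by exact: (smooth_comp (fun v : 'cV_(1 + d) => usubmx v)).
  have sw : smooth w by exact: (smooth_comp (fun v : 'cV_(1 + d) => dsubmx v)).
  have uwM x y : u (x * y)%g = u x + u y /\
      w (x * y)%g = w x + (kappa x *m u y + rho x *m w y).
    have := bM x y; rewrite !bE /ext_rep mul_block_col mul1mx mul0mx addr0 add_col_mx.
    by move=> /eq_col_mx.
  have u0 x : u x = 0.
    pose f x := u x 0 0.
    have hf : hom1 f.
      split; first exact: (smooth_comp (fun v : 'cV_1 => v 0 0)).
      by move=> s t _ _; rewrite /f (uwM s t).1 mxE.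
    have f0 : f x = 0.
      apply: (nd hf) => // a [sa aM].
      have : row_cocycle (ext_rep rho kappa) (fun x => row_mx (a x)%:M 0).
        apply: (ext_row_cocycle (row_cocycle0 rho)) => // s t.
        by rewrite /cupm mul0mx mxE aM //; ring.
      move=> /bK; apply: eq_coboundary_on => s t _ _.
      by rewrite /cupm bE mul_row_col mul0mx addr0 mul_scalar_mx mxE.
    by apply/matrixP => i j; rewrite !ord1 [RHS]mxE; exact: f0.
  have wM : col_cocycle rho w.
    by split=> // x y; rewrite (uwM x y).2 u0 mulmx0 add0r.
  have wL a : row_cocycle rho a -> cob (cupm a kappa) -> cob (cupm a w).
    move=> ra /(ext_row_lift ra)[a0 /bK]; apply: eq_coboundary_on => s t _ _.
    by rewrite /cupm bE mul_row_col u0 mulmx0 add0r.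
  (* Cupping with [kappa] and with [w] are two functionals on row cocycles with values in a space of
     dimension at most 1. The kernel of the first lies in that of the second, so the second is a
     multiple of the first. *)
  have [lam lamP] : exists lam, forall a, row_cocycle rho a ->
      cob (cupm a (fun x => - lam *: kappa x + w x)).
    have [all|/existsNP[a1 /not_implyP[ra1 n1]]] :=
      pselect (forall a, row_cocycle rho a -> cob (cupm a kappa)).
      exists 0 => a ra; apply: eq_coboundary_on (wL _ ra (all _ ra)) => s t _ _.
      by rewrite /cupm oppr0 scale0r add0r.
    have k1 := cupm_cocycle ra1 kk; have w1 := cupm_cocycle ra1 wM.
    have [lam l1] := h2 k1 w1 n1; exists lam => a ra.
    have [mu m1] := h2 k1 (cupm_cocycle ra kk) n1.
    have ra' := row_cocycle_lin (- mu) ra1 ra.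
    have c2 : cob (cupm (fun x => - mu *: a1 x + a x) w).
      apply: wL => //; apply: eq_coboundary_on m1 => s t _ _.
      by rewrite /cupm mulmxDl -scalemxAl !mxE; ring.
    have c3 : cob (cupm (fun x => - mu *: a1 x + a x) kappa).
      apply: eq_coboundary_on m1 => s t _ _.
      by rewrite /cupm mulmxDl -scalemxAl !mxE; ring.
    have := coboundary_lin ncN mu l1 (coboundary_lin ncN (- lam) c3 c2).
    apply: eq_coboundary_on => s t _ _.
    rewrite /cupm !mulmxDl !mulmxDr -?scalemxAl -?scalemxAr.
    move: (a1 s *m w t) (a1 s *m kappa t) (a s *m w t) (a s *m kappa t) => X1 X2 X3 X4.
    rewrite !mxE; ring.
  have [v vE] := IH _ (col_cocycle_lin (- lam) kk wM) lamP.
  (* In the extension [kappa] is the coboundary of the first unit vector, so the entry [lam] gives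
     back the multiple of [kappa]. *)
  exists (col_mx lam%:M v) => x.
  rewrite bE u0 /ext_rep mul_block_col mul1mx mul0mx addr0 opp_col_mx add_col_mx subrr.
  congr col_mx; have := vE x; rewrite mul_mx_scalar => e.
  by rewrite -[LHS](addKr (- lam *: kappa x)) e scaleNr opprK addrA.
- move=> d B rho uB rr IH b [sb bM] bK.
  have rb : col_cocycle rho (fun x => invmx B *m b x).
    split; first exact: (smooth_comp (fun v => invmx B *m v)).
    by move=> x y; rewrite bM mulmxDr !mulmxA mulVmx // mul1mx.
  have [|v vE] := IH _ rb.
    move=> a ra; have := bK _ (conj_row_cocycle uB ra); apply: eq_coboundary_on => s t _ _.
    by rewrite /cupm mulmxA.
  exists (B *m v) => x; rewrite -[LHS](mulKVmx uB) vE mulmxBr.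
  by rewrite -!mulmxA mulKmx.
Qed.

End Nondegenerate.

(** Duality between H^2 of the dual module and H^0: pairings with fixed vectors detect the class.
    The induction hypothesis trivialises the part of [C] over [rho], and what remains is a scalar
    cocycle [D]. *)
Lemma H2_dual_trivial : H2_le1 setT -> H2_zero setT \/ cup_nondegenerate setT ->
  forall d (rho : G -> 'M[F]_d), is_rep rho -> forall C, row_cocycle2 rho C ->
  (forall v : 'cV[F]_d, (forall x, rho x *m v = v) -> cob (fun x y => (C x y *m v) 0 0)) ->
  row_coboundary2 rho C.
Proof.
move=> h2 dual.
apply: (rep_ind p_pr ncN pimg (Q := fun d (rho : G -> 'M[F]_d) => forall C, row_cocycle2 rho C ->
  (forall v : 'cV[F]_d, (forall x, rho x *m v = v) -> cob (fun x y => (C x y *m v) 0 0)) ->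
  row_coboundary2 rho C)).
- by move=> rho C _ _; exists (fun=> 0) => // x y; rewrite [LHS]thinmx0 [RHS]thinmx0.
- move=> d rho kappa rr kk IH C [sC CM] Cv; have [sk kM] := kk.
  pose c x y := lsubmx (C x y) 0 0; pose C' x y := rsubmx (C x y).
  have CE x y : C x y = row_mx (c x y)%:M (C' x y).
    by rewrite /c -mx11_scalar hsubmxK.
  have sc : smooth2 c by exact: (smooth2_comp (fun v : 'rV_(1 + d) => lsubmx v 0 0)).
  have sC' : smooth2 C' by exact: (smooth2_comp (fun v : 'rV_(1 + d) => rsubmx v)).
  have cM x y z : c x y + (C' x y *m kappa z) 0 0 + c (x * y)%g z = c y z + c x (y * z)%g /\
      C' x y *m rho z + C' (x * y)%g z = C' y z + C' x (y * z)%g.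
    have := CM x y z; rewrite !CE /ext_rep mul_row_block mulmx1 mulmx0 add0r !add_row_mx.
    move=> /eq_row_mx[e ->]; split=> //; have /matrixP/(_ 0 0) := e.
    rewrite mxE [in X in X + _ = _]mxE; by rewrite !mxE !mulr1n => ->.
  have [|v vfix|S sS SE] := IH C'; first by split=> // x y z; rewrite (cM x y z).2.
    have vf x : ext_rep rho kappa x *m col_mx 0 v = col_mx 0 v.
      by rewrite /ext_rep mul_block_col !mulmx0 mul0mx !add0r vfix.
    apply: eq_coboundary_on (Cv _ vf) => s t _ _.
    by rewrite CE mul_row_col mulmx0 add0r.
  pose D x y := c x y - (S x *m kappa y) 0 0.
  (* The primitive [S] is only determined up to row cocycles; replacing it by [S + lam *: a] changes
     [D] by a multiple of the cup product of [a] and [kappa]. *)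
  suff [lam [a [ra [s ss sE]]]] : exists lam a, row_cocycle rho a /\
      cob (fun x y => D x y - lam * cupm a kappa x y).
    exists (fun x => row_mx (s x)%:M (S x + lam *: a x)).
      apply: (smooth_op ncN (fun (t : F) v => row_mx t%:M v)) => //.
      by apply: (smooth_op ncN (fun u v => u + lam *: v)) => //; case: ra.
    move=> x y; rewrite CE /ext_rep mul_row_block mulmx1 mulmx0 add0r opp_row_mx !add_row_mx.
    congr row_mx.
      apply/matrixP => i j; rewrite !ord1.
      have := sE x y I I; rewrite /D /cupm mulmxDl -scalemxAl => e.
      have -> : c x y = c x y - (S x *m kappa y) 0 0 - lam * (a x *m kappa y) 0 0 +
        ((S x *m kappa y) 0 0 + lam * (a x *m kappa y) 0 0) by ring.
      rewrite e; move: (S x *m _) (a x *m _) => X1 X2; rewrite !mxE !mulr1n; ring.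
    rewrite SE ra.2 mulmxDl -scalemxAl !scalerDr.
    move: (S x *m rho y) (a x *m rho y) => X1 X2.
    by apply/matrixP => i j; rewrite !mxE; ring.
  have cocD : coc D.
    split.
      apply: (smooth2_op ncN (fun u v => u - v)) => //.
      apply: (smooth2_op ncN (fun (u : 'rV_d) (v : 'cV_d) => (u *m v) 0 0)).
        exact: smooth2_fst.
      exact: smooth2_snd.
    move=> x y z _ _ _; rewrite /D kM mulmxDr mulmxA.
    have := (cM x y z).1; rewrite SE !mulmxDl mulNmx.
    move: (S x *m rho y *m _) (S y *m _) (S (x * y)%g *m _) (S x *m kappa y) => X1 X2 X3 X4.
    rewrite !mxE => e.
    apply: (addIr (X1 0 0 + (X2 0 0 - X3 0 0))); rewrite -[RHS]addrA.
    have -> : forall u v : F, c x y - u + (c (x * y)%g z - v) + (X1 0 0 + (X2 0 0 - v)) =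
      c x y + (X1 0 0 + X2 0 0 - v) + c (x * y)%g z - u - v by move=> u v; ring.
    rewrite e; ring.
  (* If the extension splits, it has a further fixed vector, with entries 1 and [- u], and the
     hypothesis for it says that [D] is a coboundary. *)
  have [[u uE]|ns] := pselect (col_coboundary rho kappa).
    exists 0, (fun=> 0); split; first exact: row_cocycle0.
    have vf x : ext_rep rho kappa x *m col_mx 1%:M (- u) = col_mx 1%:M (- u).
      rewrite /ext_rep mul_block_col !mul1mx mul0mx addr0 mulmx1 mulmxN uE.
      by congr col_mx; rewrite addrAC subrr add0r.
    have := Cv _ vf => c1.
    have c2 : cob (fun x y => (S x *m u) 0 0 + (S y *m u) 0 0 - (S (x * y)%g *m u) 0 0).
      exists (fun x => (S x *m u) 0 0) => //.
      exact: (smooth_comp (fun v : 'rV_d => (v *m u) 0 0)).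
    apply: eq_coboundary_on (coboundaryD ncN c1 c2) => x y _ _.
    rewrite CE mul_row_col mulmx1 mulmxN SE /D uE mulmxBr !mulmxDl mulNmx mulmxA.
    by rewrite mul0r subr0; move: (S x *m rho y *m _) => X1; rewrite !mxE !mulr1n; ring.
  case: dual => [h0|nd].
    exists 0, (fun=> 0); split; first exact: row_cocycle0.
    by apply: eq_coboundary_on (h0 _ cocD) => x y _ _; rewrite mul0r subr0.
  (* Otherwise duality in degree one yields [a] whose cup product with [kappa] is not a coboundary;
     its multiples absorb [D] because H^2 has dimension at most 1. *)
  have : ~ (forall a, row_cocycle rho a -> cob (cupm a kappa)).
    by move=> /(row_dual_nondegenerate h2 nd rr kk).
  move=> /existsNP[a /not_implyP[ra na]].
  have [lam lamP] := h2 _ _ (cupm_cocycle ra kk) cocD na.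
  by exists lam, a.
- move=> d B rho uB rr IH C [sC CM] Cv.
  have CB : row_cocycle2 rho (fun x y => C x y *m B).
    split; first exact: (smooth2_comp (fun v => v *m B)).
    move=> x y z; rewrite -!mulmxDl -CM mulmxDl; congr (_ + _).
    by rewrite !mulmxA mulmxKV.
  have [v vfix|S sS SE] := IH _ CB.
    have vf x : B *m rho x *m invmx B *m (B *m v) = B *m v.
      by rewrite mulmxA mulmxKV // -mulmxA vfix.
    by apply: eq_coboundary_on (Cv _ vf) => s t _ _; rewrite mulmxA.
  exists (fun x => S x *m invmx B); first exact: (smooth_comp (fun v => v *m invmx B)).
  move=> x y; rewrite -[LHS](mulmxK uB) SE mulmxBl mulmxDl; congr (_ + _ - _).
  by rewrite !mulmxA mulmxKV.
Qed.

End Duality.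

(** * Dimensions of spaces of cocycles with coefficients *)

Section RowCocycles.
Variables (p : nat) (G : groupType) (N : nat -> set G).
Hypothesis p_pr : prime p.
Hypothesis ncN : normal_chain N.
Hypothesis pimg : p_images p N.
Local Notation F := 'F_p.
Local Notation smooth := (smooth N).
Local Notation cob := (@coboundary_on p G N setT).
Local Notation coc := (@cocycle_on p G N setT).
Local Notation is_rep := (@is_rep p G N _).
Local Notation row_cocycle := (@row_cocycle p G N _).
Local Notation col_cocycle := (@col_cocycle p G N _).

(* Functions are normalised to vanish off [U], so that [homs U] is H^1(U, F_p). *)
Definition homs (U : set G) : set (G -> F^o) :=
  [set f | hom_on N U (f : G -> F) /\ forall x, ~ U x -> f x = 0].

Definition row_cocycles d (rho : G -> 'M[F]_d) : set (G -> 'rV[F]_d) := [set a | row_cocycle rho a].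

Lemma homs_subspace U : subspace (homs U).
Proof.
split; first by split=> //; split=> [|x y _ _]; [exact: smooth_cst | rewrite addr0].
move=> a f g [[sf fM] f0] [[sg gM] g0]; split; first split.
- exact: (smooth_op ncN (fun u v : F^o => a *: u + v)).
- move=> x y Ux Uy; change (a * f (x * y)%g + g (x * y)%g = a * f x + g x + (a * f y + g y)).
  by rewrite fM // gM //; ring.
- by move=> x nU; change (a * f x + g x = 0); rewrite f0 // g0 //; ring.
Qed.

Lemma row_cocycles_subspace d (rho : G -> 'M[F]_d) : subspace (row_cocycles rho).
Proof. by split=> [|a x y rx ry]; [exact: row_cocycle0 | exact: row_cocycle_lin]. Qed.

Definition ext_quo d (a : G -> 'rV[F]_(1 + d)) : G -> 'rV[F]_d := fun x => rsubmx (a x).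

Lemma ext_quo_linear d (P : set (G -> 'rV[F]_(1 + d))) : linear_on P (@ext_quo d).
Proof.
move=> t a b _ _; apply/funext => x; rewrite /ext_quo.
change (rsubmx (t *: a x + b x) = t *: rsubmx (a x) + rsubmx (b x)).
by rewrite linearP.
Qed.

Lemma lincomb_fun (T : Type) (V : lmodType F) k (v : 'I_k -> T -> V) c x :
  lincomb v c x = lincomb (fun i => v i x) c.
Proof. by rewrite /lincomb fct_sumE. Qed.

Section Ext.
Variables (d : nat) (rho : G -> 'M[F]_d) (kappa : G -> 'cV[F]_d).
Hypotheses (rr : is_rep rho) (kk : col_cocycle rho kappa).
Local Notation R := (ext_rep rho kappa).
Local Notation ker := [set a | row_cocycles R a /\ ext_quo a = 0].

Definition liftable := [set a | row_cocycles rho a /\ cob (cupm a kappa)].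

Lemma liftable_subspace : subspace liftable.
Proof.
split.
  split; first exact: row_cocycle0.
  apply: eq_coboundary_on (coboundary0 _ _ _) => x y _ _.
  by rewrite /cupm -[(0 : G -> _) x]/(0 : 'rV[F]_d) mul0mx mxE.
move=> t a b [ra ca] [rb cb]; split; first exact: row_cocycle_lin.
apply: eq_coboundary_on (coboundary_lin ncN t ca cb) => x y _ _.
rewrite /cupm -[(t *: a + b) x]/(t *: a x + b x) mulmxDl -scalemxAl.
by move: (a x *m _) (b x *m _) => X Y; rewrite !mxE.
Qed.

Lemma ext_quo_im : @ext_quo d @` row_cocycles R = liftable.
Proof.
apply/seteqP; split=> [_ [a ra <-]|a [ra ca]].
  by have [] := ext_row_inv ra.
have [a0 ra0] := ext_row_lift ncN ra ca.
by exists (fun x => row_mx (a0 x)%:M (a x)) => //; apply/funext => x; rewrite /ext_quo row_mxKr.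
Qed.

Lemma ext_ker_dim_ge n : dim_ge (homs setT) n -> dim_ge ker n.
Proof.
move=> [v [Pv iv]].
pose w i : G -> 'rV[F]_(1 + d) := fun x => row_mx (v i x)%:M 0.
exists w; split=> [i|c c0].
  split; last by apply/funext => x; rewrite /ext_quo row_mxKr.
  have [[sv vM] _] := Pv i; apply: (ext_row_cocycle ncN (row_cocycle0 N rho)) => // x y.
  by rewrite vM // /cupm mul0mx mxE; ring.
apply: iv; apply/funext => x.
have := congr1 (fun f : G -> 'rV[F]_(1 + d) => f x 0 (lshift d 0)) c0.
rewrite /= !lincomb_fun /lincomb summxE -[(0 : G -> _) x]/(0 : 'rV[F]_(1 + d)) [in RHS]mxE => e.
apply: etrans e; apply: eq_bigr => i _.
by rewrite mxE row_mxEl mxE eqxx mulr1n.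
Qed.

Lemma ext_ker_dim_le n : dim_le (homs setT) n -> dim_le ker n.
Proof.
move=> [v sv].
exists (fun i x => row_mx (v i x)%:M 0) => a [ra a0].
have aE x : a x = row_mx (lsubmx (a x)) 0.
  by rewrite -{1}[a x]hsubmxK; congr row_mx; have := congr1 (fun f => f x) a0.
have [c cE] : exists c, (fun x => lsubmx (a x) 0 0) = lincomb v c.
  apply: sv; split; last by move=> x /(_ I).
  split.
    by case: ra => sa _; exact: (smooth_comp (fun u : 'rV_(1 + d) => lsubmx u 0 0)).
  move=> x y _ _; case: ra => _ ->.
  rewrite {1}(aE x) /ext_rep mul_row_block mulmx1 !mul0mx !addr0 mulmx0.
  by rewrite linearD /= row_mxKl [LHS]mxE.
exists c; apply/funext => x; rewrite lincomb_fun aE.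
have -> : lsubmx (a x) = (lincomb v c x)%:M by rewrite -cE -mx11_scalar.
rewrite lincomb_fun /lincomb.
apply/rowP => j; rewrite summxE; case: (split_ordP j) => i ->.
  rewrite row_mxEl !ord1 mxE eqxx mulr1n; apply: eq_bigr => k _.
  by rewrite mxE row_mxEl mxE eqxx mulr1n.
rewrite row_mxEr mxE big1 // => k _.
by rewrite mxE row_mxEr mxE mulr0.
Qed.

End Ext.

Lemma row_cocycles_conj d (rho : G -> 'M[F]_d) B : B \in unitmx -> is_rep rho ->
  (forall k, dim_ge (row_cocycles rho) k ->
     dim_ge (row_cocycles (fun x => B *m rho x *m invmx B)) k) /\
  (forall k, dim_le (row_cocycles rho) k ->
     dim_le (row_cocycles (fun x => B *m rho x *m invmx B)) k).
Proof.
have lE k (v : 'I_k -> G -> 'rV[F]_d) c (M : 'M[F]_d) x :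
    lincomb (fun i x => v i x *m M) c x = lincomb v c x *m M.
  by rewrite !lincomb_fun /lincomb mulmx_suml; apply: eq_bigr => i _; rewrite scalemxAl.
move=> uB rr; split=> k [v].
  move=> [Pv iv]; exists (fun i x => v i x *m invmx B); split=> [i|c c0].
    exact: (conj_row_cocycle uB (Pv i)).
  apply: iv; apply/funext => x; have := congr1 (fun f => f x *m B) c0.
  by rewrite lE mulmxKV // => ->; rewrite mul0mx.
move=> sv; exists (fun i x => v i x *m invmx B) => a /(conj_row_cocycleV uB) /sv[c cE].
exists c; apply/funext => x; rewrite lE -cE.
by rewrite mulmxK.
Qed.

Lemma row_cocycles_dim_le n d (rho : G -> 'M[F]_d) : dim_le (homs setT) n -> is_rep rho ->
  dim_le (row_cocycles rho) (n * d)%N.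
Proof.
move=> hn; move: d rho; apply: (rep_ind p_pr ncN pimg
  (Q := fun d (rho : G -> 'M[F]_d) => dim_le (row_cocycles rho) (n * d)%N)).
- move=> rho; rewrite muln0; exists (fun _ => 0) => a _; exists 0.
  by apply/funext => x; rewrite [LHS]thinmx0 [RHS]thinmx0.
- move=> d rho kappa rr kk IH; rewrite mulnDr muln1.
  apply: (dim_le_ker_im (row_cocycles_subspace _) (@ext_quo_linear d _)).
    exact: ext_ker_dim_le.
  by rewrite ext_quo_im //; apply: dim_leS IH => a [].
- by move=> d B rho uB rr /(row_cocycles_conj uB rr).2.
Qed.

Lemma row_cocycles_dim_ge_free n d (rho : G -> 'M[F]_d) :
  @H2_zero p G N setT -> dim_ge (homs setT) n ->
  is_rep rho -> dim_ge (row_cocycles rho) (n * d)%N.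
Proof.
move=> h0 hn; move: d rho; apply: (rep_ind p_pr ncN pimg
  (Q := fun d (rho : G -> 'M[F]_d) => dim_ge (row_cocycles rho) (n * d)%N)).
- by move=> rho; rewrite muln0; exact: dim_ge0.
- move=> d rho kappa rr kk IH; rewrite mulnDr muln1.
  apply: (dim_ge_ker_im (row_cocycles_subspace _) (@ext_quo_linear d _)).
    exact: ext_ker_dim_ge.
  rewrite ext_quo_im //; apply: dim_geS IH => a ra; split=> //.
  by apply: h0; exact: (cupm_cocycle ncN ra kk).
- by move=> d B rho uB rr /(row_cocycles_conj uB rr).1.
Qed.

(** Each extension gains n + 1 from H^1 and loses at most 1 to the liftability condition, a
    vanishing in H^2. The first step has nothing to lift and loses nothing, whence the extra 1. *)
Lemma row_cocycles_dim_ge n d (rho : G -> 'M[F]_d) :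
  @H2_le1 p G N setT -> dim_ge (homs setT) n.+1 ->
  is_rep rho -> dim_ge (row_cocycles rho) (n * d + (0 < d))%N.
Proof.
move=> h2 hn; move: d rho; apply: (rep_ind p_pr ncN pimg
  (Q := fun d (rho : G -> 'M[F]_d) => dim_ge (row_cocycles rho) (n * d + (0 < d))%N)).
- by move=> rho; rewrite muln0; exact: dim_ge0.
- move=> d rho kappa rr kk IH.
  have -> : (n * (1 + d) + (0 < 1 + d) = n.+1 + n * d)%N by rewrite addn1 mulnDr muln1 addSn.
  apply: (dim_ge_ker_im (row_cocycles_subspace _) (@ext_quo_linear d _)).
    exact: ext_ker_dim_ge.
  rewrite ext_quo_im //.
  case: d rho kappa rr kk IH => [|d] rho kappa rr kk IH.
    by rewrite muln0; exact: dim_ge0.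
  rewrite addn1 in IH.
  apply: dim_ge_codim1 (row_cocycles_subspace rho) _ IH => a b ra rb na.
  have nca : ~ cob (cupm a kappa) by move=> ca; apply: na.
  have [lam lamP] := h2 _ _ (cupm_cocycle ncN ra kk) (cupm_cocycle ncN rb kk) nca.
  exists lam; split.
    rewrite -scaleNr addrC; exact: row_cocycle_lin.
  apply: eq_coboundary_on lamP => x y _ _; rewrite /cupm.
  rewrite -[(b - lam *: a) x]/(b x - lam *: a x) mulmxBl -scalemxAl.
  by move: (a x *m _) (b x *m _) => X Y; rewrite !mxE.
- by move=> d B rho uB rr /(row_cocycles_conj uB rr).1.
Qed.

Lemma fixed_col d (rho : G -> 'M[F]_d) : is_rep rho -> (0 < d)%N ->
  exists2 v : 'cV[F]_d, v != 0 & forall x, rho x *m v = v.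
Proof.
move: d rho; apply: (rep_ind p_pr ncN pimg (Q := fun d (rho : G -> 'M[F]_d) => (0 < d)%N ->
  exists2 v : 'cV[F]_d, v != 0 & forall x, rho x *m v = v)) => //.
- case=> [|d] rho kappa rr kk IH _.
    exists (col_mx 1%:M 0).
      apply/negP => /eqP /(congr1 usubmx); rewrite col_mxKu => /matrixP/(_ 0 0).
      by rewrite !mxE => /eqP; rewrite oner_eq0.
    move=> x; rewrite /ext_rep mul_block_col !mulmx0 !mulmx1 !addr0.
    by congr col_mx; rewrite [LHS]flatmx0.
  have [v v0 vf] := IH isT; exists (col_mx 0 v).
    by apply: contra_neq v0 => /(congr1 dsubmx); rewrite col_mxKd linear0.
  by move=> x; rewrite /ext_rep mul_block_col !mulmx0 mul0mx !add0r vf.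
- move=> d B rho uB rr IH /IH[v v0 vf]; exists (B *m v).
    by apply: contra_neq v0 => /(congr1 (mulmx (invmx B))); rewrite mulKmx // mulmx0.
  by move=> x; rewrite -!mulmxA mulKmx // vf.
Qed.

(** If the fixed columns form at most a line, no extension over a non-zero [rho] splits, as a
    splitting would give a second fixed vector. By duality liftability is then a proper condition,
    and each step after the first adds at most n - 1. *)
Lemma row_cocycles_dim_le_dual n d (rho : G -> 'M[F]_d) :
  @H2_le1 p G N setT -> @cup_nondegenerate p G N setT ->
  dim_le (homs setT) n -> is_rep rho ->
  (forall v w : 'cV[F]_d, (forall x, rho x *m v = v) -> (forall x, rho x *m w = w) ->
     v != 0 -> exists c, w = c *: v) ->
  dim_le (row_cocycles rho) (n.-1 * d + 1)%N.
Proof.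
move=> h2 nd hn; move: d rho; apply: (rep_ind p_pr ncN pimg
  (Q := fun d (rho : G -> 'M[F]_d) =>
  (forall v w : 'cV[F]_d, (forall x, rho x *m v = v) -> (forall x, rho x *m w = w) ->
     v != 0 -> exists c, w = c *: v) ->
  dim_le (row_cocycles rho) (n.-1 * d + 1)%N)).
- move=> rho _; exists (fun _ => 0) => a _; exists 0.
  by apply/funext => x; rewrite [LHS]thinmx0 [RHS]thinmx0.
- move=> d rho kappa rr kk IH fix1.
  have fixl (v : 'cV[F]_d) : (forall x, rho x *m v = v) ->
      forall x, ext_rep rho kappa x *m col_mx 0 v = col_mx 0 v.
    by move=> vf x; rewrite /ext_rep mul_block_col !mulmx0 mul0mx !add0r vf.
  case: (posnP d) => [d0|d0].
    have := row_cocycles_dim_le hn (ext_rep_is ncN rr kk).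
    by apply: dim_le_leq; rewrite d0; lia.
  have [v v0 vf] := fixed_col rr d0.
  have v0' : col_mx 0 v != 0 :> 'cV[F]_(1 + d).
    by apply: contra_neq v0 => /(congr1 dsubmx); rewrite col_mxKd linear0.
  have ns : ~ col_coboundary rho kappa.
    move=> [u uE].
    have uf x : ext_rep rho kappa x *m col_mx 1%:M (- u) = col_mx 1%:M (- u).
      rewrite /ext_rep mul_block_col !mul1mx mul0mx addr0 mulmx1 mulmxN uE.
      by congr col_mx; rewrite addrAC subrr add0r.
    have [c] := fix1 _ _ (fixl _ vf) uf v0'; rewrite scale_col_mx scaler0.
    move=> /(congr1 usubmx); rewrite !col_mxKu => /matrixP/(_ 0 0).
    by rewrite !mxE => /eqP; rewrite oner_eq0.
  have [a [ra na]] : exists a, row_cocycle rho a /\ ~ cob (cupm a kappa).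
    apply: contrapT => no; apply: ns.
    apply: (row_dual_nondegenerate p_pr ncN pimg h2 nd rr kk) => a ra.
    by apply: contrapT => na; apply: no; exists a.
  have {}IH : dim_le (row_cocycles rho) (n.-1 * d).+1.
    rewrite -[(_ * _).+1]addn1; apply: IH => u w uf wf u0.
    have u0' : col_mx 0 u != 0 :> 'cV[F]_(1 + d).
      by apply: contra_neq u0 => /(congr1 dsubmx); rewrite col_mxKd linear0.
    have [c] := fix1 _ _ (fixl _ uf) (fixl _ wf) u0'; rewrite scale_col_mx.
    by move=> /(congr1 dsubmx); rewrite !col_mxKd => ->; exists c.
  apply: (@dim_le_leq _ _ _ (n + n.-1 * d)%N); first lia.
  apply: (dim_le_ker_im (row_cocycles_subspace _) (@ext_quo_linear d _)).
    exact: ext_ker_dim_le.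
  rewrite ext_quo_im //.
  apply: (dim_le_proper (row_cocycles_subspace rho) (liftable_subspace rho kappa)) => //.
    by move=> b [].
  by exists a => // -[].
- move=> d B rho uB rr IH fix1; apply: (row_cocycles_conj uB rr).2; apply: IH => v w vf wf v0.
  have Bf (u : 'cV[F]_d) : (forall x, rho x *m u = u) -> forall x, B *m rho x *m invmx B *m (B *m u) = B *m u.
    by move=> uf x; rewrite -!mulmxA mulKmx // uf.
  have v0' : B *m v != 0.
    by apply: contra_neq v0 => /(congr1 (mulmx (invmx B))); rewrite mulKmx // mulmx0.
  have [c cE] := fix1 _ _ (Bf _ vf) (Bf _ wf) v0'.
  by exists c; rewrite -[LHS](mulKmx uB) cE -scalemxAr mulKmx.
Qed.

End RowCocycles.

(** * Shapiro's lemma *)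

(** The normalisation [trv_1] makes [coset_cocycle u] at the base coset equal to [u] for [u] in [U],
    so that coinduction followed by [restr] is the identity. *)
Record left_transversal (G : groupType) (U : set G) m (cs : G -> 'I_m.+1) (t : 'I_m.+1 -> G) : Prop :=
  LeftTransversal {
    trv_eq : forall x y, cs x = cs y <-> U (x^-1 * y)%g;
    trv_K : cancel t cs;
    trv_1 : t (cs 1%g) = 1%g
  }.

Section Shapiro.
Variables (p : nat) (G : groupType) (N : nat -> set G).
Hypothesis p_pr : prime p.
Hypothesis ncN : normal_chain N.
Hypothesis pimg : p_images p N.
Local Notation F := 'F_p.
Local Notation smooth := (smooth N).
Local Notation cob := (@coboundary_on p G N setT).
Local Notation coc := (@cocycle_on p G N setT).
Local Notation is_rep := (@is_rep p G N _).
Local Notation row_cocycle := (@row_cocycle p G N _).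
Local Notation col_cocycle := (@col_cocycle p G N _).
Local Notation homsT := (@homs p G N setT).

Variables (U : set G) (m : nat) (cs : G -> 'I_m.+1) (t : 'I_m.+1 -> G).
Hypotheses (gU : sgrp U) (oU : exists k, N k `<=` U) (trv : left_transversal U cs t).
Local Notation j0 := (cs 1%g).

Let csU x u : U u -> cs (x * u)%g = cs x.
Proof. by move=> Uu; apply/esym; apply/(trv_eq trv); rewrite mulKg. Qed.

Definition cact (g : G) (i : 'I_m.+1) : 'I_m.+1 := cs (g * t i)%g.

Let cs_mul g x : cs (g * x)%g = cact g (cs x).
Proof.
apply/(trv_eq trv); rewrite invMg -mulgA mulKg; apply/(trv_eq trv).
by rewrite (trv_K trv).
Qed.

Let cactM g h i : cact (g * h)%g i = cact g (cact h i).
Proof. by rewrite /cact -mulgA; exact: cs_mul. Qed.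

Let cact1 i : cact 1%g i = i.
Proof. by rewrite /cact mul1g (trv_K trv). Qed.

Let cactK g : cancel (cact g) (cact g^-1%g).
Proof. by move=> i; rewrite -cactM mulVg cact1. Qed.

Let cactVK g : cancel (cact g^-1%g) (cact g).
Proof. by move=> i; rewrite -cactM mulgV cact1. Qed.

Let cact_t j : cact (t j) j0 = j.
Proof. by rewrite /cact (trv_1 trv) mulg1 (trv_K trv). Qed.

Let cactU u : U u -> cact u j0 = j0.
Proof. by move=> Uu; rewrite /cact (trv_1 trv) mulg1 -[u]mul1g csU. Qed.

Let cact_bij g : bijective (cact g).
Proof. by exists (cact g^-1%g); [exact: cactK | exact: cactVK]. Qed.

(** The element of [U] by which g times the [j]-th representative differs from the representative of
    its coset. *)
Definition coset_cocycle (g : G) (j : 'I_m.+1) : G := ((t (cact g j))^-1 * g * t j)%g.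
Local Notation sg := coset_cocycle.

Let sgU g j : U (sg g j).
Proof. by rewrite /sg -mulgA; apply/(trv_eq trv); rewrite (trv_K trv). Qed.

Let sgM g h j : sg (g * h)%g j = (sg g (cact h j) * sg h j)%g.
Proof. by rewrite /sg cactM !mulgA mulgK. Qed.

Let sg0 u : U u -> sg u j0 = u.
Proof. by move=> Uu; rewrite /sg cactU // (trv_1 trv) invg1 mul1g mulg1. Qed.

Let open_level : exists k, [/\ N k `<=` U, forall x n j, N k n -> cact (x * n)%g j = cact x j &
  forall x n j, N k n -> sg (x * n)%g j = (sg x j * (n ^ t j))%g].
Proof.
have [k kU] := oU; exists k.
have h x n j : N k n -> cact (x * n)%g j = cact x j.
  move=> nk; rewrite /cact -mulgA (conjgC n) mulgA; apply: csU.
  by apply: kU; exact: (chain_normal ncN).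
split=> // x n j nk; rewrite /sg h // -!mulgA; congr (_ * (_ * _))%g.
by rewrite (conjgC n).
Qed.

Let smooth_cact j : smooth (fun x => cact x j).
Proof. by have [k [_ h _]] := open_level; exists k => x n nk; exact: h. Qed.

Let smooth_sg T (f : G -> T) j : smooth f -> smooth (fun x => f (sg x j)).
Proof.
move=> [l fl]; have [k [_ _ h]] := open_level; exists (maxn k l) => x n nn.
rewrite h; last by apply: (chain_le ncN _ nn); exact: leq_maxl.
apply: fl; apply: (chain_normal ncN).
by apply: (chain_le ncN _ nn); exact: leq_maxr.
Qed.

Definition perm_rep (g : G) : 'M[F]_m.+1 := \matrix_(i, j) (cact g j == i)%:R.

Let row_perm_rep (w : 'rV[F]_m.+1) g j : (w *m perm_rep g) 0 j = w 0 (cact g j).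
Proof.
rewrite mxE (bigD1 (cact g j)) //= mxE eqxx mulr1 big1 ?addr0 // => i ne.
by rewrite mxE eq_sym (negbTE ne) mulr0.
Qed.

Let perm_rep_col (v : 'cV[F]_m.+1) g i : (perm_rep g *m v) i 0 = v (cact g^-1%g i) 0.
Proof.
rewrite mxE (bigD1 (cact g^-1%g i)) //= mxE cactVK eqxx mul1r big1 ?addr0 // => j ne.
rewrite mxE (_ : _ == _ = false) ?mul0r //; apply: contra_neqF ne => /eqP <-.
by rewrite cactK.
Qed.

Lemma perm_rep_is : is_rep perm_rep.
Proof.
split.
- by apply/matrixP => i j; rewrite !mxE cact1 eq_sym.
- move=> x y; apply/row_matrixP => i; apply/rowP => j.
  rewrite row_mul row_perm_rep [LHS]mxE [RHS]mxE [LHS]mxE [RHS]mxE.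
  by rewrite cactM.
- apply: (smooth_mx ncN) => i j.
  apply: (@eq_smooth _ _ _ (fun x => (cact x j == i)%:R)).
    by move=> x; rewrite mxE.
  exact: (smooth_comp (fun k => (k == i)%:R : F)).
Qed.

Definition restr (a : G -> 'rV[F]_m.+1) : G -> F^o :=
  fun x => if `[<U x>] then a x 0 j0 else 0.

Let row_cocycleE a x y j : row_cocycle perm_rep a ->
  a (x * y)%g 0 j = a x 0 (cact y j) + a y 0 j.
Proof. by move=> [_ ->]; rewrite mxE row_perm_rep. Qed.

(** The identity comes from factoring x t_j also as t_(xj) times [coset_cocycle x j]. It says that a
    row cocycle is coinduced from its restriction to [U] up to the coboundary of its values at the
    representatives. *)
Let row_cocycle_coind a : row_cocycle perm_rep a -> forall x j,
  a x 0 j = a (sg x j) 0 j0 + (a (t (cact x j)) 0 j0 - a (t j) 0 j0).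
Proof.
move=> ra x j.
have := row_cocycleE x (t j) j0 ra; rewrite cact_t => e1.
have := row_cocycleE (t (cact x j)) (sg x j) j0 ra; rewrite cactU // => e2.
have e3 : (t (cact x j) * sg x j = x * t j)%g by rewrite /sg !mulgA mulgV mul1g.
rewrite e3 e1 in e2.
by rewrite -[LHS](addrK (a (t j) 0 j0)) e2; ring.
Qed.

Lemma restr_hom a : row_cocycle perm_rep a -> homs N U (restr a).
Proof.
move=> ra; split; last by move=> x nU; rewrite /restr; case: asboolP.
have [_ UM _] := gU; have [k kU] := oU; split.
  have [l al] := ra.1; exists (maxn k l) => x n nn.
  have nU : U n by apply: kU; apply: (chain_le ncN _ nn); exact: leq_maxl.
  rewrite /restr al; last by apply: (chain_le ncN _ nn); exact: leq_maxr.
  suff -> : `[<U (x * n)%g>] = `[<U x>] by [].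
  apply/asboolP/asboolP => h; last exact: UM.
  by rewrite -(mulgK n x); apply: UM => //; case: gU => _ _; apply.
move=> x y Ux Uy; rewrite /restr !asboolT //; last exact: UM.
by rewrite row_cocycleE // cactU.
Qed.

Lemma restr_linear (P : set (G -> 'rV[F]_m.+1)) : linear_on P restr.
Proof.
move=> c a b _ _; apply/funext => x; rewrite /restr.
change ((if `[< U x >] then (c *: a x + b x) 0 j0 else 0) =
  c * (if `[< U x >] then a x 0 j0 else 0) + (if `[< U x >] then b x 0 j0 else 0)).
by case: asboolP => _; rewrite ?mxE // mulr0 addr0.
Qed.

Definition row_coind (f : G -> F) (x : G) : 'rV[F]_m.+1 := \row_j f (sg x j).

Lemma row_coind_cocycle f : hom_on N U f -> row_cocycle perm_rep (row_coind f).
Proof.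
move=> [sf fM]; split.
  apply: (smooth_mx ncN) => i j.
  apply: (@eq_smooth _ _ _ (fun x => f (sg x j))); last exact: smooth_sg.
  by move=> x; rewrite mxE.
move=> x y; apply/rowP => j; rewrite mxE sgM fM // [RHS]mxE row_perm_rep.
by rewrite !mxE.
Qed.

Lemma restr_im : restr @` row_cocycles N perm_rep = homs N U.
Proof.
apply/seteqP; split=> [_ [a ra <-]|f [hf f0]]; first exact: restr_hom.
exists (row_coind f); first exact: row_coind_cocycle.
apply/funext => x; rewrite /restr; case: asboolP => Ux; last by rewrite f0.
by rewrite mxE sg0.
Qed.

Local Notation ker := [set a | row_cocycles N perm_rep a /\ restr a = 0].

(** The coboundary of the [k]-th unit row. Those with [k] different from [j0] form a basis of the
    kernel of restriction, whence the [m] subtracted in the dimension formulas. *)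
Definition perm_cob (k : 'I_m.+1) (x : G) : 'rV[F]_m.+1 :=
  \row_j ((cact x j == k)%:R - (j == k)%:R).

Lemma perm_cob_ker k : k != j0 -> ker (perm_cob k).
Proof.
move=> k0; split.
  split.
    apply: (smooth_mx ncN) => i j.
    apply: (@eq_smooth _ _ _ (fun x => (cact x j == k)%:R - (j == k)%:R)).
      by move=> x; rewrite mxE.
    exact: (smooth_comp (fun i => (i == k)%:R - (j == k)%:R : F)).
  move=> x y; apply/rowP => j; rewrite [RHS]mxE row_perm_rep !mxE cactM.
  ring.
apply/funext => x; rewrite /restr; case: asboolP => // Ux.
by rewrite mxE cactU // subrr.
Qed.

Lemma restr_ker_dim_ge : dim_ge ker m.
Proof.
exists (fun i => perm_cob (lift j0 i)); split=> [i|c c0].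
  by apply: perm_cob_ker; rewrite eq_sym neq_lift.
apply/rowP => i; rewrite [RHS]mxE.
have := congr1 (fun f : G -> 'rV[F]_m.+1 => f (t (lift j0 i)) 0 j0) c0.
rewrite /= lincomb_fun /lincomb summxE -[(0 : G -> _) _]/(0 : 'rV[F]_m.+1) [in RHS]mxE => e.
rewrite -{}e (bigD1 i) //= !mxE cact_t eqxx (negbTE (neq_lift _ _)) subr0 mulr1.
rewrite big1 ?addr0 // => k ki; rewrite !mxE cact_t (negbTE (neq_lift _ _)) subr0.
by rewrite (inj_eq lift_inj) eq_sym (negbTE ki) mulr0.
Qed.

Lemma restr_ker_dim_le : dim_le ker m.
Proof.
exists (fun i => perm_cob (lift j0 i)) => a [ra a0].
have aU u : U u -> a u 0 j0 = 0.
  by move=> Uu; have := congr1 (fun f => f u) a0; rewrite /restr asboolT.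
have a10 : a (t j0) 0 j0 = 0 by rewrite (trv_1 trv) aU //; case: gU.
exists (\row_i a (t (lift j0 i)) 0 j0); apply/funext => x; rewrite lincomb_fun /lincomb.
apply/rowP => j; rewrite (row_cocycle_coind ra) aU // add0r summxE.
have key i : a (t i) 0 j0 = \sum_k a (t (lift j0 k)) 0 j0 * (i == lift j0 k)%:R.
  case: (unliftP j0 i) => [k ->|->].
    rewrite (bigD1 k) //= eqxx mulr1 big1 ?addr0 // => l lk.
    by rewrite (inj_eq lift_inj) eq_sym (negbTE lk) mulr0.
  by rewrite a10 big1 // => k _; rewrite (negbTE (neq_lift _ _)) mulr0.
rewrite (key (cact x j)) (key j) -sumrB; apply: eq_bigr => k _.
by rewrite !mxE; ring.
Qed.

Let perm_rep_fixed (v : 'cV[F]_m.+1) : (forall x, perm_rep x *m v = v) ->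
  v = const_mx (v j0 0).
Proof.
move=> vf; apply/colP => i; rewrite mxE.
have /colP/(_ i) := vf (t i); rewrite perm_rep_col => <-.
congr (v _ _); apply: (can_inj (cactK (t i))).
by rewrite cactVK cact_t.
Qed.

Lemma homs_dim_le n : dim_le homsT n -> dim_le (@homs p G N U) (n * m.+1).
Proof.
move=> /(row_cocycles_dim_le p_pr ncN pimg)/(_ perm_rep_is) h.
rewrite -restr_im -[(_ * _)%N]subn0.
apply: (dim_le_im (row_cocycles_subspace ncN _) (@restr_linear _)) => //.
exact: dim_ge0.
Qed.

(** Schreier's formula: for positive [n] and d = m + 1 the bound is (n - 1) d + 1. *)
Lemma homs_dim_le_sub n : dim_le homsT n -> dim_le (@homs p G N U) (n * m.+1 - m).
Proof.
move=> /(row_cocycles_dim_le p_pr ncN pimg)/(_ perm_rep_is) h.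
rewrite -restr_im.
apply: (dim_le_im (row_cocycles_subspace ncN _) (@restr_linear _)) => //.
exact: restr_ker_dim_ge.
Qed.

(** Fixed columns of [perm_rep] are constant, hence form a line. For [n] at least 2 and d = m + 1
    the bound is (n - 2) d + 2, the rank of an open subgroup of index d in a Demushkin group of rank
    [n]; for n = 2 it does not grow. *)
Lemma homs_dim_le_dual n : @H2_le1 p G N setT -> @cup_nondegenerate p G N setT ->
  dim_le homsT n -> dim_le (@homs p G N U) (n.-1 * m.+1 + 1 - m).
Proof.
move=> h2 nd hn.
rewrite -restr_im.
apply: (dim_le_im (row_cocycles_subspace ncN _) (@restr_linear _)); last first.
  exact: restr_ker_dim_ge.
apply: (row_cocycles_dim_le_dual p_pr ncN pimg h2 nd hn perm_rep_is).
move=> v w /perm_rep_fixed -> /perm_rep_fixed -> v0.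
have c0 : v j0 0 != 0.
  by apply: contra_neq v0 => ->; apply/matrixP => i j; rewrite !mxE.
exists (w j0 0 / v j0 0); apply/matrixP => i j; rewrite !mxE.
by rewrite mulfVK.
Qed.

Lemma homs_dim_ge_free n : @H2_zero p G N setT -> dim_ge homsT n ->
  dim_ge (@homs p G N U) (n * m.+1 - m).
Proof.
move=> h0 /(row_cocycles_dim_ge_free p_pr ncN pimg h0)/(_ perm_rep_is) h.
rewrite -restr_im.
apply: (dim_ge_im (row_cocycles_subspace ncN _) (@restr_linear _)) => //.
exact: restr_ker_dim_le.
Qed.

Lemma homs_dim_ge n : @H2_le1 p G N setT -> dim_ge homsT n.+1 ->
  dim_ge (@homs p G N U) (n * m.+1 + 1 - m).
Proof.
move=> h2 /(row_cocycles_dim_ge p_pr ncN pimg h2)/(_ perm_rep_is) h.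
rewrite -restr_im.
apply: (dim_ge_im (row_cocycles_subspace ncN _) (@restr_linear _)) => //.
exact: restr_ker_dim_le.
Qed.

Definition row_coind2 (c : G -> G -> F) (x y : G) : 'rV[F]_m.+1 :=
  \row_j c (sg x (cact y j)) (sg y j).

(** Corestriction from [U] to the whole group on 2-cocycles: coinduce and sum over the cosets. *)
Definition transfer (c : G -> G -> F) (x y : G) : F := \sum_j c (sg x (cact y j)) (sg y j).

Lemma row_coind2_cocycle c : cocycle_on N U c -> row_cocycle2 N perm_rep (row_coind2 c).
Proof.
move=> [[l cl] cM]; split.
  have [k [kU ka ks]] := open_level; exists (maxn k l) => x y n n' nn nn'.
  have nk := chain_le ncN (leq_maxl k l) nn; have nl := chain_le ncN (leq_maxr k l) nn.
  have nk' := chain_le ncN (leq_maxl k l) nn'; have nl' := chain_le ncN (leq_maxr k l) nn'.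
  by apply/rowP => j; rewrite !mxE ka // !ks // cl //; apply: (chain_normal ncN).
move=> x y z; apply/rowP => j; rewrite [LHS]mxE row_perm_rep !mxE.
by rewrite [sg (x * y)%g _]sgM [sg (y * z)%g _]sgM cactM cM.
Qed.

Lemma transferE c x y (v : 'cV[F]_m.+1) : (forall x, perm_rep x *m v = v) ->
  (row_coind2 c x y *m v) 0 0 = v j0 0 * transfer c x y.
Proof.
move=> /perm_rep_fixed ->; rewrite mxE [in RHS]mxE mulr_sumr; apply: eq_bigr => i _.
by rewrite !mxE mulrC.
Qed.

Lemma transfer_cocycle c : cocycle_on N U c -> coc (transfer c).
Proof.
move=> cc; have [sC CM] := row_coind2_cocycle cc.
have vf x : perm_rep x *m const_mx 1 = const_mx 1 :> 'cV[F]_m.+1.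
  by apply/matrixP => i j; rewrite !ord1 perm_rep_col !mxE.
have tE x y : transfer c x y = (row_coind2 c x y *m (const_mx 1 : 'cV[F]_m.+1)) 0 0.
  by rewrite (transferE _ _ _ vf) mxE mul1r.
split.
  apply: (@eq_smooth2 _ _ _ (fun x y => (row_coind2 c x y *m (const_mx 1 : 'cV[F]_m.+1)) 0 0)).
    by move=> x y; rewrite tE.
  exact: (smooth2_comp (fun u : 'rV[F]_m.+1 => (u *m (const_mx 1 : 'cV[F]_m.+1)) 0 0)).
move=> x y z _ _ _; have := congr1 (fun u => (u *m (const_mx 1 : 'cV[F]_m.+1)) 0 0) (CM x y z).
by rewrite /= !mulmxDl -mulmxA vf mxE [RHS]mxE -!tE.
Qed.

Section Dual.
Hypothesis h2 : @H2_le1 p G N setT.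
Hypothesis dual : @H2_zero p G N setT \/ @cup_nondegenerate p G N setT.

(** The pairings of the coinduced cocycle with fixed vectors, which are constant, are multiples of
    the transfer. So duality in degree two trivialises it, and the entry at the base coset gives a
    primitive on [U]. *)
Lemma transfer_injective c : cocycle_on N U c -> cob (transfer c) -> coboundary_on N U c.
Proof.
move=> cc ct.
have [|S sS SE] := H2_dual_trivial p_pr ncN pimg h2 dual perm_rep_is (row_coind2_cocycle cc).
  move=> v vf; apply: eq_coboundary_on (coboundaryZ ncN (v j0 0) ct) => x y _ _.
  by rewrite transferE.
exists (fun x => S x 0 j0); first exact: (smooth_comp (fun u : 'rV[F]_m.+1 => u 0 j0)).
move=> x y Ux Uy; have := row_perm_rep (S x) y j0; have := SE x y.
move: (S x *m _) => X /rowP/(_ j0) + XE.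
by rewrite [LHS]mxE cactU // !sg0 // => ->; rewrite !mxE XE cactU.
Qed.

Lemma H2_le1_open : @H2_le1 p G N U.
Proof.
move=> c c' cc cc' nc.
have nt : ~ cob (transfer c) by move=> /(transfer_injective cc).
have [lam lamP] := h2 (transfer_cocycle cc) (transfer_cocycle cc') nt.
exists lam; apply: transfer_injective.
  have [sc _] := cocycle_lin ncN (- lam) cc cc'.
  have [_ e] := cocycle_lin ncN (- lam) cc cc'.
  split; first exact: (smooth2_op ncN (fun u v => v - lam * u) cc.1 cc'.1).
  by move=> x y z Ux Uy Uz; have := e x y z Ux Uy Uz; rewrite !mulNr ![- _ + _]addrC.
apply: eq_coboundary_on lamP => x y _ _.
by rewrite /transfer mulr_sumr -sumrB.
Qed.

End Dual.

Lemma H2_zero_open : @H2_zero p G N setT -> @H2_zero p G N U.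
Proof.
move=> h0 c cc; apply: transfer_injective => //; first by move=> c1 c2 cc1 cc2 /(_ (h0 _ cc1)).
  by left.
by apply: h0; exact: transfer_cocycle.
Qed.

Lemma transfer_coboundary c : coboundary_on N U c -> cob (transfer c).
Proof.
move=> [s ss sE]; exists (fun x => \sum_j s (sg x j)).
  by apply: (smooth_sum ncN) => j; exact: smooth_sg.
move=> x y _ _; rewrite /transfer.
rewrite [\sum_j s (sg x j)](reindex (cact y)) /=; last exact: onW_bij.
rewrite -big_split -sumrB /=; apply: eq_bigr => j _.
by rewrite sgM -sE.
Qed.

Definition col_coind (f : G -> F) (x : G) : 'cV[F]_m.+1 :=
  \col_i f (sg x (cact x^-1%g i)).

Lemma col_coind_cocycle f : hom_on N U f -> col_cocycle perm_rep (col_coind f).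
Proof.
move=> [sf fM]; split.
  apply: (smooth_mx ncN) => i j.
  apply: (@eq_smooth _ _ _ (fun x => f (sg x (cact x^-1%g i)))).
    by move=> x; rewrite mxE.
  have [k [kU ka ks]] := open_level; have [l fl] := sf.
  have kaV x n j1 : N k n -> cact (x * n)^-1%g j1 = cact x^-1%g j1.
    move=> nk; rewrite invMg (conjgC n^-1%g) ka //.
    apply: (chain_normal ncN); by case: (chain_sgrp ncN k) => _ _; apply.
  exists (maxn k l) => x n nn.
  have nk := chain_le ncN (leq_maxl k l) nn; have nl := chain_le ncN (leq_maxr k l) nn.
  rewrite kaV // ks // fl //; exact: (chain_normal ncN).
move=> x y; apply/colP => i; rewrite mxE invMg cactM sgM cactVK fM // [RHS]mxE.
by rewrite perm_rep_col !mxE.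
Qed.

(** The column cocycle coinduced from [b] is orthogonal to every row cocycle: such a one is
    coinduced from its restriction up to a coboundary, and the cup product of coinduced cocycles is
    the transfer of that on [U]. Hence it is a coboundary, and the base entry of a coboundary
    vanishes on [U]. *)
Lemma cup_nondegenerate_open : @H2_le1 p G N setT -> @cup_nondegenerate p G N setT ->
  @cup_nondegenerate p G N U.
Proof.
move=> h2 nd b hb bK x Ux.
have cb := col_coind_cocycle hb.
have [|v vE] := row_dual_nondegenerate p_pr ncN pimg h2 nd perm_rep_is cb.
  move=> a ra.
  pose al := restr a.
  have [hal _] := restr_hom ra.
  have c1 := transfer_coboundary (bK _ hal).
  pose w : 'rV[F]_m.+1 := \row_j a (t j) 0 j0.
  have aE y : a y = row_coind al y + (w *m perm_rep y - w).
    apply/rowP => j; rewrite (row_cocycle_coind ra) mxE [in RHS]mxE; congr (_ + _).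
      by rewrite /al /restr asboolT.
    by have := row_perm_rep w y j; move: (w *m _) => X XE; rewrite [RHS]mxE XE !mxE.
  have c2 : cob (cupm (fun y => w *m perm_rep y - w) (col_coind b)).
    exists (fun y => - (w *m col_coind b y) 0 0).
      exact: (smooth_comp (fun u : 'cV[F]_m.+1 => - (w *m u) 0 0) cb.1).
    move=> y z _ _; rewrite /cupm mulmxBl cb.2 mulmxDr !mulmxA.
    move: (w *m perm_rep y *m _) (w *m col_coind b y) (w *m col_coind b z) => X Y Z.
    by rewrite !mxE; ring.
  apply: eq_coboundary_on (coboundaryD ncN c1 c2) => y z _ _.
  rewrite /cupm [in RHS]aE [in RHS]mulmxDl [RHS]mxE; congr (_ + _).
  rewrite [RHS]mxE (reindex (cact z)) /=; last exact: onW_bij.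
  by apply: eq_bigr => j _; rewrite !mxE cactK.
have := vE x => /colP/(_ j0).
rewrite mxE => e; rewrite -[LHS](_ : b (sg x (cact x^-1%g j0)) = _).
  rewrite e [LHS]mxE perm_rep_col mxE cactU ?subrr //.
  by case: gU => _ _; apply.
by rewrite cactU ?sg0 //; case: gU => _ _; apply.
Qed.

End Shapiro.

(** * Lifting generators of finite p-groups *)

Section FpHoms.
Variables (p : nat) (gT : finGroupType).
Hypothesis p_pr : prime p.
Local Notation F := 'F_p.
Implicit Types (X : {group gT}) (f : gT -> F).

Definition hom_in X f := forall x y, x \in X -> y \in X -> f (x * y)%g = f x + f y.

Lemma hom_in1 X f : hom_in X f -> f 1%g = 0.
Proof.
move=> fM; have := fM 1%g 1%g (group1 X) (group1 X).
by rewrite mulg1 => /(congr1 (fun z => z - f 1%g)); rewrite subrr addrK.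
Qed.

Lemma hom_inX X f x n : hom_in X f -> x \in X -> f (x ^+ n)%g = f x * n%:R.
Proof.
move=> fM xX; elim: n => [|n IH]; first by rewrite expg0 (hom_in1 fM) mulr0.
by rewrite expgS fM ?groupX // IH -natr1; ring.
Qed.

Lemma hom_inV X f x : hom_in X f -> x \in X -> f x^-1%g = - f x.
Proof.
move=> fM xX; have := fM x x^-1%g xX; rewrite groupV => /(_ xX).
by rewrite mulgV (hom_in1 fM) => e; apply/eqP; rewrite -addr_eq0 addrC -e.
Qed.

Lemma hom_inR X f x y : hom_in X f -> x \in X -> y \in X -> f [~ x, y]%g = 0.
Proof.
move=> fM xX yX; rewrite /commg /conjg !fM ?groupM ?groupV //.
by rewrite !(hom_inV fM) //; ring.
Qed.

Lemma hom_in_prod X f (I : Type) (r : seq I) (y : I -> gT) : hom_in X f ->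
  (forall i, y i \in X) -> f (\prod_(i <- r) y i)%g = \sum_(i <- r) f (y i).
Proof.
move=> fM yX; elim: r => [|i r IH]; first by rewrite !big_nil (hom_in1 fM).
by rewrite !big_cons fM ?IH // group_prod.
Qed.

(** A maximal subgroup of a p-group is normal of index p; the hom is a coordinate of the quotient by
    one that contains [H]. *)
Lemma proper_hom_in X (H : {group gT}) : (p.-group X)%g -> H \proper X ->
  exists f, [/\ hom_in X f, forall h, h \in H -> f h = 0 & exists2 x, x \in X & f x != 0].
Proof.
move=> pX /[dup] /proper_sub HX prHX.
case: (maximal_exists HX) => [HE|[M maxM HM]].
  by move: prHX; rewrite HE fintype.properxx.
have nMX := p_maximal_normal pX maxM.
have cardq : #|(X / M)%g| = p by rewrite card_quotient ?normal_norm // (p_maximal_index pX).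
have abq := prime_abelem p_pr cardq.
have ntq : (X / M)%g != 1%g :> {set _}.
  by rewrite trivg_card1 cardq neq_ltn prime_gt1 ?orbT.
have [x xX xM] : exists2 x, x \in X & x \notin M.
  by have /maxgroupP[/properP[_ [x]]] := maxM; exists x.
pose rv := abelem_rV abq ntq.
have nX y : y \in X -> y \in 'N(M)%g by move: y; exact: (fintype.subsetP (normal_norm nMX)).
have qX y : y \in X -> coset M y \in (X / M)%g by move=> yX; apply: mem_quotient.
have rvx : rv (coset M x) != 0.
  apply/eqP => e; have := abelem_rV_K abq ntq (qX _ xX); rewrite -/rv e rVabelem0.
  by move=> /esym /coset_idr => /(_ (nX _ xX)); exact/negP.
case/rV0Pn: rvx => k rvk.
exists (fun y => rv (coset M y) 0 k); split=> [y z yX zX|h hH|]; last by exists x.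
  rewrite morphM ?nX // /rv (abelem_rV_M abq ntq) ?qX //.
  by move: (abelem_rV _ _ _) (abelem_rV _ _ _) => u v; rewrite mxE.
rewrite coset_id; last by apply: (fintype.subsetP HM).
by rewrite /rv (abelem_rV_1 abq ntq) mxE.
Qed.

(** The [m i] are coordinates of [x] modulo the Frattini subgroup, the same for all homs. *)
Lemma gen_hom_in l X (y : 'I_l -> gT) x : (forall i, y i \in X) ->
  x \in <<[set y i | i in 'I_l]%SET>>%g ->
  exists m : 'I_l -> F, forall f, hom_in X f -> f x = \sum_i m i * f (y i).
Proof.
move=> yX.
pose S := [set x in X | `[<exists m : 'I_l -> F, forall f, hom_in X f -> f x = \sum_i m i * f (y i)>]]%SET.
have gS : group_set S.
  apply/group_setP; split.
    rewrite finset.in_set group1 /=; apply/asboolP; exists (fun=> 0) => f /hom_in1 ->.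
    by rewrite big1 // => i _; rewrite mul0r.
  move=> u v; rewrite !finset.in_set => /andP[uX /asboolP[m mP]] /andP[vX /asboolP[n nP]].
  rewrite groupM //=; apply/asboolP; exists (fun i => m i + n i) => f hf.
  by rewrite hf // mP // nP // -big_split /=; apply: eq_bigr => i _; rewrite mulrDl.
have : <<[set y i | i in 'I_l]%SET>>%g \subset Group gS.
  rewrite gen_subG; apply/fintype.subsetP => _ /imsetP[i _ ->]; rewrite finset.in_set yX /=.
  apply/asboolP; exists (fun j => (j == i)%:R) => f _.
  by rewrite (bigD1 i) //= eqxx mul1r big1 ?addr0 // => j /negbTE ->; rewrite mul0r.
by move=> /fintype.subsetP sub /sub; rewrite finset.in_set => /andP[_ /asboolP].
Qed.

End FpHoms.

(** A hom to Z/p^a, with natural numbers as values because it will be used as an exponent. *)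
Definition mod_hom (p : nat) (G : groupType) (N : nat -> set G) (U : set G) (a : nat) (f : G -> nat) :=
  smooth N f /\ forall x y, U x -> U y -> f (x * y)%g = f x + f y %[mod p ^ a].

Section CommutatorStep.
Variables (p : nat) (gT : finGroupType) (X : {group gT}).
Hypotheses (p_pr : prime p) (pX : (p.-group X)%g) (nabX : ~~ abelian X).

(** A lift of an element of order p in the centre of X / Z(X). Its commutators form a non-trivial
    central subgroup, which the lifting argument divides out. *)
Lemma second_center : exists t, [/\ t \in X, t \notin 'Z(X)%g, (t ^+ p)%g \in 'Z(X)%g &
  forall x, x \in X -> [~ t, x]%g \in 'Z(X)%g].
Proof.
set Z := 'Z(X)%G.
have nZX : normal Z X by exact: center_normal.
have nX y : y \in X -> y \in 'N(Z)%g by move: y; exact: (fintype.subsetP (normal_norm nZX)).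
have pQ : (p.-group (X / Z))%g by exact: quotient_pgroup.
have ntQ : (X / Z)%g != 1%g :> {set _}.
  apply: contra nabX => /eqP /trivgP; rewrite quotient_sub1 ?normal_norm // => sXZ.
  by apply: abelianS sXZ _; exact: center_abelian.
have ntC : 'Z(X / Z)%g != 1%g :> {set _}.
  by apply: contra ntQ => /eqP e; rewrite (trivg_center_pgroup pQ e).
have pC : (p.-group 'Z(X / Z))%g by apply: pgroupS pQ; exact: center_sub.
have [_ pdiv _] := pgroup_pdiv pC ntC.
have [q qC oq] := Cauchy p_pr pdiv.
have /morphimP[t nt tX qE] : q \in (X / Z)%g by move: qC; exact: (fintype.subsetP (center_sub _)).
exists t; split=> //.
- apply/negP => tZ; move: oq; rewrite qE /= coset_id // order1 => p1.
  by move: p_pr; rewrite -p1.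
- by apply: coset_idr; rewrite ?groupX // morphX //= -qE -oq expg_order.
- move=> x xX; apply: coset_idr; first by rewrite groupR ?nX.
  rewrite morphR ?nX //; apply/eqP/commgP; rewrite /= -qE.
  by have /centerP[_] := qC; apply; exact: mem_quotient.
Qed.

End CommutatorStep.

Section Lift.
Variables (p : nat) (G : groupType) (N : nat -> set G).
Hypothesis p_pr : prime p.
Hypothesis ncN : normal_chain N.
Local Notation F := 'F_p.
Local Notation smooth := (smooth N).
Variables (U : set G) (a l : nat) (chi psi : 'I_l -> G -> nat) (eta : G -> G -> F).
Local Notation cob := (@coboundary_on p G N U).
Local Notation coc := (@cocycle_on p G N U).
Hypotheses (gU : sgrp U).
Hypotheses (chiM : forall i, mod_hom p N U a (chi i)) (psiM : forall i, mod_hom p N U a (psi i)).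
Hypothesis etaP : forall c, coc c -> exists lam, cob (fun x y => c x y - lam * eta x y).
Hypothesis psi_chi : forall i j,
  cob (fun x y => (psi j x)%:R * (chi i y)%:R - (i == j)%:R * eta x y).
Hypothesis psi_psi : forall j k, cob (fun x y => (psi j x)%:R * (psi k y)%:R).

Definition lift_form (A : 'I_l -> 'I_l -> F) i u : F :=
  (chi i u)%:R + \sum_j A i j * (psi j u)%:R.

(* The last condition prescribes [phi] modulo the Frattini subgroup of [X]; the
   matrix [A] leaves room to correct the lift by the isotropic homs [psi]. *)
Definition has_lift (gT : finGroupType) (X : {group gT}) (y : 'I_l -> gT) :=
  exists (phi : G -> gT) (A : 'I_l -> 'I_l -> F), [/\ smooth phi,
    forall u, U u -> phi u \in X,
    forall u v, U u -> U v -> phi (u * v)%g = (phi u * phi v)%g &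
    forall f : gT -> F, hom_in X f -> forall u, U u ->
      f (phi u) = \sum_i f (y i) * lift_form A i u].

Let expg_mod_hom (gT : finGroupType) (X : {group gT}) x f u v :
  (#|X| %| p ^ a)%N -> x \in X -> mod_hom p N U a f -> U u -> U v ->
  (x ^+ f (u * v)%g = x ^+ f u * x ^+ f v)%g.
Proof.
move=> dX xX [_ fM] Uu Uv; rewrite -expgnDr.
have xp : (x ^+ (p ^ a) = 1)%g.
  by apply/eqP; rewrite -order_dvdn; apply: dvdn_trans dX; exact: order_dvdG.
by rewrite -(expg_mod _ xp) fM // (expg_mod _ xp).
Qed.

Lemma lift_abelian (gT : finGroupType) (X : {group gT}) y : abelian X ->
  (#|X| %| p ^ a)%N -> (forall i, y i \in X) -> has_lift X y.
Proof.
move=> abX dX yX.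
exists (fun u => \prod_i y i ^+ chi i u)%g, (fun _ _ => 0); split.
- have [k fk] := smooth_common ncN (fun i => (chiM i).1).
  by exists k => x n nk; apply: eq_bigr => i _; rewrite fk.
- by move=> u _; apply: group_prod => i _; rewrite groupX.
- move=> u v Uu Uv; rewrite -prodgM_commute.
    by apply: eq_bigr => i _; rewrite (expg_mod_hom dX).
  by move=> i j _ _; apply: (centsP abX); rewrite groupX.
- move=> f hf u Uu; rewrite (hom_in_prod _ hf); last by move=> i; rewrite groupX.
  apply: eq_bigr => i _; rewrite (hom_inX _ hf) // /lift_form big1 ?addr0 //.
  by move=> j _; rewrite mul0r.
Qed.

(** The obstruction to lifting from X / [t, X] to X is [ze] times [eta] with [ze] in [t, X], so ze =
    [t, x0] for some [x0]. Multiplying the set-theoretic lift [ph] by [t ^+ Psi] adds the cup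
    product of [Psi] with [t, ph], and the coordinates of [x0] tell which combination [Psi] of the
    isotropic homs cancels the obstruction. *)
Lemma lift_nonabelian (gT : finGroupType) (X : {group gT}) y : (p.-group X)%g ->
  ~~ abelian X -> (#|X| %| p ^ a)%N -> (forall i, y i \in X) ->
  X \subset <<[set y i | i in 'I_l]%SET>>%g ->
  (forall Z : {group gT}, normal Z X -> Z != 1%g :> {set gT} -> has_lift (X / Z)%G (fun i => coset Z (y i))) ->
  has_lift X y.
Proof.
move=> pX nabX dX yX genX IH.
have [t [tX tZ tpZ tR]] := second_center p_pr pX nabX.
have cX z : z \in 'Z(X)%g -> forall x, x \in X -> commute z x.
  by move=> /centerP[_].
have ZX z : z \in 'Z(X)%g -> z \in X by move=> /centerP[].
pose ka x := [~ t, x]%g.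
have kaM x x' : x \in X -> x' \in X -> ka (x * x')%g = (ka x * ka x')%g.
  move=> xX x'X; rewrite /ka commgMJ.
  rewrite (_ : [~ t, x] ^ x' = [~ t, x])%g; last by apply/conjg_fixP/commgP; exact: cX (tR _ xX) _ x'X.
  by apply: cX; rewrite ?tR // ZX // tR.
have ka1 : ka 1%g = 1%g by rewrite /ka commg1.
have kaX n x : x \in X -> [~ t ^+ n, x]%g = (ka x ^+ n)%g.
  move=> xX; rewrite commXg //; apply: commute_sym; exact: cX (tR _ xX) _ tX.
have kap x : x \in X -> (ka x ^+ p = 1)%g.
  by move=> xX; rewrite -kaX //; apply/eqP/commgP; exact: cX tpZ _ xX.
(* Commutation with [t] is multiplicative on [X], so the commutators already form a group and each
   element of [Z] is a single commutator. *)
have gZ : group_set [set ka x | x in X]%SET.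
  apply/group_setP; split; first by apply/imsetP; exists 1%g; rewrite ?group1 ?ka1.
  move=> _ _ /imsetP[x xX ->] /imsetP[x' x'X ->]; apply/imsetP.
  by exists (x * x')%g; rewrite ?groupM ?kaM.
pose Z := Group gZ.
have memZ z : z \in Z -> exists2 x, x \in X & z = ka x by move=> /imsetP[x xX ->]; exists x.
have kaZ x : x \in X -> ka x \in Z by move=> xX; apply/imsetP; exists x.
have ZC : Z \subset 'Z(X)%g.
  by apply/fintype.subsetP => z /memZ[x xX ->]; exact: tR.
have zC z : z \in Z -> forall x, x \in X -> commute z x.
  by move=> zZ; apply: cX; exact: (fintype.subsetP ZC).
have zX z : z \in Z -> z \in X by move=> zZ; apply/ZX/(fintype.subsetP ZC).
have ka0 z : z \in Z -> ka z = 1%g.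
  by move=> zZ; apply/eqP/commgP; apply: commute_sym; exact: zC.
have nZX : normal Z X by exact: sub_center_normal.
have ntZ : Z != 1%g :> {set _}.
  apply: contra tZ => /eqP Z1; apply/centerP; split=> // x xX.
  have s1 : Z \subset (1%g : {set gT}) by rewrite Z1.
  by apply/commgP; have := fintype.subsetP s1 _ (kaZ _ xX); rewrite finset.in_set1.
have abZ : (p.-abelem Z)%g.
  apply/abelemP => //; split; last by move=> _ /memZ[x xX ->]; exact: kap.
  by apply: abelianS ZC _; exact: center_abelian.
have nX x : x \in X -> x \in 'N(Z)%g by move: x; exact: (fintype.subsetP (normal_norm nZX)).
pose rv : gT -> _ := abelem_rV abZ ntZ.
have rvM u v : u \in Z -> v \in Z -> rv (u * v)%g = rv u + rv v.
  by move=> uZ vZ; rewrite /rv abelem_rV_M.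
have rv1 : rv 1%g = 0 by exact: abelem_rV_1.
have rvV u : u \in Z -> rv u^-1%g = - rv u.
  by move=> uZ; apply/eqP; rewrite -addr_eq0 -rvM ?groupV // mulVg rv1.
have rvX u n : u \in Z -> rv (u ^+ n)%g = n%:R *: rv u.
  by move=> uZ; rewrite /rv abelem_rV_X.
have rv_inj u v : u \in Z -> v \in Z -> rv u = rv v -> u = v.
  by move=> uZ vZ e; rewrite -(abelem_rV_K abZ ntZ uZ) -/(rv u) e /rv abelem_rV_K.
have homka k : hom_in X (fun x => rv (ka x) 0 k).
  by move=> x x' xX x'X /=; rewrite kaM // rvM ?kaZ // mxE.
have [phi0 [A [sphi phiX phiM phiE]]] := IH Z nZX ntZ.
have /choice[sec secP] : forall q, exists x, q \in (X / Z)%g -> x \in X /\ coset Z x = q.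
  move=> q; case: (boolP (q \in (X / Z)%g)) => [/morphimP[x _ xX ->]|_]; last by exists 1%g.
  by exists x.
pose ph u := sec (phi0 u).
have phX u : U u -> ph u \in X by move=> Uu; case: (secP _ (phiX _ Uu)).
have phK u : U u -> coset Z (ph u) = phi0 u by move=> Uu; case: (secP _ (phiX _ Uu)).
have sph : smooth ph by exact: (smooth_comp sec sphi).
have UM u v : U u -> U v -> U (u * v)%g by case: gU => _ h _; exact: h.
pose c u v := ((ph (u * v))^-1 * (ph u * ph v))%g.
have cZ u v : U u -> U v -> c u v \in Z.
  move=> Uu Uv; apply: coset_idr; first by rewrite nX ?groupM ?groupV ?phX //; exact: UM.
  rewrite morphM ?morphV ?morphM ?nX ?groupM ?groupV ?phX //; try exact: UM.
  by rewrite /= !phK // ?phiM ?mulVg //; exact: UM.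
have phM u v : U u -> U v -> (ph u * ph v = ph (u * v) * c u v)%g.
  by move=> Uu Uv; rewrite /c mulKVg.
have sc : smooth2 N c.
  apply: (smooth2_op ncN (fun x y => x^-1 * y)%g); first exact: (smooth2_mul ncN).
  by apply: (smooth2_op ncN (fun x y => x * y)%g); [exact: smooth2_fst | exact: smooth2_snd].
have ccM k : coc (fun u v => rv (c u v) 0 k).
  split; first exact: (smooth2_comp (fun x => rv x 0 k)).
  move=> u v w Uu Uv Uw.
  have Uuv := UM _ _ Uu Uv; have Uvw := UM _ _ Uv Uw.
  have e : (c u v * c (u * v) w = c v w * c u (v * w))%g.
    apply: (@mulgI _ (ph (u * v * w))%g).
    have uv_c := zC _ (cZ _ _ Uu Uv); have vw_c := zC _ (cZ _ _ Uv Uw).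
    transitivity (ph u * ph v * ph w)%g.
      rewrite (uv_c (c (u * v)%g w)); last by rewrite zX ?cZ.
      by rewrite mulgA -(phM _ _ Uuv Uw) -mulgA -uv_c ?phX // mulgA -phM.
    rewrite (vw_c (c u (v * w)%g)); last by rewrite zX ?cZ.
    by rewrite mulgA -[(u * v * w)%g]mulgA -(phM _ _ Uu Uvw) -[RHS]mulgA -(phM _ _ Uv Uw) mulgA.
  have := congr1 (fun z => rv z 0 k) e.
  rewrite /= (rvM _ _ (cZ _ _ Uu Uv) (cZ _ _ Uuv Uw)) (rvM _ _ (cZ _ _ Uv Uw) (cZ _ _ Uu Uvw)).
  by move: (rv (c u v)) (rv (c (u * v)%g w)) (rv (c v w)) (rv (c u (v * w)%g)) => X1 X2 X3 X4; rewrite !mxE.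
have /choice[ze zeP] := fun k => etaP (ccM k).
have zZ := mem_rVabelem abZ ntZ (\row_k ze k).
have [x0 x0X x0E] := memZ _ zZ.
have [mm mP] := gen_hom_in p yX (fintype.subsetP genX _ x0X).
have zeE k : ze k = \sum_i mm i * rv (ka (y i)) 0 k.
  by rewrite -(mP _ (homka k)) -x0E /rv rVabelemK mxE.
have [tau tauP] := gen_hom_in p yX (fintype.subsetP genX _ tX).
(* With this sign the cup product of [Psi] with [t, ph] is cohomologous to minus [ze] times
   [eta]. *)
pose Psi u := (\sum_j (val (- mm j)%R) * psi j u)%N.
have PsiM : mod_hom p N U a Psi.
  split.
    have [k fk] := smooth_common ncN (fun i => (psiM i).1).
    by exists k => x n nk; apply: eq_bigr => i _; rewrite fk.
  move=> u v Uu Uv; rewrite /Psi -big_split /=.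
  apply: (big_ind2 (fun s s' => s = s' %[mod p ^ a])) => //.
    by move=> s1 s2 s3 s4 e1 e2; rewrite -modnDm e1 e2 modnDm.
  by move=> j _; rewrite -modnMmr (psiM j).2 // modnMmr mulnDr.
have PsiE u : (Psi u)%:R = \sum_j (- mm j) * (psi j u)%:R :> F.
  by rewrite /Psi natr_sum; apply: eq_bigr => j _; rewrite natrM natr_Zp.
have secE (f : gT -> F) : hom_in X f -> (forall z, z \in Z -> f z = 0) ->
    hom_in (X / Z)%G (fun q => f (sec q)) /\ forall x, x \in X -> f (sec (coset Z x)) = f x.
  move=> hf f0.
  have eqf x x' : x \in X -> x' \in X -> coset Z x = coset Z x' -> f x = f x'.
    move=> xX x'X e.
    have : (x^-1 * x')%g \in Z.
      apply: coset_idr; first by rewrite nX ?groupM ?groupV.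
      by rewrite morphM ?morphV ?nX ?groupV //= e mulVg.
    by move=> /f0; rewrite hf ?groupV // (hom_inV hf) // addrC => /eqP; rewrite subr_eq0 => /eqP.
  have secX q : q \in (X / Z)%g -> sec q \in X by move=> /secP[].
  have secK q : q \in (X / Z)%g -> coset Z (sec q) = q by move=> /secP[].
  split=> [q q' qX q'X|x xX]; last by apply: eqf; rewrite ?secX ?secK ?mem_quotient.
  rewrite -hf ?secX //; apply: eqf; rewrite ?groupM ?secX ?groupM //.
  by rewrite morphM ?nX ?secX //= !secK ?groupM.
have phE (f : gT -> F) : hom_in X f -> (forall z, z \in Z -> f z = 0) ->
    forall u, U u -> f (ph u) = \sum_i f (y i) * lift_form A i u.
  move=> hf f0 u Uu; have [hf' fE] := secE f hf f0.
  rewrite (phiE _ hf' u Uu); apply: eq_bigr => i _; by rewrite fE.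
(* [psi_chi] contributes [eta] for equal indices only, and [psi_psi] disposes of the terms coming
   from [A]. *)
have Dcob k : cob (fun u v => rv (c u v) 0 k + (Psi u)%:R * rv (ka (ph v)) 0 k).
  have c1 i : cob (fun u v => rv (ka (y i)) 0 k * \sum_j - mm j *
     (((psi j u)%:R * (chi i v)%:R - (i == j)%:R * eta u v) +
       \sum_j' A i j' * ((psi j u)%:R * (psi j' v)%:R))).
    apply: (coboundaryZ ncN); apply: (coboundary_sum ncN) => j; apply: (coboundaryZ ncN).
    apply: (coboundaryD ncN) => //; apply: (coboundary_sum ncN) => j'.
    exact: (coboundaryZ ncN).
  apply: eq_coboundary_on (coboundaryD ncN (zeP k) (coboundary_sum ncN c1)) => u v Uu Uv.
  have ka0' z : z \in Z -> rv (ka z) 0 k = 0 by move=> zZ'; rewrite ka0 // rv1 mxE.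
  rewrite (phE _ (homka k) ka0') // zeE -addrA; congr (_ + _).
  rewrite mulr_suml -sumrN -big_split /= mulr_sumr; apply: eq_bigr => i _.
  move: (rv _ _ _) => b.
  have -> : \sum_j - mm j * ((psi j u)%:R * (chi i v)%:R - (i == j)%:R * eta u v +
      \sum_j' A i j' * ((psi j u)%:R * (psi j' v)%:R)) =
      (Psi u)%:R * lift_form A i v + mm i * eta u v.
    rewrite PsiE mulr_suml.
    rewrite (_ : mm i * eta u v = \sum_j mm j * (i == j)%:R * eta u v); last first.
      rewrite (bigD1 i) //= eqxx mulr1 big1 ?addr0 // => j ji.
      by rewrite eq_sym (negbTE ji) mulr0 mul0r.
    rewrite -big_split /=; apply: eq_bigr => j _.
    rewrite (_ : \sum_j' _ = (psi j u)%:R * \sum_j' A i j' * (psi j' v)%:R); last first.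
      by rewrite mulr_sumr; apply: eq_bigr => j' _; ring.
    rewrite /lift_form; ring.
  ring.
have /choice[s sP] : forall k, exists s, smooth s /\ forall u v, U u -> U v ->
    rv (c u v) 0 k + (Psi u)%:R * rv (ka (ph v)) 0 k = s u + s v - s (u * v)%g.
  by move=> k; have [s ss sE] := Dcob k; exists s.
pose sg u := rVabelem abZ ntZ (\row_k s k u).
have sgZ u : sg u \in Z by exact: mem_rVabelem.
have sgE u : rv (sg u) = \row_k s k u by rewrite /rv rVabelemK.
have ssg : smooth sg.
  apply: (smooth_comp (rVabelem abZ ntZ)); apply: (smooth_mx ncN) => i j.
  by apply: (@eq_smooth _ _ _ (s j)); [move=> x; rewrite mxE | exact: (sP j).1].
have key u v : U u -> U v -> (c u v * ka (ph v) ^+ Psi u = sg u * sg v * (sg (u * v))^-1)%g.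
  move=> Uu Uv; have kZ : ka (ph v) \in Z by rewrite kaZ ?phX.
  have kXZ : (ka (ph v) ^+ Psi u)%g \in Z by exact: groupX.
  have sVZ : (sg (u * v))^-1%g \in Z by rewrite groupV.
  have ssZ : (sg u * sg v)%g \in Z by exact: groupM.
  apply: (rv_inj _ _ (groupM (cZ _ _ Uu Uv) kXZ) (groupM ssZ sVZ)).
  rewrite (rvM _ _ (cZ _ _ Uu Uv) kXZ) (rvM _ _ ssZ sVZ) (rvM _ _ (sgZ u) (sgZ v)) (rvV _ (sgZ _)) (rvX _ _ kZ) !sgE.
  have e k := (sP k).2 u v Uu Uv.
  move: (rv (c u v)) (rv (ka (ph v))) e => Q1 Q2 e.
  by apply/rowP => k; rewrite !mxE -e.
(* The factor [t ^+ Psi] shifts the forms of the lift by the coordinates [tau] of [t] times the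
   coefficients of [Psi]; the new matrix records the shift. *)
exists (fun u => ph u * t ^+ Psi u * (sg u)^-1)%g, (fun i j => A i j - tau i * mm j); split.
- apply: (smooth_op ncN (fun x y => x * y^-1)%g) => //.
  apply: (smooth_op ncN (fun x y => x * t ^+ y)%g) => //.
  exact: PsiM.1.
- by move=> u Uu; apply: groupM; [apply: groupM; [exact: phX | exact: groupX] | rewrite groupV; exact: zX].
- move=> u v Uu Uv.
  have tpX n : (t ^+ n)%g \in X by rewrite groupX.
  rewrite (expg_mod_hom dX tX PsiM Uu Uv).
  have pvX := phX _ Uv.
  have com : (t ^+ Psi u * ph v = ph v * (t ^+ Psi u * ka (ph v) ^+ Psi u))%g.
    by rewrite -kaX // commgEl mulKVg conjgC.
  have sc1 x : x \in X -> commute (sg u)^-1%g x by apply: zC; rewrite groupV.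
  transitivity (ph u * (t ^+ Psi u * ph v) * t ^+ Psi v * (sg u)^-1 * (sg v)^-1)%g; last first.
    by rewrite -!mulgA; do 2!congr (_ * _)%g; rewrite !mulgA -sc1 ?groupM // !mulgA.
  rewrite com; have kc := zC _ (groupX (Psi u) (kaZ _ pvX)).
  transitivity (ph u * ph v * (ka (ph v) ^+ Psi u) * t ^+ Psi u * t ^+ Psi v * (sg u)^-1 * (sg v)^-1)%g;
    last by rewrite -!mulgA; do 2!congr (_ * _)%g; rewrite !mulgA kc.
  rewrite phM // -[(_ * c u v * _)%g]mulgA key //.
  have sgX w : sg w \in X by rewrite zX.
  set S := (sg u * sg v * _)%g; set T := (t ^+ Psi u * t ^+ Psi v)%g.
  have SZ : S \in Z by rewrite /S !groupM ?groupV.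
  have TX : T \in X by rewrite /T groupM.
  have Se : (sg (u * v))^-1%g = (S * ((sg u)^-1 * (sg v)^-1))%g.
    have scuv := zC _ (groupVr (sgZ (u * v)%g)).
    have sVX w : (sg w)^-1%g \in X by rewrite groupV.
    rewrite /S -!mulgA (scuv _ (groupM (sVX u) (sVX v))) !mulgA (zC _ (sgZ u) _ (sgX v)).
    by rewrite mulgK mulgV mul1g.
  rewrite Se; transitivity (ph (u * v) * (S * T) * ((sg u)^-1 * (sg v)^-1))%g.
    by rewrite (zC _ SZ _ TX) !mulgA.
  by rewrite /T !mulgA.
- move=> f hf u Uu.
  have fZ z : z \in Z -> f z = 0 by move=> /memZ[x xX ->]; exact: (hom_inR hf).
  have tXn : (t ^+ Psi u)%g \in X by exact: groupX.
  have sVX : (sg u)^-1%g \in X by rewrite groupV; exact: zX.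
  rewrite (hf _ _ (groupM (phX _ Uu) tXn) sVX) (hf _ _ (phX _ Uu) tXn).
  rewrite (hom_inV hf (zX _ (sgZ u))) (fZ _ (sgZ u)) oppr0 addr0.
  rewrite (phE f hf fZ u Uu) (hom_inX _ hf) // (tauP f hf) PsiE mulr_suml -big_split /=.
  apply: eq_bigr => i _; rewrite /lift_form.
  rewrite (_ : \sum_j (A i j - tau i * mm j) * (psi j u)%:R =
    \sum_j A i j * (psi j u)%:R + tau i * \sum_j - mm j * (psi j u)%:R); first ring.
  by rewrite mulr_sumr -big_split /=; apply: eq_bigr => j _; ring.
Qed.

Lemma lift_exists (gT : finGroupType) (X : {group gT}) y : (p.-group X)%g ->
  (#|X| %| p ^ a)%N -> (forall i, y i \in X) ->
  X \subset <<[set y i | i in 'I_l]%SET>>%g -> has_lift X y.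
Proof.
have [n le_n] := ubnP #|X|; elim: n gT X y le_n => // n IH gT X y le_n pX dX yX genX.
have [abX|nabX] := boolP (abelian X); first exact: lift_abelian.
apply: lift_nonabelian => // Z nZX ntZ.
have nX x : x \in X -> x \in 'N(Z)%g by move: x; exact: (fintype.subsetP (normal_norm nZX)).
apply: IH.
- apply: leq_trans (_ : #|X| <= n)%N; last by rewrite -ltnS.
  exact: (ltn_quotient ntZ (normal_sub nZX)).
- exact: quotient_pgroup.
- exact: dvdn_trans (dvdn_quotient _ _) dX.
- by move=> i; exact: mem_quotient.
- have := quotientS Z genX; rewrite quotient_gen; last first.
    by apply/fintype.subsetP => _ /imsetP[i _ ->]; exact: nX.
  move=> /fintype.subset_trans; apply; apply: genS.
  apply/fintype.subsetP => _ /morphimP[x _ /imsetP[i _ ->] ->].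
  by apply/imsetP; exists i.
Qed.

(* A lift is onto: a hom [X -> F_p] killing its image kills the generators. *)
Lemma lift_surjective (gT : finGroupType) (X : {group gT}) y : (p.-group X)%g ->
  (#|X| %| p ^ a)%N -> (forall i, y i \in X) ->
  X \subset <<[set y i | i in 'I_l]%SET>>%g ->
  (forall (A : 'I_l -> 'I_l -> F) (b : 'I_l -> F),
     (forall u, U u -> \sum_i b i * lift_form A i u = 0) -> forall i, b i = 0) ->
  exists phi : G -> gT, [/\ smooth phi,
    forall u v, U u -> U v -> phi (u * v)%g = (phi u * phi v)%g,
    forall u, U u -> phi u \in X &
    forall x, x \in X -> exists2 u, U u & phi u = x].
Proof.
move=> pX dX yX genX indep.
have [phi [A [sphi phX phM phE]]] := lift_exists pX dX yX genX.
exists phi; split=> //.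
have [U1 UM UV] := gU.
pose H := [set x in X | `[<exists2 u, U u & phi u = x>]]%SET.
have gH : group_set H.
  apply/group_setP; split.
    rewrite finset.in_set group1 /=; apply/asboolP; exists 1%g => //.
    by apply: (@mulgI _ (phi 1%g)); rewrite -phM // !mulg1.
  move=> x x'; rewrite !finset.in_set => /andP[xX /asboolP[u Uu uE]] /andP[x'X /asboolP[v Uv vE]].
  rewrite groupM //=; apply/asboolP; exists (u * v)%g; first exact: UM.
  by rewrite phM // uE vE.
have HX : Group gH \subset X by apply/fintype.subsetP => x; rewrite finset.in_set => /andP[].
have memH u : U u -> phi u \in Group gH.
  by move=> Uu; rewrite finset.in_set phX //=; apply/asboolP; exists u.
suff XH : X \subset Group gH.
  move=> x xX; have := fintype.subsetP XH x xX.
  by rewrite finset.in_set => /andP[_ /asboolP].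
apply: contraT => nXH.
have prH : Group gH \proper X by rewrite fintype.properE HX.
have [f [hf f0 [x xX]]] := proper_hom_in p_pr pX prH.
have fy i : f (y i) = 0.
  apply: (indep A (fun i => f (y i))) => u Uu; rewrite -phE //; exact/f0/memH.
have [m ->] := gen_hom_in p yX (fintype.subsetP genX _ xX); last exact: hf.
by rewrite big1 ?eqxx // => i _; rewrite fy mulr0.
Qed.

End Lift.

(** * Hyperbolic pairs for a skew-symmetric form *)

Section HyperbolicPairs.
Variables (F : fieldType) (n : nat) (B : 'M[F]_n).
Hypothesis uB : row_free B.
Local Notation form x y := ((x *m B *m y^T) 0 0).
Hypothesis skew : forall x y : 'rV[F]_n, form x y = - form y x.

(** A non-degenerate form vanishes on [W] only if 2 rank W <= n, so as long as the inequality holds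
    a pair exists. Its orthogonal space in [W] has rank smaller by at most 2, which costs 4 in the
    inequality: this is the origin of the quarter. Alternation is assumed separately, since for p =
    2 skew symmetry does not imply it. *)
Lemma hyperbolic_pairs l k (W : 'M[F]_(k, n)) :
  (forall v : 'rV_n, (v <= W)%MS -> form v v = 0) ->
  (l = 0 \/ n + 4 * l < 2 * \rank W + 4)%N ->
  exists x z : 'I_l -> 'rV[F]_n,
    [/\ forall i, (x i <= W)%MS, forall i, (z i <= W)%MS,
        forall i j, form (z j) (x i) = (i == j)%:R &
        forall i j, form (z i) (z j) = 0].
Proof.
elim: l k W => [|l IH] k W alt rk.
  by exists (fun=> 0), (fun=> 0); split=> -[].
have {}rk : (n + 4 * l.+1 < 2 * \rank W + 4)%N by case: rk.
have : W *m B *m W^T != 0.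
  apply/eqP => /mulmx0_rank_max; rewrite mxrankMfree // mxrank_tr; lia.
case/matrix0Pn => i [j bij].
pose b := (W *m B *m W^T) i j.
pose z0 := b^-1 *: row i W; pose x0 := row j W.
have z0W : (z0 <= W)%MS by rewrite scalemx_sub ?row_sub.
have x0W : (x0 <= W)%MS by rewrite row_sub.
have zx0 : form z0 x0 = 1.
  rewrite -!scalemxAl mxE (_ : _ 0 0 = b) ?mulVf //.
  by rewrite /x0 tr_row colE mulmxA -!row_mul -colE [LHS]mxE [LHS]mxE.
pose K := kermx (row_mx (B *m x0^T) (B *m z0^T)).
have rK : (n - 2 <= \rank K)%N by rewrite mxrank_ker leq_sub2l // rank_leq_col.
have inK (v : 'rV_n) : (v <= K)%MS -> form v x0 = 0 /\ form v z0 = 0.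
  move=> /sub_kermxP; rewrite mul_mx_row => /eqP; rewrite row_mx_eq0 => /andP[/eqP e1 /eqP e2].
  by rewrite -!mulmxA e1 e2 !mxE.
have W'W : (W :&: K <= W)%MS by exact: capmxSl.
have W'K : (W :&: K <= K)%MS by exact: capmxSr.
have rk' : (n + 4 * l < 2 * \rank (W :&: K)%MS + 4)%N.
  have := mxrank_sum_cap W K; have := rank_leq_col (W + K)%MS; lia.
have [x [z [xW zW zx zz]]] := IH _ _ (fun v vW => alt v (submx_trans vW W'W)) (or_intror rk').
have xK i' := inK _ (submx_trans (xW i') W'K).
have zK i' := inK _ (submx_trans (zW i') W'K).
exists (fcons x0 x), (fcons z0 z); split.
- move=> i'; case: (unliftP ord0 i') => [i'' ->|->]; rewrite ?fcons0 ?fconsS //.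
  exact: submx_trans (xW _) W'W.
- move=> i'; case: (unliftP ord0 i') => [i'' ->|->]; rewrite ?fcons0 ?fconsS //.
  exact: submx_trans (zW _) W'W.
- move=> i1 j1; case: (unliftP ord0 i1) => [i2 ->|->]; case: (unliftP ord0 j1) => [j2 ->|->];
    rewrite ?fcons0 ?fconsS ?(inj_eq lift_inj) //.
  + by rewrite skew (xK i2).2 oppr0 eq_sym (negbTE (neq_lift _ _)).
  + by rewrite (zK j2).1 (negbTE (neq_lift _ _)).
- move=> i1 j1; case: (unliftP ord0 i1) => [i2 ->|->]; case: (unliftP ord0 j1) => [j2 ->|->];
    rewrite ?fcons0 ?fconsS //.
  + by rewrite (zK i2).2.
  + by rewrite skew (zK j2).2 oppr0.
  + exact: alt.
Qed.

End HyperbolicPairs.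

Lemma bin2D i j : 'C(i + j, 2) = ('C(i, 2) + i * j + 'C(j, 2))%N.
Proof.
rewrite -binomial.Vandermonde !big_ord_recr big_ord0 /= !bin0 !bin1 subn0.
lia.
Qed.

(** * Lifting homs from F_p to Z/p^a *)

Section Carry.
Variables (p : nat) (G : groupType) (N : nat -> set G).
Hypothesis p_pr : prime p.
Hypothesis ncN : normal_chain N.
Local Notation F := 'F_p.
Local Notation smooth := (smooth N).
Local Notation smooth2 := (smooth2 N).
Variable U : set G.
Hypothesis gU : sgrp U.
Local Notation cob := (@coboundary_on p G N U).
Local Notation coc := (@cocycle_on p G N U).
Local Notation hom1 := (@hom_on p G N U).
Local Notation mod_hom := (mod_hom p N U).

Let UM u v : U u -> U v -> U (u * v)%g.
Proof. by case: gU => _ h _; exact: h. Qed.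

(* [q mod p] is the obstruction to lifting the hom [g : U -> Z/p^k] to Z/p^(k+1). *)
Definition carry k (g : G -> nat) (q : G -> G -> int) := forall x y, U x -> U y ->
  (g x)%:Z + (g y)%:Z - (g (x * y)%g)%:Z = (p ^ k)%:Z * q x y.

Let eq_modE k (m n : nat) : m = n %[mod p ^ k] <-> ((p ^ k)%:Z %| m%:Z - n%:Z)%Z.
Proof.
rewrite -eqz_mod_dvd !modz_nat eqz_nat; split=> [->|/eqP] //.
Qed.

Lemma mod_hom_carry k g : mod_hom k g -> exists2 q, smooth2 q & carry k g q.
Proof.
move=> [sg gM].
exists (fun x y => ((g x)%:Z + (g y)%:Z - (g (x * y)%g)%:Z) %/ (p ^ k)%:Z)%Z.
  apply: (smooth2_comp (fun z : int => z %/ (p ^ k)%:Z)%Z).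
  apply: (smooth2_op ncN (fun u v : int => u - v)); last exact: (smooth2_mul ncN (smooth_comp _ sg)).
  apply: (smooth2_op ncN (fun u v : int => u + v)).
    exact: smooth2_fst (smooth_comp _ sg).
  exact: smooth2_snd (smooth_comp _ sg).
move=> x y Ux Uy; rewrite mulrC divzK //.
by rewrite -PoszD; apply/eq_modE/esym/gM.
Qed.

Lemma carry_mod_hom k g q : smooth g -> carry k g q -> mod_hom k g.
Proof.
move=> sg gq; split=> // x y Ux Uy; apply/esym/eq_modE.
by rewrite PoszD gq // dvdz_mulr.
Qed.

Lemma carry_cocycle k g q : smooth2 q -> carry k g q -> coc (fun x y => (q x y)%:~R).
Proof.
move=> sq gq; split; first exact: (smooth2_comp (fun z : int => z%:~R : F)).
move=> x y z Ux Uy Uz; rewrite -!intrD; congr (_%:~R).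
have pk0 : (p ^ k)%:Z != 0 by rewrite eqz_nat expn_eq0 negb_and -lt0n prime_gt0.
apply: (mulfI pk0); rewrite !mulrDr -!gq //; try exact: UM.
rewrite mulgA; ring.
Qed.

Let F0E (z : int) : (z%:~R == 0 :> F) = (p %| z)%Z.
Proof. by rewrite -(dvdz_pcharf (pchar_Fp p_pr)). Qed.

Lemma carry_lift k g q : smooth g -> carry k g q -> cob (fun x y => (q x y)%:~R) ->
  exists g', mod_hom k.+1 g' /\ forall x, g' x = g x %[mod p ^ k].
Proof.
move=> sg gq [s ss sE].
exists (fun x => g x + p ^ k * val (- s x)%R)%N; split; last first.
  by move=> x; rewrite -modnDmr modnMr addn0.
split.
  apply: (smooth_op ncN (fun m (u : F) => m + p ^ k * val (- u)%R)%N) => //.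
move=> x y Ux Uy; apply/esym/eq_modE.
pose v u : int := (val (- s u)%R)%:Z.
have -> : (g x + p ^ k * val (- s x)%R + (g y + p ^ k * val (- s y)%R))%N%:Z -
   (g (x * y)%g + p ^ k * val (- s (x * y)%g)%R)%N%:Z =
   (p ^ k)%:Z * (q x y + v x + v y - v (x * y)%g).
  rewrite !PoszD !PoszM -/(v x) -/(v y) -/(v (x * y)%g) !mulrDr mulrN -gq //; ring.
have pk0 : (p ^ k)%:Z != 0 by rewrite eqz_nat expn_eq0 negb_and -lt0n prime_gt0.
rewrite expnSr PoszM dvdz_mul2l //.
rewrite -F0E rmorphB !rmorphD /=.
have vE u : (v u)%:~R = - s u :> F by rewrite /v; exact: natr_Zp.
by rewrite !vE sE //; apply/eqP; ring.
Qed.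

Definition lifts_to a (f : G -> F) := exists2 g, mod_hom a g & forall u, U u -> (g u)%:R = f u.

Lemma natr_mod k (m n : nat) : (0 < k)%N -> m = n %[mod p ^ k] -> m%:R = n%:R :> F.
Proof.
move=> k0 e; apply/eqP; rewrite -subr_eq0.
have -> : m%:R - n%:R = (m%:Z - n%:Z)%:~R :> F by rewrite rmorphB.
rewrite F0E; apply: dvdz_trans ((eq_modE _ _ _).1 e).
by rewrite -(subnK k0) addn1 expnS PoszM dvdz_mulr.
Qed.

Lemma lifts_to1 f : hom1 f -> lifts_to 1 f.
Proof.
move=> [sf fM]; exists (fun u => val (f u)); last by move=> u _; exact: natr_Zp.
split; first exact: (smooth_comp val).
move=> x y Ux Uy; apply/eq_modE; rewrite expn1 -F0E rmorphB /= PoszD rmorphD /=.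
by rewrite -!pmulrn !natr_Zp fM // subrr.
Qed.

Lemma lifts_toW k f : (0 < k)%N -> lifts_to k.+1 f -> lifts_to k f.
Proof.
move=> k0 [g [sg gM] gf]; exists g => //; split=> // x y Ux Uy.
have := gM x y Ux Uy; move=> /eq_modE e; apply/eq_modE; apply: dvdz_trans e.
by rewrite expnS PoszM dvdz_mull.
Qed.

Lemma carry_lin k g q g' q' n : carry k g q -> carry k g' q' ->
  carry k (fun x => g x + n * g' x)%N (fun x y => q x y + n%:Z * q' x y).
Proof.
move=> gq gq' x y Ux Uy; rewrite mulrDr -gq // mulrCA -gq' // !PoszD !PoszM; ring.
Qed.

(** Let [g0], with values modulo p^(k+1), be a hom that fails to lift at the first level where any
    does. Below that level nothing is obstructed. From it on, every obstruction is a multiple [e] of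
    that of [g0], and a multiple of [g0] corrects it; so homs lift after subtraction of a multiple
    of [g0] modulo p. *)
Lemma lifts_to_codim1 a : @H2_le1 p G N U ->
  exists f0 : G -> F, hom1 f0 /\ forall f, hom1 f -> exists c, lifts_to a.+1 (fun u => f u - c * f0 u).
Proof.
move=> h2.
pose bad k := exists g q, [/\ smooth g, smooth2 q, carry k.+1 g q & ~ cob (fun x y => (q x y)%:~R)].
have hom0 : hom1 (fun=> 0) by split=> [|x y _ _]; [exact: smooth_cst | rewrite addr0].
have step k f : ~ bad k -> lifts_to k.+1 f -> lifts_to k.+2 f.
  move=> nb [g gM gf]; have [q sq gq] := mod_hom_carry gM.
  have cq : cob (fun x y => (q x y)%:~R).
    by apply: contrapT => nc; apply: nb; exists g, q; split=> //; case: gM.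
  have [g' [g'M g'g]] := carry_lift gM.1 gq cq; exists g' => // u Uu.
  by rewrite (natr_mod _ (g'g u)) ?gf.
have [nobad|] := pselect (forall k, ~ bad k).
  exists (fun=> 0); split=> // f hf; exists 0.
  suff : lifts_to a.+1 f by move=> [g gM gf]; exists g => // u Uu; rewrite mul0r subr0 gf.
  by elim: a => [|a IH]; [exact: lifts_to1 | exact: step].
move=> /existsNP[k0 /contrapT bk0].
have ex : exists k, `[<bad k>] by exists k0; apply/asboolP.
case: (ex_minnP ex) => k /asboolP[g0 [q0 [sg0 sq0 gq0 nc0]]] kmin.
have small f j : hom1 f -> (j <= k)%N -> lifts_to j.+1 f.
  move=> hf; elim: j => [|j IH] jk; first exact: lifts_to1.
  apply: step; last by apply: IH; exact: ltnW.
  by move=> bj; have := kmin j (asboolT bj); rewrite leqNgt jk.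
have g0M := carry_mod_hom sg0 gq0.
exists (fun u => (g0 u)%:R); split.
  split; first exact: (smooth_comp (fun m => m%:R : F)).
  by move=> x y Ux Uy; rewrite (natr_mod _ (g0M.2 x y Ux Uy)) // natrD.
suff big j : (k <= j)%N -> forall f, hom1 f -> exists c, lifts_to j.+1 (fun u => f u - c * (g0 u)%:R).
  move=> f hf; have [c [g gM gf]] := big _ (leq_maxr a k) f hf; exists c.
  have : (a <= maxn a k)%N by exact: leq_maxl.
  move: gM; move: (maxn a k) => b + /subnK bE; rewrite -bE => gM.
  have : lifts_to ((b - a) + a).+1 (fun u => f u - c * (g0 u)%:R) by exists g.
  by elim: (b - a)%N => // i IH; rewrite addSn => /lifts_toW h; apply: IH; exact: h.
elim: j => [|j IH] kj f hf.
  by move: kj; rewrite leqn0 => /eqP k00; exists 0; have [g gM gf] := small f 0 hf isT;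
    exists g => // u Uu; rewrite mul0r subr0 gf.
move: kj; rewrite leq_eqVlt => /predU1P[kj|kj].
  exists 0; have := small f j.+1 hf; rewrite -kj leqnn => /(_ isT) [g gM gf].
  by exists g => // u Uu; rewrite mul0r subr0 gf.
have [c [g gM gf]] := IH kj f hf.
have [q sq gq] := mod_hom_carry gM.
have [e eP] := h2 _ _ (carry_cocycle sq0 gq0) (carry_cocycle sq gq) nc0.
(* Multiplication by [p ^ (j - k)] carries the obstruction of [g0] unchanged to the level [j.+1]. *)
have gq0' : carry j.+1 (fun x => p ^ (j - k) * g0 x)%N q0.
  move=> x y Ux Uy; rewrite !PoszM -mulrDr -mulrBr gq0 // mulrA -PoszM -expnD.
  by rewrite addnS subnK.
have gq1 := carry_lin (val (- e)%R) gq gq0'.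
have sg1 : smooth (fun x => g x + val (- e)%R * (p ^ (j - k) * g0 x))%N.
  exact: (smooth_op ncN (fun m m' => m + val (- e)%R * (p ^ (j - k) * m'))%N gM.1 sg0).
have [|g2 [g2M g2g]] := carry_lift sg1 gq1.
  have eE : (val (- e)%R)%:Z%:~R = - e :> F by exact: natr_Zp.
  by apply: eq_coboundary_on eP => x y _ _; rewrite intrD intrM eE mulNr.
exists (c + e * (p ^ (j - k))%:R), g2 => // u Uu.
rewrite (natr_mod _ (g2g u)) // natrD !natrM gf // natr_Zp; ring.
Qed.

(** For odd p a congruence modulo p would do; the square is for p = 2, where the parity of the
    binomial depends on m modulo 4. *)
Lemma bin2_mod (m n : nat) : m = n %[mod p ^ 2] -> 'C(m, 2) = 'C(n, 2) %[mod p].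
Proof.
wlog le_nm : m n / (n <= m)%N.
  by move=> h e; case: (leqP n m) => [/h|/ltnW /h <-//]; exact.
move=> /eqP; rewrite eqn_mod_dvd // => /dvdnP[k kE].
have -> : m = (n + k * p ^ 2)%N by rewrite -kE subnKC.
suff /eqP d : (p %| n * (k * p ^ 2) + 'C(k * p ^ 2, 2))%N.
  by rewrite bin2D -addnA -modnDmr d addn0.
rewrite dvdn_add //; first by rewrite dvdn_mull // dvdn_mull // dvdn_exp.
(* If k p is odd then so is k p^2, and its predecessor is even. *)
have /dvdnP[h hE] : (2 %| (k * p) * (k * p ^ 2).-1)%N.
  rewrite dvdn2; case: (posnP (k * p ^ 2)) => [->|kp]; first by rewrite muln0.
  rewrite oddM; case: (boolP (odd (k * p))) => //=; rewrite oddM => /andP[ok op].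
  by rewrite -subn1 oddB // oddM ok oddX op.
have -> : 'C(k * p ^ 2, 2) = (p * h)%N; last exact: dvdn_mulr.
rewrite bin2 -(@mulnK (p * h) 2) // -divn2; congr (_ %/ _)%N.
by rewrite -[RHS]mulnA -hE [RHS]mulnA expnS expn1 (mulnCA p k p).
Qed.

(** By [bin2D] the coboundary of C(g, 2) is minus g(x) g(y); lifting to Z/p^2 makes C(g, 2) well
    behaved modulo p. For p = 2 this is the vanishing of the Bockstein. *)
Lemma cupf_lift_self g : mod_hom 2 g ->
  cob (fun x y => (g x)%:R * (g y)%:R).
Proof.
move=> [sg gM]; exists (fun x => - ('C(g x, 2))%:R).
  exact: (smooth_comp (fun m => - ('C(m, 2))%:R : F)).
move=> x y Ux Uy.
have e : ('C(g (x * y)%g, 2))%:R = ('C(g x + g y, 2))%:R :> F.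
  by apply: (@natr_mod 1) => //; rewrite expn1; apply: bin2_mod; exact: gM.
rewrite e bin2D !natrD natrM; ring.
Qed.

End Carry.

(** * Finite p-groups as quotients of an open subgroup *)

Section Quotients.
Variables (p : nat) (G : groupType) (N : nat -> set G).
Hypothesis p_pr : prime p.
Hypothesis ncN : normal_chain N.
Local Notation F := 'F_p.
Local Notation smooth := (smooth N).
Variable U : set G.
Hypothesis gU : sgrp U.
Hypothesis oU : exists k, N k `<=` U.
Local Notation cob := (@coboundary_on p G N U).
Local Notation coc := (@cocycle_on p G N U).
Local Notation hom1 := (@hom_on p G N U).
Local Notation homsU := (@homs p G N U).

Definition has_quotients l := forall (gT : finGroupType) (X : {group gT}) (y : 'I_l -> gT),
  (p.-group X)%g -> (forall i, y i \in X) -> X \subset <<[set y i | i in 'I_l]%SET>>%g ->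
  exists phi : G -> gT, [/\ smooth phi,
    forall u v, U u -> U v -> phi (u * v)%g = (phi u * phi v)%g,
    forall u, U u -> phi u \in X &
    forall x, x \in X -> exists2 u, U u & phi u = x].

Lemma H2_zero_lifts a f : @H2_zero p G N U -> hom1 f -> lifts_to N U a.+1 f.
Proof.
move=> h0 hf.
have h2 : @H2_le1 p G N U by move=> c c' cc _ /(_ (h0 _ cc)).
elim: a => [|a [g gM gf]]; first exact: (lifts_to1 p_pr).
have [q sq gq] := mod_hom_carry ncN gM.
have [g' [g'M g'g]] := carry_lift p_pr ncN gM.1 gq (h0 _ (carry_cocycle p_pr gU sq gq)).
by exists g' => // u Uu; rewrite (natr_mod p_pr _ (g'g u)) ?gf.
Qed.

Let pgroup_dvd (gT : finGroupType) (X : {group gT}) a : (p.-group X)%g ->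
  (logn p #|X| <= a)%N -> (#|X| %| p ^ a)%N.
Proof. by move=> pX le; rewrite (card_pgroup pX) dvdn_exp2l. Qed.

(** Without H^2 the lifting argument applies with [psi] and [eta] zero, and all of H^1 may serve as
    [chi]. *)
Lemma H2_zero_quotients l : @H2_zero p G N U -> dim_ge homsU l -> has_quotients l.
Proof.
move=> h0 [v [Pv iv]] gT X y pX yX genX.
have /choice[chi chiP] : forall i, exists g, mod_hom p N U (logn p #|X|).+1 g /\
    forall u, U u -> (g u)%:R = v i u :> F.
  by move=> i; have [g gM gv] := H2_zero_lifts (logn p #|X|) h0 (Pv i).1; exists g.
apply: (@lift_surjective p G N p_pr ncN U (logn p #|X|).+1 l chi (fun _ _ => 0%N) (fun _ _ => 0)
  gU _ _ _ _ _ gT X y pX) => //.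
- by move=> i; case: (chiP i).
- move=> c cc; exists 0; apply: eq_coboundary_on (h0 _ cc) => x z _ _.
  by rewrite mul0r subr0.
- move=> i j; apply: eq_coboundary_on (coboundary0 _ _ _) => x z _ _.
  by rewrite mul0r mulr0 subr0.
- move=> i j; apply: eq_coboundary_on (coboundary0 _ _ _) => x z _ _.
  by rewrite mul0r.
- by apply: pgroup_dvd.
- move=> A b Ab i.
  have : lincomb v (\row_j b j) = 0.
    apply/funext => u; rewrite lincomb_fun /lincomb -[RHS]/(0 : F).
    have [Uu|nU] := pselect (U u); last first.
      by apply: big1 => j _; rewrite (Pv j).2 // scaler0.
    rewrite -[RHS](Ab u Uu); apply: eq_bigr => j _; rewrite mxE /lift_form.
    rewrite (chiP j).2 // big1 ?addr0 // => k _; by rewrite mulr0.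
  by move=> /iv /rowP/(_ i); rewrite !mxE.
Qed.

Lemma hom_on_normalise f : hom1 f -> exists2 f', homsU f' & forall u, U u -> f' u = f u.
Proof.
move=> [sf fM]; have [U1 UM UV] := gU; have [k kU] := oU.
exists (fun x => if `[<U x>] then f x else 0); last by move=> u Uu; rewrite asboolT.
split; last by move=> x nU; case: asboolP.
split; last by move=> x y Ux Uy; rewrite !asboolT //; [exact: fM | exact: UM].
have [l fl] := sf; exists (maxn k l) => x n nn.
have nU : U n by apply: kU; apply: (chain_le ncN _ nn); exact: leq_maxl.
rewrite fl; last by apply: (chain_le ncN _ nn); exact: leq_maxr.
suff -> : `[<U (x * n)%g>] = `[<U x>] by [].
apply/asboolP/asboolP => h; last exact: UM.
by rewrite -(mulgK n x); apply: UM => //; exact: UV.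
Qed.

Lemma lifts_to_lin a (t : F) (f f' : G -> F) : lifts_to N U a f -> lifts_to N U a f' ->
  lifts_to N U a (fun x => t * f x + f' x).
Proof.
move=> [g [sg gM] gf] [g' [sg' gM'] gf'].
exists (fun x => val t * g x + g' x)%N; last by move=> u Uu; rewrite natrD natrM natr_Zp gf // gf'.
split; first exact: (smooth_op ncN (fun m m' => val t * m + m')%N).
move=> x y Ux Uy; rewrite -modnDm -modnMmr gM // gM' // modnMmr modnDm.
by congr (_ %% _)%N; lia.
Qed.

Section Dual.
Hypotheses (h2 : @H2_le1 p G N U) (nd : @cup_nondegenerate p G N U).

(** The cup form on H^1 has a non-singular skew matrix [B]. Homs liftable to Z/p^(a+1) form a
    subspace of codimension at most 1 on which the form is alternating, and 4 l <= n leaves room in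
    it for [l] hyperbolic pairs; their lifts are [chi] and [psi]. *)
Lemma dual_quotients l m : dim_le homsU m -> dim_ge homsU (4 * l) -> has_quotients l.
Proof.
move=> hm hl gT X y pX yX genX.
(* For l = 0 there may be no non-zero class to serve as [eta], but then [X] is trivial. *)
case: l hl y yX genX => [|l] hl y yX genX.
  have X1 x : x \in X -> x = 1%g.
    move=> /(fintype.subsetP genX); rewrite (_ : [set y i | i in 'I_0]%SET = finset.set0).
      by rewrite gen0 finset.in_set1 => /eqP.
    by apply/setP => z; rewrite finset.inE; apply/imsetP => -[[]].
  exists (fun=> 1%g); split=> // [u v _ _|x /X1 ->]; first by rewrite mulg1.
  by exists 1%g => //; case: gU.
set L := l.+1 in hl y yX genX *.
have [n [nm [v [Pv iv sv]]]] := basis_dim_le hm.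
have nL : (4 * L <= n)%N by apply: (dim_ge_le hl); exists v.
have hv i : hom1 (v i) := (Pv i).1.
(* a generator of H^2(U, F_p) *)
have [a1 [b1 [ha1 hb1 ne]]] : exists a b, [/\ hom1 a, hom1 b & ~ cob (cupf a b)].
  have n0 : (0 < n)%N by lia.
  apply: contrapT => no.
  have : v (Ordinal n0) = 0.
    apply/funext => u; rewrite -[RHS]/(0 : F); have [Uu|nU] := pselect (U u); last by rewrite (Pv _).2.
    apply: (nd (hv _)) => // a ha; apply: contrapT => na; apply: no.
    by exists a, (v (Ordinal n0)).
  rewrite -lincomb_delta => /iv /rowP/(_ (Ordinal n0)); rewrite !mxE !eqxx => /eqP.
  by rewrite oner_eq0.
pose eta := cupf a1 b1.
have ce : coc eta by exact: cupf_cocycle.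
have eta_uniq t : cob (fun x z => t * eta x z) -> t = 0.
  move=> ct; apply: contrapT => /eqP t0; apply: ne.
  apply: eq_coboundary_on (coboundaryZ ncN t^-1 ct) => x z _ _.
  by rewrite mulrA mulVf // mul1r.
have /choice[b bP] : forall i, exists b : 'I_n -> F, forall j,
    cob (fun x z => cupf (v i) (v j) x z - b j * eta x z).
  move=> i; have [f fP] := choice (fun j => h2 ce (cupf_cocycle ncN (hv i) (hv j)) ne).
  by exists f.
pose B : 'M[F]_n := \matrix_(i, j) b i j.
pose lc (x : 'rV[F]_n) : G -> F := lincomb v x.
have hlc x : homsU (lc x) by apply: subspace_lincomb => //; exact: homs_subspace.
have lcE x u : lc x u = \sum_i x 0 i * v i u by rewrite /lc lincomb_fun.
have cupE x z : cob (fun u w => cupf (lc x) (lc z) u w - (x *m B *m z^T) 0 0 * eta u w).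
  have c1 : cob (fun u w => \sum_i \sum_j x 0 i * z 0 j * (cupf (v i) (v j) u w - b i j * eta u w)).
    by do 2![apply: (coboundary_sum ncN) => ?]; exact: (coboundaryZ ncN).
  apply: eq_coboundary_on c1 => u w _ _.
  have -> : (x *m B *m z^T) 0 0 = \sum_i \sum_j x 0 i * z 0 j * b i j.
    rewrite -mulmxA mxE; apply: eq_bigr => i _; rewrite mxE mulr_sumr.
    by apply: eq_bigr => j _; rewrite !mxE; ring.
  rewrite /cupf !lcE mulr_suml mulr_suml -sumrB; apply: eq_bigr => i _.
  rewrite mulr_sumr mulr_suml -sumrB; apply: eq_bigr => j _.
  rewrite /cupf; ring.
have skew (x z : 'rV[F]_n) : (x *m B *m z^T) 0 0 = - (z *m B *m x^T) 0 0.
  apply/eqP; rewrite -addr_eq0; apply/eqP/eta_uniq.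
  have := coboundaryB ncN (cupf_skew ncN (hlc x).1 (hlc z).1) (coboundaryD ncN (cupE x z) (cupE z x)).
  by apply: eq_coboundary_on => u w _ _; ring.
have cob0 (x z : 'rV[F]_n) : (x *m B *m z^T) 0 0 = 0 -> cob (cupf (lc x) (lc z)).
  by move=> e; apply: eq_coboundary_on (cupE x z) => u w _ _; rewrite e mul0r subr0.
have uB : row_free B.
  rewrite -kermx_eq0; apply/eqP/row_matrixP => i; rewrite row0.
  set c := row i _.
  have cB : c *m B = 0 by rewrite /c -row_mul mulmx_ker row0.
  apply: iv; apply/funext => u; rewrite -[RHS]/(0 : F); have [Uu|nU] := pselect (U u); last first.
    by have := (hlc c).2 u nU.
  apply: (nd (hlc c).1) => // f hf; have [f' hf' ff'] := hom_on_normalise hf.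
  have [z zE] := sv _ hf'.
  have : cob (cupf (lc z) (lc c)).
    by apply: cob0; rewrite skew cB mul0mx mxE oppr0.
  by apply: eq_coboundary_on => w w' Uw Uw'; rewrite /cupf /lc -zE ff'.
(* Lifts are taken modulo p^(a+1): the exponent is then at least 2 even for trivial [X], as
   alternation requires, and p^a is a multiple of the order of [X]. *)
pose a := (logn p #|X|).+1.
pose P : set (G -> F^o) := [set f | homsU f /\ lifts_to N U a.+1 f].
have sP : subspace P.
  have [h0 hD] := @homs_subspace p G N ncN U.
  split; first by split=> //; exists (fun=> 0%N) => //; split=> //; exact: smooth_cst.
  by move=> t f g [hf lf] [hg lg]; split; [exact: hD | exact: lifts_to_lin].
have [f0 [hf0 f0P]] := lifts_to_codim1 p_pr ncN gU a h2.
have dP : dim_ge P n.-1.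
  have n1 : n = n.-1.+1 by lia.
  apply: (@dim_ge_codim1 _ _ homsU P n.-1 (@homs_subspace p G N ncN U)); last first.
    by rewrite -n1; exists v.
  move=> f g hf hg nPf.
  have [c1 l1] := f0P _ hf.1; have [c2 l2] := f0P _ hg.1.
  have c10 : c1 != 0.
    apply/eqP => c10; apply: nPf; split=> //; case: l1 => k kM kf.
    by exists k => // u Uu; rewrite kf // c10 mul0r subr0.
  exists (c2 / c1); split.
    by rewrite -scaleNr addrC; apply: (@homs_subspace p G N ncN U).2.
  have [k kM kf] := lifts_to_lin (- (c2 / c1)) l1 l2.
  exists k => // u Uu; rewrite kf //.
  change (- (c2 / c1) * (f u - c1 * f0 u) + (g u - c2 * f0 u) = g u - c2 / c1 * f u).
  by field.
have [w [Pw iw]] := dP.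
have /choice[wc wE] := fun i => sv _ (Pw i).1.
pose W := \matrix_i wc i.
have WE c : lc (c *m W) = lincomb w c.
  rewrite /lc -lincomb_mul (_ : (fun i => lincomb v (row i W)) = w) //.
  by apply/funext => i; rewrite rowK -wE.
have rW : \rank W = n.-1.
  apply/eqP; rewrite -[_ == _]/(row_free W) -kermx_eq0; apply/eqP/row_matrixP => i.
  rewrite row0; apply: iw; rewrite -WE -row_mul mulmx_ker row0.
  exact: lincomb0.
have WP (x : 'rV_n) : (x <= W)%MS -> P (lc x).
  by move=> /submxP[D ->]; rewrite WE; exact: subspace_lincomb.
have alt (x : 'rV_n) : (x <= W)%MS -> (x *m B *m x^T) 0 0 = 0.
  move=> /WP [_ lx]; apply: eta_uniq.
  have {}lx : lifts_to N U 2 (lc x).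
    have h k : lifts_to N U (k + 2) (lc x) -> lifts_to N U 2 (lc x).
      by elim: k => // k IH; rewrite addSn => hk; apply/IH/lifts_toW => //; rewrite addn2.
    by apply: (h (logn p #|X|)); rewrite addn2.
  have [g gM gf] := lx.
  have cg := cupf_lift_self p_pr gM.
  have := coboundaryB ncN cg (cupE x x); apply: eq_coboundary_on => u u' Uu Uu'.
  by rewrite /cupf !gf //; ring.
have [|x [z [xW zW zx zz]]] := hyperbolic_pairs (l := L) uB skew alt.
  by right; rewrite rW; lia.
have /choice[chi chiP] : forall i, exists g, mod_hom p N U a.+1 g /\
    forall u, U u -> (g u)%:R = lc (x i) u.
  by move=> i; have [_ [g gM gv]] := WP _ (xW i); exists g.
have /choice[psi psiP] : forall i, exists g, mod_hom p N U a.+1 g /\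
    forall u, U u -> (g u)%:R = lc (z i) u.
  by move=> i; have [_ [g gM gv]] := WP _ (zW i); exists g.
have psi_chi i j : cob (fun u u' => (psi j u)%:R * (chi i u')%:R - (i == j)%:R * eta u u').
  apply: eq_coboundary_on (cupE (z j) (x i)) => u u' Uu Uu'.
  by rewrite /cupf (psiP j).2 // (chiP i).2 // zx.
have psi_psi j k : cob (fun u u' => (psi j u)%:R * (psi k u')%:R).
  apply: eq_coboundary_on (cob0 _ _ (zz j k)) => u u' Uu Uu'.
  by rewrite /cupf (psiP j).2 // (psiP k).2.
apply: (@lift_surjective p G N p_pr ncN U a.+1 L chi psi eta gU _ _ _ psi_chi psi_psi gT X y pX) => //.
- by move=> i; case: (chiP i).
- by move=> i; case: (psiP i).
- by move=> c cc; exact: (h2 ce cc ne).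
- by apply: pgroup_dvd => //; rewrite /a; lia.
(* Cupping a linear relation between the forms with [psi k] leaves [c k] times [eta], by duality and
   isotropy of the pairs. *)
- move=> A c cA k; apply: eta_uniq.
  have c1 : cob (fun u u' => \sum_i c i * (((psi k u)%:R * (chi i u')%:R - (i == k)%:R * eta u u') +
     \sum_j A i j * ((psi k u)%:R * (psi j u')%:R))).
    apply: (coboundary_sum ncN) => i; apply: (coboundaryZ ncN); apply: (coboundaryD ncN) => //.
    by apply: (coboundary_sum ncN) => j; exact: (coboundaryZ ncN).
  apply: eq_coboundary_on (coboundaryZ ncN (-1) c1) => u u' Uu Uu'.
  have -> : \sum_i c i * (((psi k u)%:R * (chi i u')%:R - (i == k)%:R * eta u u') +
     \sum_j A i j * ((psi k u)%:R * (psi j u')%:R)) =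
     (psi k u)%:R * (\sum_i c i * lift_form chi psi A i u') - \sum_i c i * (i == k)%:R * eta u u'.
    rewrite mulr_sumr -sumrB; apply: eq_bigr => i _.
    rewrite /lift_form (_ : \sum_j A i j * ((psi k u)%:R * _) = (psi k u)%:R * \sum_j A i j * (psi j u')%:R).
      ring.
    by rewrite mulr_sumr; apply: eq_bigr => j _; ring.
  rewrite cA // mulr0 sub0r (bigD1 k) //= eqxx mulr1 big1 => [|i /negbTE ->].
    by rewrite addr0 mulN1r opprK.
  by rewrite mulr0 mul0r.
Qed.

End Dual.

End Quotients.

(** * Generators of finite quotients *)

Section Generators.
Variables (p : nat) (G : groupType) (N : nat -> set G).
Hypothesis p_pr : prime p.
Hypothesis ncN : normal_chain N.
Local Notation F := 'F_p.
Local Notation smooth := (smooth N).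
Variable U : set G.
Hypothesis gU : sgrp U.
Hypothesis oU : exists k, N k `<=` U.
Local Notation homsU := (@homs p G N U).
Variables (gT : finGroupType) (P : {group gT}) (phi : G -> gT).
Hypotheses (pP : (p.-group P)%g) (sphi : smooth phi).
Hypothesis phiM : forall u v, U u -> U v -> phi (u * v)%g = (phi u * phi v)%g.
Hypothesis phiP : forall u, U u -> phi u \in P.
Hypothesis phi_onto : forall x, x \in P -> exists2 u, U u & phi u = x.

Definition pullback_homs (H : {set gT}) : set (G -> F^o) :=
  [set f | homsU f /\ exists lam : gT -> F,
    [/\ hom_in P lam, forall h, h \in H -> lam h = 0 & forall u, U u -> f u = lam (phi u)]].

Lemma pullback_subspace (H : {set gT}) : subspace (pullback_homs H).
Proof.
have [h0 hD] := @homs_subspace p G N ncN U; split.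
  by split=> //; exists (fun=> 0); split=> // x y _ _; rewrite addr0.
move=> t f g [hf [lf [lfM lf0 lfE]]] [hg [lg [lgM lg0 lgE]]]; split; first exact: hD.
exists (fun x => t * lf x + lg x); split.
- by move=> x y xP yP; rewrite lfM // lgM //; ring.
- by move=> h hH; rewrite lf0 // lg0 //; ring.
- by move=> u Uu; rewrite -lfE // -lgE.
Qed.

Let pullbackE (H : {set gT}) (lam : gT -> F) : hom_in P lam -> (forall h, h \in H -> lam h = 0) ->
  exists2 f, pullback_homs H f & forall u, U u -> f u = lam (phi u).
Proof.
move=> lM l0.
have [|f hf fE] := @hom_on_normalise p G N ncN U gU oU (fun u => lam (phi u)).
  split; first exact: (smooth_comp lam).
  by move=> x y Ux Uy; rewrite phiM // lM ?phiP.
by exists f => //; split=> //; exists lam.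
Qed.

(** If some hom kills [H] but not [P], add to [H] an element on which it is non-zero: that hom no
    longer pulls back, so the dimension drops by one with each added generator. *)
Lemma image_generated d (H : {group gT}) : H \subset P -> dim_le (pullback_homs H) d ->
  exists y : 'I_d -> gT, (forall i, y i \in P) /\
    P \subset <<H :|: [set y i | i in 'I_d]%SET>>%g.
Proof.
elim: d H => [|d IH] H HP hd.
  exists (fun=> 1%g); split=> [i|]; first exact: group1.
  apply: (@fintype.subset_trans _ _ H); last by rewrite -{1}[gval H]genGid genS // finset.subsetUl.
  apply: contraT => nPH.
  have prH : H \proper P by rewrite fintype.properE HP.
  have [lam [lM l0 [x xP xl]]] := proper_hom_in p_pr pP prH.
  have [f Vf fE] := pullbackE lM l0.
  have [v sv] := hd; have [c cE] := sv _ Vf.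
  have [u Uu uE] := phi_onto xP.
  move: xl; rewrite -uE -fE // cE lincomb_fun /lincomb big_ord0.
  by rewrite eqxx.
have [PH|nPH] := boolP (P \subset H).
  exists (fun=> 1%g); split=> [i|]; first exact: group1.
  by apply: (fintype.subset_trans PH); rewrite -{1}[gval H]genGid genS // finset.subsetUl.
have prH : H \proper P by rewrite fintype.properE HP.
have [lam [lM l0 [x xP xl]]] := proper_hom_in p_pr pP prH.
have [f Vf fE] := pullbackE lM l0.
pose H' := (<<H :|: [set x]>>)%G.
have xH' : x \in H' by rewrite mem_gen // finset.in_setU finset.in_set1 eqxx orbT.
have HH' : H \subset H' by rewrite -{1}[gval H]genGid genS // finset.subsetUl.
have H'P : H' \subset P by rewrite gen_subG finset.subUset HP finset.sub1set.
have VV : pullback_homs H' `<=` pullback_homs H.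
  move=> g [hg [l [l1 l2 l3]]]; split=> //; exists l; split=> // h hH.
  by apply: l2; exact: (fintype.subsetP HH').
have hd' : dim_le (pullback_homs H') d.
  apply: (dim_le_proper (pullback_subspace H) (pullback_subspace H') VV _ hd).
  exists f => // -[_ [l [l1 l2 l3]]].
  have [u Uu uE] := phi_onto xP.
  have := l2 x xH'; rewrite -uE -l3 // fE // uE => /eqP; exact/negP.
have [y [yP yg]] := IH H' H'P hd'.
exists (fcons x y); split=> [i|].
  by case: (unliftP ord0 i) => [j ->|->]; rewrite ?fcons0 ?fconsS.
apply: (fintype.subset_trans yg); rewrite gen_subG finset.subUset gen_subG finset.subUset.
rewrite finset.sub1set; apply/andP; split; first (apply/andP; split).
- by apply: fintype.subset_trans (subset_gen _); exact: finset.subsetUl.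
- by rewrite mem_gen // finset.in_setU; apply/orP; right; apply/imsetP; exists ord0; rewrite ?fcons0.
- apply/fintype.subsetP => _ /imsetP[i _ ->].
  rewrite mem_gen // finset.in_setU; apply/orP; right; apply/imsetP.
  by exists (lift ord0 i); rewrite ?fconsS.
Qed.

Lemma image_generated_homs m : dim_le homsU m ->
  exists y : 'I_m -> gT, (forall i, y i \in P) /\ P \subset <<[set y i | i in 'I_m]%SET>>%g.
Proof.
move=> hm.
have [|y [yP yg]] := @image_generated m 1%G (sub1G P).
  by apply: dim_leS hm => f [].
exists y; split=> //; apply: (fintype.subset_trans yg).
rewrite gen_subG finset.subUset subset_gen andbT finset.sub1set; exact: group1.
Qed.

End Generators.

(** * Quotients that are direct powers *)

Section Powers.
Variables (p : nat) (G : groupType) (N : nat -> set G) (U : set G).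

(** The K-th power of [P] is generated by the K m elements having a single coordinate [y j] and the
    others 1. *)
Lemma power_quotient K m (gT : finGroupType) (P : {group gT}) (y : 'I_m -> gT) :
  @has_quotients p G N U (K * m) -> (p.-group P)%g -> (forall i, y i \in P) ->
  P \subset <<[set y i | i in 'I_m]%SET>>%g ->
  exists phi : G -> 'I_K -> gT, [/\ smooth N phi,
    forall u v, U u -> U v -> phi (u * v)%g = (fun i => phi u i * phi v i)%g,
    forall u i, U u -> phi u i \in P &
    forall x : 'I_K -> gT, (forall i, x i \in P) -> exists2 u, U u & phi u = x].
Proof.
move=> hq pP yP genP.
pose X := setXn (fun _ : 'I_K => P).
have gX : group_set X by exact: group_setXn.
have pX : (p.-group (Group gX))%g.
  rewrite /pgroup /= cardsXn; apply: (big_ind (fun n => p.-nat n)) => //.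
  by move=> n n' pn pn'; rewrite pnatM pn.
have cK : #|{: 'I_K * 'I_m}| = (K * m)%N by rewrite card_prod !card_ord.
pose z (k : 'I_(K * m)) : {dffun forall i : 'I_K, gT} :=
  let ij := enum_val (cast_ord (esym cK) k) in dfung1 (y ij.2 : (fun=> gT) ij.1).
have zX k : z k \in X.
  apply/setXnP => i; rewrite /z ffunE.
  by case: eqtype.dfwithP => [|j _]; [exact: yP | exact: group1].
have genX : Group gX \subset <<[set z k | k in 'I_(K * m)]%SET>>%g.
  have sub1 i : set1gXn (P : {set (fun=> gT) i}) \subset <<[set z k | k in 'I_(K * m)]%SET>>%g.
    rewrite -morphim_dfung1.
    apply: (fintype.subset_trans (morphimS _ genP)).
    rewrite morphim_gen; last exact: finset.subsetT.
    apply: genS; apply/fintype.subsetP => _ /morphimP[_ _ /imsetP[j _ ->] ->].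
    apply/imsetP; exists (cast_ord cK (enum_rank (i, j))) => //.
    by rewrite /z cast_ordK enum_rankK.
  apply/fintype.subsetP => x /=; rewrite /X -setXn_prod => /prodsgP[f fP ->].
  by apply: group_prod => i _; apply: (fintype.subsetP (sub1 i)); exact: fP.
have [phi [sphi phiM phiX phi_onto]] := hq _ (Group gX) z pX zX genX.
exists (fun u i => phi u i); split.
- exact: (smooth_comp (fun (f : {dffun forall i : 'I_K, gT}) i => f i) sphi).
- by move=> u v Uu Uv; apply/funext => i; rewrite phiM // ffunE.
- by move=> u i Uu; have /setXnP := phiX u Uu; apply.
- move=> x xP; have [|u Uu uE] := phi_onto [ffun i => x i].
    by apply/setXnP => i; rewrite ffunE.
  by exists u => //; apply/funext => i; rewrite uE ffunE.
Qed.

End Powers.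

(** * Centralisers and metabelian quotients *)

Definition finite_indices (G : groupType) (N : nat -> set G) := forall U : set G, sgrp U ->
  (exists k, N k `<=` U) -> exists m (cs : G -> 'I_m.+1) t, left_transversal U cs t.

Section FiniteQuotients.
Variables (p : nat) (G : groupType) (N : nat -> set G).
Hypothesis p_pr : prime p.
Hypothesis ncN : normal_chain N.
Hypothesis pimg : p_images p N.
Hypothesis fidx : finite_indices N.
Local Notation F := 'F_p.
Local Notation smooth := (smooth N).
Local Notation homsT := (@homs p G N setT).

Lemma sgrpT : sgrp [set: G].
Proof. by split. Qed.

Lemma openT : exists k, N k `<=` [set: G].
Proof. by exists 0%N. Qed.

Lemma finite_quotient (M : set G) : sgrp M -> (exists k, N k `<=` M) ->
  (forall x g, M x -> M (x ^ g)%g) ->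
  exists (gT : finGroupType) (pi : G -> gT) (P : {group gT}),
    [/\ {morph pi : x y / (x * y)%g}, forall x, pi x = 1%g <-> M x, smooth pi, (p.-group P)%g &
        (forall x, pi x \in P) /\ forall h, h \in P -> exists x, pi x = h].
Proof.
move=> gM oM nM; have [m [cs [t trv]]] := fidx gM oM.
have [M1 MM MV] := gM.
have csM x u : M u -> cs (x * u)%g = cs x.
  by move=> Mu; apply/esym; apply/(trv_eq trv); rewrite mulKg.
have cs_mul g x : cs (g * x)%g = cs (g * t (cs x))%g.
  apply/(trv_eq trv); rewrite invMg -mulgA mulKg; apply/(trv_eq trv).
  by rewrite (trv_K trv).
(* The inverse turns the left action on cosets into a right action, to match the composition of
   permutations. *)
pose act g i := cs (g^-1 * t i)%g.
have actM x y i : act (x * y)%g i = act y (act x i).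
  by rewrite /act invMg -mulgA cs_mul.
have act1 i : act 1%g i = i by rewrite /act invg1 mul1g (trv_K trv).
have act_inj g : injective (act g).
  by apply: (can_inj (g := act g^-1%g)) => i; rewrite -actM mulgV act1.
pose pi g := perm (@act_inj g).
have piM : {morph pi : x y / (x * y)%g}.
  by move=> x y; apply/permP => i; rewrite permM !permE actM.
have piK x : pi x = 1%g <-> M x.
  split=> [/permP/(_ (cs 1%g))|Mx].
    rewrite permE perm1 /act (trv_1 trv) mulg1 => e.
    have /(trv_eq trv) : cs x^-1%g = cs 1%g by rewrite e.
    by rewrite invgK mulg1.
  apply/permP => i; rewrite permE perm1 /act (conjgC _ (t i)) csM ?(trv_K trv) //.
  by apply: nM; exact: MV.
have spi : smooth pi.
  have [k kM] := oM; exists k => x n nk.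
  by rewrite piM (_ : pi n = 1%g) ?mulg1 //; apply/piK/kM.
have gP : group_set [set h | `[<exists x, pi x = h>]]%SET.
  apply/group_setP; split.
    by rewrite finset.in_set; apply/asboolP; exists 1%g; apply/piK.
  move=> h h'; rewrite !finset.in_set => /asboolP[x xE] /asboolP[y yE]; apply/asboolP.
  by exists (x * y)%g; rewrite piM xE yE.
have inP x : pi x \in Group gP by rewrite finset.in_set; apply/asboolP; exists x.
have onP h : h \in Group gP -> exists x, pi x = h by rewrite finset.in_set => /asboolP.
exists _, pi, (Group gP); split=> //.
exact: (pimg spi piM inP onP).
Qed.

(** If [al] cupped with [be] has primitive [s], then s(z y) = s(y z) forces al(z) be(y) = be(z)
    al(y). So for al(z) non-zero the annihilator of [al] has dimension at most 1, whereas it has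
    codimension at most 1 in H^1, and is all of H^1 when H^2 = 0. *)
Lemma central_trivial_aux (U : set G) z : sgrp U -> (exists k, N k `<=` U) -> U z ->
  (forall y, U y -> (z * y = y * z)%g) -> @H2_le1 p G N U -> dim_ge (@homs p G N U) 3 \/
  (@H2_zero p G N U /\ dim_ge (@homs p G N U) 2) ->
  forall al, homs N U al -> al z = 0 :> F.
Proof.
move=> gU oU Uz zc h2 dims al hal; apply: contrapT => /eqP alz.
pose P : set (G -> F^o) := [set be | homs N U be /\ coboundary_on N U (cupf (al : G -> F) be)].
have P1 : dim_le P 1.
  exists (fun=> al) => be [hbe [s _ sE]].
  exists (\row_i (be z / al z)).
  apply/funext => y; rewrite lincomb_fun /lincomb big_ord1 mxE -[RHS]/(be z / al z * al y).
  have [Uy|nU] := pselect (U y); last by rewrite (hbe.2 y) // (hal.2 y) // mulr0.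
  have := sE z y Uz Uy; rewrite /cupf zc // => e1; have e2 := sE y z Uy Uz.
  have e : al z * be y = be z * al y.
    rewrite e1 [RHS]mulrC; apply: etrans (esym e2); ring.
  by rewrite mulrAC -e mulrAC mulfV // mul1r.
have P2 : dim_ge P 2.
  case: dims => [d3|[h0 d2]].
    apply: (dim_ge_codim1 (@homs_subspace p G N ncN U) _ d3) => f g hf hg nPf.
    have nc : ~ coboundary_on N U (cupf (al : G -> F) f) by move=> c; apply: nPf.
    have [lam lamP] := h2 _ _ (cupf_cocycle ncN hal.1 hf.1) (cupf_cocycle ncN hal.1 hg.1) nc.
    exists lam; split.
      by rewrite -scaleNr addrC; apply: (@homs_subspace p G N ncN U).2.
    apply: eq_coboundary_on lamP => x y _ _; rewrite /cupf.
    rewrite -[(g - lam *: f) y]/(g y - lam * f y); ring.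
  apply: dim_geS d2 => f hf; split=> //; exact: (h0 _ (cupf_cocycle ncN hal.1 hf.1)).
by have := dim_ge_le P2 P1.
Qed.

Section Big.
Hypothesis h2 : @H2_le1 p G N setT.
Hypothesis big : (@cup_nondegenerate p G N setT /\ dim_ge homsT 3) \/
  (@H2_zero p G N setT /\ dim_ge homsT 2).
Hypothesis sepN : forall x, (forall k, N k x) -> x = 1%g.

(* On an open [U] in which [z] is central, cupping with a hom that is non-zero at
   [z] annihilates only the multiples of that hom. *)
Lemma central_trivial z k : (forall y, N k y -> (z * y = y * z)%g) -> z = 1%g.
Proof.
move=> zc; apply: contrapT => z1.
have [k' [kk' nz]] : exists k', (k <= k')%N /\ ~ N k' z.
  apply: contrapT => no; apply: z1; apply: sepN => i.
  apply: (chain_le ncN (leq_maxr k i)); apply: contrapT => nz; apply: no.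
  by exists (maxn k i); rewrite leq_maxl.
have [gT [pi [P [piM piK spi pP [inP _]]]]] := finite_quotient (chain_sgrp ncN k')
  (ex_intro _ k' (fun x h => h)) (@chain_normal _ _ ncN k').
pose C := <[pi z]>%G.
have pC : (p.-group C)%g by apply: pgroupS pP; rewrite cycle_subG.
have pr1 : 1%G \proper C.
  rewrite fintype.properE sub1G /= cycle_subG finset.in_set1; apply/eqP => /piK; exact: nz.
have [lam [lamM _ [x xC lx]]] := proper_hom_in p_pr pC pr1.
have lamz : lam (pi z) != 0.
  apply/eqP => l0; move: lx; have /cycleP[i ->] := xC.
  by rewrite (hom_inX _ lamM) ?cycle_id // l0 mul0r eqxx.
(* Elements of [U] are powers of [z] times elements of [N k'], which commute with [z]. So [z] is
   central in [U], and [lam] gives a hom on [U] that is non-zero at [z]. *)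
pose U := [set x | pi x \in C].
have pi1 : pi 1%g = 1%g by apply/piK; case: (chain_sgrp ncN k').
have piV y : pi y^-1%g = (pi y)^-1%g by apply: (@mulgI _ (pi y)); rewrite -piM !mulgV.
have piX i : pi (z ^+ i)%g = (pi z ^+ i)%g.
  by elim: i => [|i IH]; rewrite ?expg0 // !expgS piM IH.
have gU : sgrp U.
  split; first by rewrite /U /= pi1 group1.
    by move=> a b; rewrite /U /= piM => aC bC; exact: groupM.
  by move=> a; rewrite /U /= piV groupV.
have oU : exists l, N l `<=` U.
  by exists k' => y /piK; rewrite /U /= => ->; exact: group1.
have Uz : U z by rewrite /U /= cycle_id.
have zcU y : U y -> (z * y = y * z)%g.
  rewrite /U /= => /cycleP[i yE].
  have /(chain_le ncN kk') ny : N k' (z ^- i * y)%g.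
    by apply/piK; rewrite piM piV piX yE mulVg.
  rewrite -[y](mulVKg (z ^+ i)%g); move: (z ^- i * y)%g ny => n ny.
  by rewrite !mulgA -expgS expgSr -!mulgA; congr (_ * _)%g; exact: zc.
have [m [cs [t trv]]] := fidx gU oU.
have [al hal alE] : exists2 al, homs N U al & forall u, U u -> al u = lam (pi u).
  apply: (@hom_on_normalise p G N ncN U gU oU (fun u => lam (pi u))); split.
    exact: (smooth_comp lam).
  by move=> a b aC bC; rewrite piM lamM.
have dual : @H2_zero p G N setT \/ @cup_nondegenerate p G N setT.
  by case: big => -[? _]; [right | left].
have h2U := H2_le1_open p_pr ncN pimg oU trv h2 dual.
have : al z = 0; last by rewrite alE // => e; move: lamz; rewrite e eqxx.
apply: (central_trivial_aux gU oU Uz zcU h2U _ hal).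
case: big => [[nd d3]|[h0 d2]].
  left; have := homs_dim_ge p_pr ncN pimg gU oU trv h2 d3.
  by apply: dim_ge_leq; lia.
right; split; first exact: (H2_zero_open p_pr ncN pimg oU trv h0).
have := homs_dim_ge_free p_pr ncN pimg gU oU trv h0 d2.
by apply: dim_ge_leq; lia.
Qed.

(** For index m + 1 the rank formulas give dim H^1(U) at least m + 3 from rank 3 in the dual case
    and m + 2 from rank 2 in the free case, so at least the index. *)
Lemma big_has_quotients (U : set G) m (cs : G -> 'I_m.+1) t l n : sgrp U ->
  (exists k, N k `<=` U) -> left_transversal U cs t -> dim_le homsT n ->
  (4 * l <= m.+1)%N -> @has_quotients p G N U l.
Proof.
move=> gU oU trv hn lm.
case: big => [[nd d3]|[h0 d2]].
  apply: (dual_quotients p_pr ncN gU oU (H2_le1_open p_pr ncN pimg oU trv h2 (or_intror nd))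
    (cup_nondegenerate_open p_pr ncN pimg gU oU trv h2 nd)
    (homs_dim_le p_pr ncN pimg gU oU trv hn)).
  have := homs_dim_ge p_pr ncN pimg gU oU trv h2 d3.
  by apply: dim_ge_leq; lia.
apply: (H2_zero_quotients p_pr ncN gU (H2_zero_open p_pr ncN pimg oU trv h0)).
have := homs_dim_ge_free p_pr ncN pimg gU oU trv h0 d2.
by apply: dim_ge_leq; lia.
Qed.

End Big.

(* The conclusion says that the finite quotients [G / N k] are metabelian. *)
Lemma cyclic_metabelian k : dim_le homsT 1 ->
  exists V : set G, [/\ sgrp V, forall x y, V [~ x, y]%g &
    forall a b, V a -> V b -> N k [~ a, b]%g].
Proof.
move=> h1.
have [gT [pi [P [piM piK spi pP [inP onP]]]]] := finite_quotient (chain_sgrp ncN k)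
  (ex_intro _ k (fun x h => h)) (@chain_normal _ _ ncN k).
exists setT; split=> //.
move=> a b _ _.
have [y [yP yg]] := image_generated_homs p_pr ncN sgrpT openT pP spi
  (fun u v _ _ => piM u v) (fun u _ => inP u)
  (fun x xP => let: ex_intro u uE := onP x xP in ex_intro2 _ _ u I uE) h1.
have gen1 x : pi x \in <[y ord0]>%g.
  have := fintype.subsetP yg _ (inP x); apply: (fintype.subsetP _); apply: genS.
  by apply/fintype.subsetP => _ /imsetP[i _ ->]; rewrite finset.in_set1 ord1.
have piR : pi [~ a, b]%g = [~ pi a, pi b]%g.
  have pi1 : pi 1%g = 1%g by apply/piK; case: (chain_sgrp ncN k).
  have piV c : pi c^-1%g = (pi c)^-1%g by apply: (@mulgI _ (pi c)); rewrite -piM !mulgV.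
  by rewrite /commg /conjg !piM !piV.
apply/piK; rewrite piR; apply/eqP/commgP.
by apply: (centsP (cycle_abelian (y ord0))).
Qed.

(** Let U_i be the preimage of the multiples of p^i under a hom [g] to Z/p^a. The images of the U_i
    in a finite group with fewer than [a] elements cannot drop every time, so U_i and U_(i+1) have
    equal image for some i. Then g / p^i is a hom on U_i not induced from that image; as H^1(U_i,
    F_p) has dimension at most 2, the image of U_i is cyclic. All commutators lie in U_i. *)
Lemma rank2_metabelian k : @H2_le1 p G N setT -> @cup_nondegenerate p G N setT ->
  dim_le homsT 2 -> dim_ge homsT 2 ->
  exists V : set G, [/\ sgrp V, forall x y, V [~ x, y]%g &
    forall a b, V a -> V b -> N k [~ a, b]%g].
Proof.
move=> h2 nd hle [v [Pv iv]].
have [gT [pi [P [piM piK spi pP [inP onP]]]]] := finite_quotient (chain_sgrp ncN k)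
  (ex_intro _ k (fun x h => h)) (@chain_normal _ _ ncN k).
have pi1 : pi 1%g = 1%g by apply/piK; case: (chain_sgrp ncN k).
have piV c : pi c^-1%g = (pi c)^-1%g by apply: (@mulgI _ (pi c)); rewrite -piM !mulgV.
pose w := #|gT|; pose a := w.+1.
(* a hom to Z/p^a that is onto, with more steps than the quotient has elements *)
have [f [x0 [[g [sg gM] gf] fx0]]] : exists (f : G -> F) x0,
    lifts_to N setT a f /\ f x0 != 0.
  have [f0 [hf0 f0P]] := lifts_to_codim1 p_pr ncN sgrpT w h2.
  apply: contrapT => no.
  have zero i : exists c, v i = (fun x => c * f0 x) :> (G -> F).
    have [c l] := f0P _ (Pv i).1; exists c; apply/funext => x; apply: contrapT => ne; apply: no.
    exists (fun u => v i u - c * f0 u), x; split=> //.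
    by apply/eqP => /eqP; rewrite subr_eq0 => /eqP.
  pose Q : set (G -> F^o) := [set h | exists c, h = (fun x => c * f0 x) :> (G -> F)].
  have Q2 : dim_ge Q 2 by exists v; split=> // i; exact: zero.
  have Q1 : dim_le Q 1.
    exists (fun=> f0) => _ [c ->]; exists (\row_i c); apply/funext => x.
    by rewrite lincomb_fun /lincomb big_ord1 mxE.
  by have := dim_ge_le Q2 Q1.
have pa i : (i <= a)%N -> (p ^ i %| p ^ a)%N by move=> ia; rewrite dvdn_exp2l.
have gMd i x y : (i <= a)%N -> g (x * y)%g = g x + g y %[mod p ^ i].
  by move=> /pa ia; apply/eqP; rewrite -(modn_dvdm _ ia) gM // modn_dvdm.
pose U i := [set x | (p ^ i %| g x)%N].
have UE i x : (i <= a)%N -> U i x <-> g x = 0 %[mod p ^ i].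
  by move=> ia; rewrite mod0n; split=> [/eqP|/eqP].
have g1 i : (i <= a)%N -> g 1%g = 0 %[mod p ^ i].
  move=> ia; have := gMd i 1%g 1%g ia; rewrite mulg1 => /eqP.
  by rewrite -{1}[g 1%g]addn0 eqn_modDl => /eqP ->.
have gU i : (i <= a)%N -> sgrp (U i).
  move=> ia; split; first by apply/UE => //; exact: g1.
    by move=> x y /UE ex /UE ey; apply/UE => //; rewrite gMd // -modnDm ex // ey // modnDm addn0.
  move=> x /UE ex; apply/UE => //; have := gMd i x x^-1%g ia; rewrite mulgV g1 // -modnDml ex //.
  by rewrite modnDml add0n => ->.
have oU i : (i <= a)%N -> exists l, N l `<=` U i.
  move=> ia; have [l gl] := sg; exists l => n nl; rewrite /U /=.
  by apply/(UE i n ia); rewrite -[n]mul1g gl // g1.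
pose A i := [set h | `[<exists2 x, U i x & pi x = h>]]%SET.
have AP i h : reflect (exists2 x, U i x & pi x = h) (h \in A i).
  by rewrite finset.in_set; exact: asboolP.
have USU i x : U i.+1 x -> U i x by rewrite /U /=; apply: dvdn_trans; rewrite dvdn_exp2l.
have ASA i : A i.+1 \subset A i.
  by apply/fintype.subsetP => h /AP[x /USU Ux xE]; apply/AP; exists x.
have [i [iw Ai]] : exists i, (i < a)%N /\ A i.+1 = A i.
  apply: contrapT => no.
  have drop i : (i <= a)%N -> (#|A i| + i <= w)%N.
    elim: i => [|i IH] ia; first by rewrite addn0; exact: max_card.
    have : (#|A i.+1| < #|A i|)%N.
      rewrite proper_card // finset.properEneq ASA andbT; apply/eqP => e; apply: no.
      by exists i.
    have := IH (ltnW ia); lia.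
  by have := drop a (leqnn a); rewrite /a; lia.
have ia := ltnW iw.
have gX n x j : (j <= a)%N -> g (x ^+ n)%g = n * g x %[mod p ^ j].
  move=> ja; elim: n => [|n IH]; first by rewrite expg0 mul0n g1.
  by rewrite expgS gMd // -modnDmr IH modnDmr mulSn.
pose xi := (x0 ^+ (p ^ i))%g.
have xiU : U i xi by apply/UE => //; rewrite gX // mod0n modnMr.
have xinU : ~ U i.+1 xi.
  move=> /UE => /(_ iw); rewrite gX // mod0n => /eqP; rewrite -/(dvdn _ _) expnSr dvdn_pmul2l.
    by move: fx0; rewrite -gf // -(dvdn_pcharf (pchar_Fp p_pr)) => /negP.
  by rewrite expn_gt0 prime_gt0.
have [y Uy yE] : exists2 y, U i.+1 y & pi y = pi xi by apply/AP; rewrite Ai; apply/AP; exists xi.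
have [Ui1 UiM UiV] := gU i ia.
(* This element dies in the quotient, while g / p^i is non-zero on it modulo p. *)
pose tau := (y^-1 * xi)%g.
have tauU : U i tau by apply: UiM => //; apply/UiV/USU.
have taunU : ~ U i.+1 tau.
  have [_ UM _] := gU i.+1 iw.
  by move=> h; apply: xinU; rewrite -[xi](mulKVg y); exact: UM.
have tau1 : pi tau = 1%g by rewrite /tau piM piV yE mulVg.
have gPi : group_set (A i).
  apply/group_setP; split; first by apply/AP; exists 1%g.
  move=> h h' /AP[b Ub <-] /AP[c Uc <-]; apply/AP; exists (b * c)%g => //; exact: UiM.
pose Pi := Group gPi.
have pPi : (p.-group Pi)%g.
  by apply: pgroupS pP; apply/fintype.subsetP => h /AP[b _ <-].
have [m [cs [t trv]]] := fidx (gU i ia) (oU i ia).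
have d2 : dim_le (@homs p G N (U i)) 2.
  have := homs_dim_le_dual p_pr ncN pimg (gU i ia) (oU i ia) trv h2 nd hle.
  by apply: dim_le_leq; lia.
have phiM b c : U i b -> U i c -> pi (b * c)%g = (pi b * pi c)%g by move=> _ _; exact: piM.
have phiP b : U i b -> pi b \in Pi by move=> Ub; apply/AP; exists b.
have phi_onto h : h \in Pi -> exists2 u, U i u & pi u = h by move=> /AP.
have chiM : hom_on N (U i) (fun x => ((g x) %/ p ^ i)%:R : F).
  split; first exact: (smooth_comp (fun m => (m %/ p ^ i)%:R : F)).
  move=> b c Ub Uc; rewrite -natrD; apply: (@natr_mod p p_pr 1) => //.
  have pi0 : (0 < p ^ i)%N by rewrite expn_gt0 prime_gt0.
  apply/eqP; rewrite -(eqn_pmul2l pi0) !muln_modr -expnD addn1; apply/eqP.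
  rewrite mulnDr ![(p ^ i * (_ %/ _))%N]mulnC !divnK //; first exact: gMd.
  exact: UiM.
have d1 : dim_le (@pullback_homs p G N (U i) gT Pi pi 1%G) 1.
  apply: (dim_le_proper (@homs_subspace p G N ncN (U i)) _ _ _ d2).
  - exact: pullback_subspace.
  - by move=> h [].
  - have [chi hchi chiE] := hom_on_normalise ncN (gU i ia) (oU i ia) chiM.
    exists chi => // -[_ [lam [lamM _ lamE]]].
    have := lamE _ tauU; rewrite tau1 (hom_in1 lamM) chiE // => /eqP.
    rewrite -(dvdn_pcharf (pchar_Fp p_pr)) => dv; apply: taunU; rewrite /U /= expnS.
    by rewrite -(divnK tauU) dvdn_pmul2r ?expn_gt0 ?prime_gt0.
have [z [zP zg]] := image_generated p_pr ncN (gU i ia) (oU i ia) pPi spi phiM phiP phi_onto (sub1G Pi) d1.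
have gen1 x : U i x -> pi x \in <[z ord0]>%g.
  move=> Ux; have := fintype.subsetP zg _ (phiP x Ux); apply: (fintype.subsetP _).
  rewrite gen_subG finset.subUset finset.sub1set group1 /=.
  by apply/fintype.subsetP => _ /imsetP[j _ ->]; rewrite ord1 cycle_id.
exists (U i); split=> // [b c|b c Ub Uc].
  apply/UE => //; rewrite /commg /conjg.
  have gV j : g j^-1%g + g j = 0 %[mod p ^ i] by rewrite -gMd // mulVg g1.
  have cong u u' r : u = u' %[mod p ^ i] -> (r + u = r + u' %[mod p ^ i])%N.
    by move=> e; rewrite -modnDmr e modnDmr.
  apply: etrans (gMd _ _ _ ia) _; apply: etrans (cong _ _ _ (gMd _ _ _ ia)) _.
  apply: etrans (cong _ _ _ (cong _ _ _ (gMd _ _ _ ia))) _.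
  have -> : (g b^-1%g + (g c^-1%g + (g b + g c)) = (g b^-1%g + g b) + (g c^-1%g + g c))%N by lia.
  by rewrite -modnDm !gV modnDm.
have piR : pi [~ b, c]%g = [~ pi b, pi c]%g by rewrite /commg /conjg !piM !piV.
apply/piK; rewrite piR; apply/eqP/commgP.
by apply: (centsP (cycle_abelian (z ord0))); exact: gen1.
Qed.

End FiniteQuotients.

(** * Filtrations of compact groups *)

Local Open Scope group_scope.

Section TopologicalGroups.
Variable E : topGroupType.

Lemma mulg_cvg (T : topologicalType) (f g : T -> E) x :
  {for x, continuous f} -> {for x, continuous g} -> {for x, continuous (fun y => f y * g y)}.
Proof.
move=> fc gc; apply: (@continuous2_cvg _ _ _ _ _ _ f g (fun a b => a * b)) => //.
exact: (@mulg_continuous E (f x, g x)).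
Qed.

Lemma lmul_continuous (a : E) : continuous (fun x => a * x).
Proof. by move=> x; apply: mulg_cvg; [exact: cst_continuous | exact: cvg_id]. Qed.

Lemma coset_nbhs (U : set E) (x : E) : open U -> U 1 -> \forall y \near x, U (x^-1 * y).
Proof.
move=> oU U1; apply: (@lmul_continuous x^-1 x); apply: open_nbhs_nbhs; split => //.
by rewrite mulVg.
Qed.

Lemma left_coset_eq (K : set E) x y : is_subgroup K ->
  left_coset x K = left_coset y K <-> K (x^-1 * y).
Proof.
move=> [K1 KM KV]; split.
  move=> /predeqP/(_ y)[_ /(_ _)]; case; first by exists 1; rewrite ?mulg1.
  by move=> k Kk <-; rewrite mulKg.
move=> Kxy; apply/predeqP => z; split=> -[k Kk <-].
  exists (y^-1 * x * k); last by rewrite !mulgA mulgV mul1g.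
  by apply: KM => //; rewrite -[y^-1 * x]invgK invMg invgK; apply: KV.
by exists (x^-1 * y * k); [exact: KM | rewrite !mulgA mulgV mul1g].
Qed.

Lemma group_indexE (A K : set E) (T : finType) (f : E -> T) (B : {set T}) :
  (forall x y, A x -> A y -> left_coset x K = left_coset y K <-> f x = f y) ->
  (forall i, i \in B <-> exists2 x, A x & f x = i) ->
  group_index A K = #|B|.
Proof.
move=> fP BP; rewrite /group_index.
have /choice[g gP] : forall i : T, exists C : set E,
    i \in B -> exists2 x, A x & f x = i /\ left_coset x K = C.
  move=> i; case: (boolP (i \in B)) => [/BP[x Ax fx]|_]; last by exists set0.
  by exists (left_coset x K) => _; exists x.
have -> : [set left_coset x K | x in A] = [set g i | i in [set` [fset i in B]%fset]].
  apply/predeqP => C; split=> -[x].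
    move=> Ax <-; exists (f x).
      by rewrite /= !inE; apply/BP; exists x.
    have [|y Ay [e <-]] := gP (f x); first by apply/BP; exists x.
    by apply/fP.
  rewrite /= !inE => xB <-; have [y Ay [_ <-]] := gP _ xB.
  by exists y.
have g_inj i j : i \in B -> j \in B -> g i = g j -> i = j.
  move=> iB jB gij.
  have [x Ax [fx e]] := gP _ iB; have [y Ay [fy e']] := gP _ jB.
  by rewrite -fx -fy; apply/(fP _ _ Ax Ay); rewrite e e'.
rewrite fset_set_image // set_fsetK card_in_imfset /=.
  rewrite cardE; apply: perm_size; apply: uniq_perm; rewrite ?enum_uniq ?fset_uniq //.
  by move=> i; rewrite mem_enum !inE.
by move=> i j iB jB; apply: g_inj; [move: iB | move: jB]; rewrite inE.
Qed.

Hypothesis cptE : compact [set: E].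

Lemma finite_transversal (U : set E) : is_subgroup U -> open U ->
  exists m (cs : E -> 'I_m.+1) t, left_transversal U cs t.
Proof.
move=> gU oU; have [U1 UM UV] := gU.
pose e x y := U (x^-1 * y).
have e_sym x y : e x y -> e y x by move=> /UV; rewrite invMg invgK.
have e_trans x y z : e x y -> e y z -> e x z.
  by move=> exy eyz; have := UM _ _ exy eyz; rewrite mulgA mulgK.
(* The coset of 1 is represented by 1 itself, as [trv_1] demands. *)
pose r x := if asbool (e x 1) then 1 else xget 1 (e x).
have er x : e x (r x).
  rewrite /r; case: asboolP => // _; case: xgetP => // /(_ x).
  by rewrite /e mulVg.
have rr x y : e x y -> r x = r y.
  move=> exy; have -> : r y = if asbool (e x 1) then 1 else xget 1 (e x).
    rewrite /r; suff -> : e x = e y by [].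
    by apply/predeqP => z; split; apply: e_trans => //; exact: e_sym.
  by [].
have finr : finite_set (range r).
  (* Infinitely many representatives would contain a sequence of pairwise inequivalent points; near
     any point at most one index occurs, against compactness. *)
  apply: contrapT => /infiniteP/card_leP[a].
  pose u (k : nat) : E := sval (a (exist _ k (mem_set I))).
  have uinj k l : e (u k) (u l) -> k = l.
    have ru i : r (u i) = u i.
      have [x _ <-] : range r (u i) by apply: set_mem; exact: (svalP (a _)).
      by apply: rr; apply: e_sym; exact: er.
    by move=> /rr; rewrite !ru => /val_inj/(@inj _ _ _ a _ _ (in_setT _) (in_setT _)) [].
  have /compact_near_coveringP/(_ nat \oo (fun k x => ~ e (u k) x)) := cptE.
  case=> [x _|m _ /(_ m)].
    have [[k ek]|nk] := pselect (exists k, e (u k) x); last first.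
      near=> x' k => /= ek'; apply: nk; exists k; apply: (e_trans _ _ _ ek').
      by apply: e_sym; near: x'; exact: coset_nbhs.
    near=> x' l => /= el.
    have : e (u k) (u l).
      apply: (e_trans _ _ _ ek); apply: (e_trans _ _ _ _ (e_sym _ _ el)).
      by near: x'; exact: coset_nbhs.
    move/uinj => kl; have : (k < l)%N by near: l; exact: nbhs_infty_gt.
    by rewrite kl ltnn.
  by move=> /(_ (leqnn _))/(_ (u m) I); apply; rewrite /e mulVg.
pose s := fset_set (range r).
have rs x : r x \in s by rewrite in_fset_set // inE; exists x.
have s0 : (0 < size s)%N.
  by have := rs 1; rewrite -index_mem; exact: leq_ltn_trans.
have ltx x : (index (r x) s < (size s).-1.+1)%N by rewrite prednK // index_mem.
exists (size s).-1, (fun x => Ordinal (ltx x)), (fun i => nth 1 s i).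
have tK x : nth 1 s (index (r x) s) = r x by rewrite nth_index.
split=> [x y|i|].
- split=> [/(congr1 val)/=/(congr1 (nth 1 s))|/rr exy].
    rewrite !tK => rxy; apply: (e_trans _ _ _ (er x)); rewrite rxy; exact: e_sym.
  by apply: val_inj; rewrite /= exy.
- apply: val_inj => /=; have ltis : (i < size s)%N by rewrite (leq_trans (ltn_ord i)) // prednK.
  have : nth 1 s i \in s by exact: mem_nth.
  rewrite in_fset_set // inE => -[x _ rx].
  have -> : r (nth 1 s i) = nth 1 s i by rewrite -rx; apply/esym/rr.
  by rewrite index_uniq // fset_uniq.
- by rewrite tK /r; case: asboolP => // -[]; rewrite /e mulg1; apply: UV.
Unshelve. all: by end_near. Qed.

Section Filtration.
Variable N : nat -> set E.
Hypothesis filN : is_filtration N.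

Lemma filtration_chain : normal_chain N.
Proof. by case: filN => h d _; split => // k; have [] := h k. Qed.

Lemma filtration_open k : open (N k).
Proof. by case: filN => h _ _; have [] := h k. Qed.

Lemma filtration_1 k : N k 1.
Proof. by have [] := chain_sgrp filtration_chain k. Qed.

Lemma filtration_sep x : (forall k, N k x) -> x = 1.
Proof. by case: filN => _ _ /predeqP/(_ x)[h _] Nx; apply: h => k _; exact: Nx. Qed.

(** Each x other than 1 lies outside some [N k], and so does a neighbourhood of x; compactness makes
    one level serve all points. *)
Lemma chain_nbhs (f : set E) : nbhs 1 f -> exists k, N k `<=` f.
Proof.
move=> nf.
have /compact_near_coveringP/(_ nat \oo (fun k x => N k x -> f x)) := cptE.
case=> [x _|k _ /(_ k (leqnn _)) Nk]; last by exists k => x; exact: Nk.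
have [->|x1] := pselect (x = 1); first by near=> y k => /= _; near: y.
have [k Nkx] : exists k, ~ N k x.
  by apply: contrapT => h; apply: x1; apply: filtration_sep => k; apply: contrapT => nk; apply: h; exists k.
near=> y l => /= Ny; case: Nkx.
have [_ NM NV] := chain_sgrp filtration_chain k.
have Nky : N k y by apply: chain_le Ny; [exact: filtration_chain | near: l; exact: nbhs_infty_ge].
have : N k (x^-1 * y).
  near: y; apply: coset_nbhs; [exact: filtration_open | exact: filtration_1].
move=> /NV; rewrite invMg invgK => /(NM _ _ Nky); by rewrite mulgA mulgV mul1g.
Unshelve. all: by end_near. Qed.

Lemma filtration_indices : finite_indices N.
Proof.
move=> U gU [k NU]; apply: finite_transversal => //.
have [U1 UM UV] := gU.
rewrite openE => x Ux; apply: filterS (coset_nbhs x (filtration_open k) (filtration_1 k)).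
by move=> y /NU /(UM _ _ Ux); rewrite mulgA mulgV mul1g.
Qed.

Lemma nbhs_chain (x : E) (f : set E) : nbhs x f <-> exists k, forall n, N k n -> f (x * n).
Proof.
split=> [|[k Nk]].
  move=> nf; have /chain_nbhs[k Nk] : nbhs 1 [set n | f (x * n)].
    by apply: (@lmul_continuous x 1); rewrite mulg1.
  by exists k.
apply: filterS (coset_nbhs x (filtration_open k) (filtration_1 k)) => y /Nk.
by rewrite mulgA mulgV mul1g.
Qed.

Lemma smooth_locally_constant A (f : E -> A) : smooth N f -> locally_constant f.
Proof. by move=> [k fk] x; apply/nbhs_chain; exists k => n Nn; exact: fk. Qed.

Lemma locally_constant_smooth2 A (f : E * E -> A) :
  locally_constant f -> smooth2 N (fun x y => f (x, y)).
Proof.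
move=> fc; have cpt2 : compact [set: E * E].
  by rewrite -setXTT; exact: compact_setX.
have /compact_near_coveringP/(_ nat \oo (fun k z => forall n m,
    N k n -> N k m -> f (z.1 * n, z.2 * m) = f z)) := cpt2.
case=> [[x y] _|k _ /(_ k (leqnn _)) Nk]; last first.
  by exists k => x y n m Nn Nm; exact: (Nk (x, y)).
have [k fk] : exists k, forall n m, N k n -> N k m -> f (x * n, y * m) = f (x, y).
  have [[A1 A2] /= [/nbhs_chain[k1 h1] /nbhs_chain[k2 h2]] AA] := fc (x, y).
  exists (maxn k1 k2) => n m Nn Nm; apply: (AA (x * n, y * m)); split => /=.
    by apply: h1; apply: chain_le Nn; [exact: filtration_chain | exact: leq_maxl].
  by apply: h2; apply: chain_le Nm; [exact: filtration_chain | exact: leq_maxr].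
near=> z l => /= n m Nn Nm.
have [_ NM _] := chain_sgrp filtration_chain k.
have Nkz : N k (x^-1 * z.1) /\ N k (y^-1 * z.2).
  near: z; exists ([set u | N k (x^-1 * u)], [set u | N k (y^-1 * u)]) => //=.
  by split; apply: coset_nbhs; (exact: filtration_open || exact: filtration_1).
have kl : (k <= l)%N by near: l; exact: nbhs_infty_ge.
have ez u v : v = u * (u^-1 * v) :> E by rewrite mulgA mulgV mul1g.
have Nkn := chain_le filtration_chain kl Nn; have Nkm := chain_le filtration_chain kl Nm.
rewrite [z in RHS]surjective_pairing (ez x z.1) (ez y z.2).
case: Nkz; move: (x^-1 * _) (y^-1 * _) => a b Na Nb.
by rewrite -!mulgA !fk //; apply: NM.
Unshelve. all: by end_near. Qed.

Lemma locally_constant_smooth A (f : E -> A) : locally_constant f -> smooth N f.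
Proof.
move=> fc; have [|k fk] := @locally_constant_smooth2 A (fun z => f z.2).
  move=> [x y]; exists ([set: E], [set y' | f y' = f y]) => /=.
    by split; [exact: filterT | exact: fc].
  by move=> [x' y'] [].
by exists k => x n Nn; apply: (fk 1 x 1 n) => //; exact: filtration_1.
Qed.

Variable p : nat.
Hypothesis pp : forall M : set E, is_subgroup M -> is_normal M -> open M ->
    exists k, group_index setT M = (p ^ k)%N.
Hypothesis p_pr : prime p.

Lemma filtration_p_images : p_images p N.
Proof.
move=> gT f H [k fk] fM fH fonto.
have f1 : f 1 = 1 by apply: (mulgI (f 1)); rewrite -fM !mulg1.
have fV x : f x^-1 = (f x)^-1.
  by apply: (mulgI (f x)); rewrite -fM !mulgV f1.
pose K := [set x | f x = 1].
have gK : is_subgroup K.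
  split=> [|x y|x]; rewrite /K /= ?f1 ?fM ?fV //; first by move=> -> ->; rewrite mulg1.
  by move=> ->; rewrite invg1.
have [||l] := pp gK.
- by move=> x g; rewrite /K /= /conjg !fM fV => ->; rewrite mul1g mulVg.
- rewrite openE => x Kx; apply/nbhs_chain; exists k => n Nn.
  by rewrite /K /= fk.
rewrite (@group_indexE setT K gT f H).
- by move=> cH; rewrite /pgroup cH pnatX pnat_id ?orbT.
- move=> x y _ _; rewrite left_coset_eq // /K /= fM fV; split.
    by move/(congr1 (fun z => f x * z)); rewrite mulgA mulgV mul1g mulg1.
  by move=> ->; rewrite mulVg.
- by move=> i; split=> [/fonto[x <-]|[x _ <-]]; [exists x | exact: fH].
Qed.

End Filtration.
End TopologicalGroups.

(** * Free pro-p groups *)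

(** Finite p-groups with the discrete topology are the test objects for the universal property of
    free pro-p groups. *)
HB.instance Definition _ (X : groupType) := Group.copy (discrete_topology X) X.

Lemma discrete_mulg_continuous (X : groupType) :
  continuous (fun x : discrete_topology X * discrete_topology X => x.1 * x.2).
Proof.
move=> [x y]; apply/discrete_cvg; exists ([set x], [set y]) => /=.
  by split; exact: discrete_set1.
by move=> [x' y'] [/= -> ->].
Qed.

Lemma discrete_invg_continuous (X : groupType) :
  continuous (fun x : discrete_topology X => x^-1).
Proof.
move=> x; apply/discrete_cvg; apply: (@filterS _ (nbhs x) _ _ _ _ (discrete_set1 x)).
by move=> y ->.
Qed.

HB.instance Definition _ (X : groupType) := isTopologicalGroup.Build (discrete_topology X)
  (@discrete_mulg_continuous X) (@discrete_invg_continuous X).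

Section FiniteDiscrete.
Variables (p : nat) (X : finGroupType).
Hypothesis pX : p.-group [set: X]%SET.

Lemma discrete_pro_p : pro_p (discrete_topology X) p.
Proof.
split; first split.
- exact/finite_compact/(@finite_finset X).
- exact: discrete_hausdorff.
- move=> U U1; exists [set 1]; split; last by move=> x ->; exact: nbhs_singleton.
    by split=> // [x y -> ->|x ->]; rewrite ?mulg1 ?invg1.
  exact: discrete_open.
move=> N gN nN _; have [N1 NM NV] := gN.
pose M := [set x : X | `[< N x >]]%SET.
have inM x : (x \in M) = `[< N x >] by rewrite finset.in_set.
have gM : group_set M.
  apply/group_setP; split; first by rewrite inM; apply/asboolP.
  move=> x y; rewrite !inM => /asboolP Nx /asboolP Ny; apply/asboolP.
  exact: (NM x y Nx Ny).
pose M' := group gM.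
rewrite (@group_indexE (discrete_topology X) setT N {set X} (fun x => x *: M)
  (lcosets M' [set: X]%SET)).
- rewrite card_lcosets.
  have /p_natP[k ->] : p.-nat #|[set: X]%SET : M'| by exact: pnat_dvd (dvdn_indexg _ _) pX.
  by exists k.
- move=> x y _ _; rewrite left_coset_eq //; split=> [Nxy|/= xy].
    apply/(@lcoset_eqP _ M'); rewrite /= mem_lcoset inM; apply/asboolP.
    by have := NV _ Nxy; rewrite invMg invgK.
  have : y \in x *: M' by rewrite /= xy; exact: (lcoset_refl M').
  by rewrite mem_lcoset inM => /asboolP.
- move=> C; split=> [/lcosetsP[x _ ->]|[x _ <-]]; first by exists x.
  by apply/lcosetsP; exists x.
Qed.

End FiniteDiscrete.

Lemma card_subg (gT : finGroupType) (G : {group gT}) : #|[set: subg_of G]%SET| = #|G|.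
Proof. by rewrite cardsT card_sub; apply: eq_card. Qed.

Section Free.
Variables (p : nat) (E : topGroupType).
Hypothesis p_pr : prime p.
Hypothesis cptE : compact [set: E].
Variable N : nat -> set E.
Hypothesis filN : is_filtration N.
Variables (X : Type) (iota : X -> E).
Hypothesis univ : is_free_pro_p_on p iota.

Lemma free_lift (P : finGroupType) (phi : X -> P) : p.-group [set: P]%SET ->
  (exists k, forall z, N k (iota z) -> phi z = 1) ->
  exists f : E -> P, [/\ smooth N f, {morph f : x y / x * y}, forall z, f (iota z) = phi z &
    forall g : E -> P, smooth N g -> {morph g : x y / x * y} ->
      (forall z, g (iota z) = phi z) -> g =1 f].
Proof.
move=> pP [k phik]; have [conv /(_ _ (discrete_pro_p pP) phi)] := univ.
case=> [U [U1 _ _] _|f [[[fc fM] fphi] funi]].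
  have := conv _ (chain_sgrp (filtration_chain filN) k) (filtration_open filN k).
  by apply: sub_finite_set => z /= nU Nz; apply: nU; rewrite phik.
exists f; split=> //.
  apply: (locally_constant_smooth cptE filN) => x.
  exact: (fc x _ (discrete_set1 (f x : discrete_topology P))).
move=> g sg gM gphi x; rewrite (funi g) //; split=> //; split=> // y.
by apply/discrete_cvg; exact: (smooth_locally_constant cptE filN sg y).
Qed.

Hypothesis pp : forall M : set E, is_subgroup M -> is_normal M -> open M ->
    exists k, group_index setT M = (p ^ k)%N.

Local Open Scope ring_scope.

(* A cocycle defines a central extension of a finite quotient, realised here by
   permutations of [Q * F_p]; the universal property splits it. *)
Lemma free_H2_zero : @H2_zero p E N setT.
Proof.
move=> c [sc cE]; have [k ck] := sc.
have ncN := filtration_chain filN.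
have pimg := filtration_p_images cptE filN pp p_pr.
have fidx := filtration_indices cptE filN.
have [gT [pi0 [P [pi0M pi0K spi0 pP [pi0P pi0onto]]]]] :=
  finite_quotient pimg fidx (chain_sgrp ncN k) (ex_intro _ k (fun x h => h))
  (chain_normal ncN (k := k)).
pose Q : finGroupType := subg_of P.
pose pi x : Q := subg P (pi0 x).
have piE x y : pi x = pi y -> pi0 x = pi0 y.
  by move/(congr1 sgval); rewrite !subgK.
have piM : {morph pi : x y / (x * y)%g}.
  by move=> x y; rewrite /pi pi0M; apply: (morphM (subg_morphism P)).
have spi : smooth N pi by apply: (smooth_comp (subg P)) spi0.
have /choice[t tK] : forall q : Q, exists x, pi x = q.
  move=> q; have [x px] := pi0onto (sgval q) (subgP q).
  by exists x; rewrite /pi px sgvalK.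
pose c' a b : 'F_p := c (t a) (t b).
have eN x y : pi x = pi y -> exists2 n, N k n & y = (x * n)%g.
  move/piE => e; exists (x^-1 * y)%g; last by rewrite mulgA mulgV mul1g.
  apply/pi0K; rewrite pi0M -e -pi0M mulVg; apply/pi0K.
  exact: (filtration_1 filN).
have c'E x y : c' (pi x) (pi y) = c x y.
  rewrite /c'; have [n Nn ->] := eN _ _ (esym (tK (pi x))).
  by have [m Nm ->] := eN _ _ (esym (tK (pi y))); rewrite ck.
have c'M a b d : c' a b + c' (a * b)%g d = c' b d + c' a (b * d)%g.
  by rewrite -(tK a) -(tK b) -(tK d) -!piM !c'E cE.
pose T := (Q * 'F_p)%type.
(* Right multiplication by the pair (x, e) in the extension defined by the cocycle. As a set of
   permutations the extension inherits associativity. *)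
pose act e x (u : T) : T := ((u.1 * x)%g, u.2 + c' u.1 x + e).
have act_inj e x : injective (act e x).
  move=> [a s] [b r] ab; have /= /mulIg eab := congr1 fst ab.
  by move: (congr1 snd ab); rewrite /= eab => /addIr/addIr ->.
pose L e x := perm (@act_inj e x).
have LM e x d y : (L e x * L d y)%g = L (e + d + c' x y) (x * y)%g.
  apply/permP => -[a s]; rewrite permM !permE /act /= mulgA; congr (_, _).
  have := c'M a x y; set u := c' _ _; set v := c' _ _; set w := c' _ _; set z := c' _ _.
  move=> h; have -> : v = w + z - u by rewrite -h; ring.
  ring.
have Linj e x d y : L e x = L d y -> e = d /\ x = y.
  move/permP/(_ (1%g, 0)); rewrite !permE /act /= !mul1g => ab.
  have /= xy := congr1 fst ab; move: (congr1 snd ab); rewrite /= xy => /addrI ->.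
  by [].
have L1 : L (- c' 1%g 1%g) 1%g = 1%g.
  apply: (mulIg (L (- c' 1%g 1%g) 1%g)).
  by rewrite LM !mul1g; congr (L _ _); ring.
pose A := [set L u.2 u.1 | u in [set: T]%SET]%SET.
have AP e x : L e x \in A by apply/imsetP; exists (x, e); rewrite ?inE.
have gA : group_set A.
  apply/group_setP; split; first by rewrite -L1.
  by move=> _ _ /imsetP[[x e] _ ->] /imsetP[[y d] _ ->]; rewrite LM.
have pA : (p.-group (group gA))%g.
  rewrite /pgroup /= card_imset; last by move=> [x e] [y d] /Linj[/= -> ->].
  have cF : #|'F_p| = p by rewrite card_Fp.
  rewrite cardsT card_prod cF pnatM pnat_id // andbT.
  suff -> : #|{: Q}| = #|P| by [].
  by rewrite -cardsT card_subg.
pose H : finGroupType := subg_of (group gA).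
have pH : (p.-group [set: H]%SET)%g by rewrite /pgroup card_subg.
have pQ : (p.-group [set: Q]%SET)%g by rewrite /pgroup card_subg.
(* The map has to be 1 once [iota z] is deep in the filtration, and [L 0 1] is the identity only for
   a normalised cocycle; hence the case distinction. *)
pose phi z : H := if pi (iota z) == 1%g then 1%g else subg (group gA) (L 0 (pi (iota z))).
pose pr (h : H) : Q := (sgval h (1%g, 0)).1.
have repr (h : H) : exists e x, sgval h = L e x.
  by have /imsetP[[x e] _ ->] := subgP h; exists e, x.
have pr_L e x h : sgval h = L e x -> pr h = x.
  by rewrite /pr => ->; rewrite permE /act /= mul1g.
have prM : {morph pr : x y / (x * y)%g}.
  move=> x y; have [e [a xE]] := repr x; have [d [b yE]] := repr y.
  rewrite (pr_L _ _ _ xE) (pr_L _ _ _ yE).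
  by apply: (pr_L (e + d + c' a b)); rewrite /= xE yE LM.
have pr_phi z : pr (phi z) = pi (iota z).
  rewrite /phi; case: eqP => [->|_].
    by apply: (pr_L (- c' 1%g 1%g)); rewrite L1.
  by apply: (pr_L 0); rewrite subgK.
have pi1 x : N k x -> pi x = 1%g.
  by move=> Nx; rewrite /pi (iffRL (pi0K x) Nx); apply: val_inj; rewrite /= subgK.
have [|f [sf fM fphi _]] := free_lift pH (phi := phi).
  by exists k => z Nz; rewrite /phi pi1 // eqxx.
have [|g [_ _ _ guni]] := free_lift pQ (phi := fun z => pi (iota z)).
  by exists k => z; exact: pi1.
(* Both sides extend [pi] on the basis, so uniqueness makes [f] compatible with the projection; the
   second coordinate of [f] is then a primitive up to sign. *)
have prf x : pr (f x) = pi x.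
  transitivity (g x); last by rewrite (guni pi).
  apply: (guni (fun x => pr (f x))) => //; first exact: (smooth_comp pr).
    by move=> u v; rewrite fM prM.
  by move=> z; rewrite fphi pr_phi.
pose e x := (sgval (f x) (1%g, 0)).2 - c' 1%g (pi x).
have fE x : sgval (f x) = L (e x) (pi x).
  have [d [a xE]] := repr (f x).
  rewrite -prf (pr_L _ _ _ xE) xE; congr (L _ _); rewrite /e xE permE /act /=.
  by rewrite -prf (pr_L _ _ _ xE); ring.
exists (fun x => - e x).
  apply: (smooth_op ncN (fun u v => - (u - v))).
    exact: (smooth_comp (fun h : H => (sgval h (1%g, 0)).2)).
  exact: (smooth_comp (c' 1%g)).
move=> x y _ _; have := fE (x * y)%g; rewrite fM /= !fE LM piM => /Linj[<- _].
by rewrite c'E; ring.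
Qed.

End Free.

(** * Continuous cohomology in degrees one and two *)

Local Open Scope ring_scope.

Lemma coord_continuous (I : Type) (E : I -> topGroupType) (i : I) :
  continuous (fun x : prod_topology E => x i).
Proof.
move=> f; have /cvg_sup/(_ i) h : (f : prod_topology E) --> f by apply: cvg_id.
move=> A; rewrite nbhsE => -[B [oB Bf] BA].
apply: (@filterS (prod_topology E) (nbhs (f : prod_topology E)) _
  ((fun x : prod_topology E => x i) @^-1` B)); first by move=> x /BA.
by apply: h; exists ((fun x => x i) @^-1` B); split => //; exists B.
Qed.

Lemma prod_continuous (I : Type) (E : I -> topGroupType) (T : topologicalType)
  (h : T -> prod_topology E) :
  (forall i, continuous (fun t => h t i)) -> continuous h.
Proof.
move=> hc t; apply/cvg_sup => i A; case=> B [[C oC <-] Cht] BA.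
apply: (filterS (P := (fun s => h s i) @^-1` C)) => [s /BA //|].
by apply: hc; exact: open_nbhs_nbhs.
Qed.

Section Cochains.
Variables (p : nat) (E : topGroupType).
Hypothesis cptE : compact [set: E].
Variable N : nat -> set E.
Hypothesis filN : is_filtration N.
Local Notation F := 'F_p.
Local Notation triv := (@trivial_act E p).
Let ncN := filtration_chain filN.

Definition tup1 (x : E) : power E 1 := fun _ => x.
Definition tup2 (x y : E) : power E 2 := fun i => if i == ord0 then x else y.
Definition tup3 (x y z : E) : power E 3 :=
  fun i => if i == 0%N :> nat then x else if i == 1%N :> nat then y else z.

Lemma tup1E (z : power E 1) : z = tup1 (z ord0).
Proof. by apply: functional_extensionality_dep => i; rewrite (ord1 i). Qed.

Lemma tup2E (z : power E 2) : z = tup2 (z ord0) (z ord_max).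
Proof.
apply: functional_extensionality_dep => i; rewrite /tup2.
case: eqP => [->//|]; case: i => -[|[|//]] lti ne; first by case: ne; exact: val_inj.
by congr (z _); exact: val_inj.
Qed.

Lemma differential1 (h : power E 1 -> F) z :
  differential triv h z = h (tup1 (z ord_max)) - h (tup1 (z ord0 * z ord_max)%g) + h (tup1 (z ord0)).
Proof.
rewrite /differential big_ord_recl big_ord0 addr0 expr1 expr2 mulN1r opprK mulr1z mulrN1z.
rewrite /trivial_act; congr (h _ - h _ + h _); rewrite [LHS]tup1E; congr tup1.
- by congr (z _); exact: val_inj.
- by rewrite /merge_at /=; congr (z _ * z _)%g; exact: val_inj.
- by congr (z _); exact: val_inj.
Qed.

Lemma differential2 (h : power E 2 -> F) x y z : differential triv h (tup3 x y z) =
  h (tup2 y z) - h (tup2 (x * y)%g z) + h (tup2 x (y * z)%g) - h (tup2 x y).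
Proof.
rewrite /differential !big_ord_recl big_ord0 addr0 !exprS expr0 !mulr1 !mulN1r opprK.
rewrite !mulr1z !mulrN1z addrA /trivial_act.
by congr (h _ - h _ + h _ - h _); rewrite [LHS]tup2E; congr tup2.
Qed.

Lemma locally_constant_tup1 (h : power E 1 -> F) : locally_constant h ->
  smooth N (fun x => h (tup1 x)).
Proof.
move=> lh; apply: (locally_constant_smooth cptE filN) => x.
have c : continuous tup1 by apply: prod_continuous => i y; exact: cvg_id.
exact: (c x _ (lh (tup1 x))).
Qed.

Lemma near_coord n k (z : power E n) (i : 'I_n) :
  \forall w \near z, N k ((z i)^-1 * w i)%g.
Proof.
apply: (@coord_continuous _ (fun=> E) i z [set u | N k ((z i)^-1 * u)%g]).
by apply: coset_nbhs; [exact: filtration_open | exact: filtration_1].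
Qed.

Lemma smooth_power1 f : smooth N f -> locally_constant (fun z : power E 1 => f (z ord0) : F).
Proof.
move=> [k fk] z; apply: (@filterS (power E 1) (nbhs z) _ _ _ _ (near_coord k z ord0)) => w Nw.
by rewrite -(fk (z ord0) _ Nw) mulgA mulgV mul1g.
Qed.

Lemma smooth2_power2 c : smooth2 N c ->
  locally_constant (fun z : power E 2 => c (z ord0) (z ord_max) : F).
Proof.
move=> [k ck] z;
  apply: (@filterS2 (power E 2) (nbhs z) _ _ _ _ _ (near_coord k z ord0) (near_coord k z ord_max)) => w Nw Nw'.
by rewrite -(ck (z ord0) (z ord_max) _ _ Nw Nw') !mulgA !mulgV !mul1g.
Qed.

Lemma hom_cocycle f : hom_on N setT f -> cocycle triv (fun z : power E 1 => f (z ord0) : F).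
Proof.
move=> [sf fM]; split; first exact: smooth_power1.
by move=> z; rewrite differential1 /tup1 fM //; ring.
Qed.

Lemma cocycle_hom (a : power E 1 -> F) : cocycle triv a -> hom_on N setT (fun x => a (tup1 x)).
Proof.
move=> [la da]; split; first exact: locally_constant_tup1.
move=> x y _ _; have := da (tup2 x y); rewrite differential1 /tup2 /= => e.
by rewrite -[LHS]addr0 -e; ring.
Qed.

Lemma cocycle_power2 c : cocycle_on N setT c ->
  cocycle triv (fun z : power E 2 => c (z ord0) (z ord_max) : F).
Proof.
move=> [sc cE]; split; first exact: smooth2_power2.
move=> w; have -> : w = tup3 (w ord0) (w (inord 1)) (w ord_max).
  apply: functional_extensionality_dep => -[i lti]; rewrite /tup3 /=.
  case: i lti => [|[|[|//]]] lti; congr (w _); apply: val_inj => //=.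
  by rewrite inordK.
rewrite differential2 /tup2 /=; set x := w ord0; set y := w (inord 1); set z := w ord_max.
transitivity (c y z + c x (y * z)%g - (c x y + c (x * y)%g z)); first by ring.
by rewrite cE // subrr.
Qed.

Lemma coboundary2_on (g : power E 2 -> F) : coboundary triv g ->
  coboundary_on N setT (fun x y => g (tup2 x y)).
Proof.
move=> [h [lh gE]]; exists (fun x => h (tup1 x)); first exact: locally_constant_tup1.
by move=> x y _ _; rewrite gE differential1 /tup2 /=; ring.
Qed.

Lemma on_coboundary2 c : coboundary_on N setT c ->
  coboundary triv (fun z : power E 2 => c (z ord0) (z ord_max) : F).
Proof.
move=> [s ss sE]; exists (fun z => s (z ord0)); split; first exact: smooth_power1.
by move=> z; rewrite differential1 /tup1 sE //; ring.
Qed.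

Lemma coboundary1 (a : power E 1 -> F) : coboundary triv a -> forall z, a z = 0.
Proof.
move=> [h [_ aE]] z; rewrite aE /differential big_ord0 addr0 expr1 mulrN1z /trivial_act.
apply/eqP; rewrite subr_eq0; apply/eqP; congr h.
by apply: functional_extensionality_dep => -[].
Qed.

Lemma dim_cohomology_H2_le1 : dim_cohomology_Fp E p 2 1 -> @H2_le1 p E N setT.
Proof.
move=> [b bc bE] c c' cc cc' ncob.
pose b' x y := b ord0 (tup2 x y).
have key d : cocycle_on N setT d ->
    exists k, coboundary_on N setT (fun x y => d x y - k * b' x y).
  move=> /cocycle_power2/bE[k [/coboundary2_on dk _]]; exists (k 0 0).
  by apply: eq_coboundary_on dk => x y _ _; rewrite big_ord1 /tup2 /=.
have [k ck] := key c cc; have [k' ck'] := key c' cc'.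
have k0 : k != 0.
  apply/eqP => k0; apply: ncob; apply: eq_coboundary_on ck => x y _ _.
  by rewrite k0 mul0r subr0.
exists (k' / k); apply: eq_coboundary_on (coboundary_lin ncN (- (k' / k)) ck ck') => x y _ _.
by field.
Qed.

Lemma cup11_cup_nondegenerate : cup11_nondegenerate E p -> @cup_nondegenerate p E N setT.
Proof.
move=> [_ nd] b hb cup0 x _.
apply: (coboundary1 (nd (fun z => b (z ord0)) (hom_cocycle hb) _) (tup1 x)).
move=> a ca; have := on_coboundary2 (cup0 _ (cocycle_hom ca)).
congr (coboundary _ _); apply: funext => z; rewrite /cup /cupf; congr (a _ * b (z _)).
  by rewrite [RHS]tup1E; congr tup1; congr (z _); exact: val_inj.
exact: val_inj.
Qed.

Lemma closed_generated_sub (S : set E) (H : set E) : is_subgroup H -> closed H ->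
  S `<=` H -> closed_generated S `<=` H.
Proof. by move=> gH cH SH x; apply. Qed.

Lemma smooth_closed T (f : E -> T) (A : set T) : smooth N f -> closed (f @^-1` A).
Proof.
move=> [k fk]; rewrite -[_ @^-1` _]setCK; apply: open_closedC.
rewrite openE => x nAx; apply/(nbhs_chain cptE filN); exists k => n Nn.
by rewrite /setC /preimage /= fk.
Qed.

(** Evaluation at the generators is injective on homs, as the zeros of a smooth hom form a closed
    subgroup. *)
Lemma fg_homs : topologically_fg E -> exists n, dim_le (@homs p E N setT) n.
Proof.
move=> [s gs]; pose n := size s.
pose L (f : E -> F^o) : 'rV[F]_n := \row_i f (nth 1%g s i).
exists (0 + n)%N; apply: (@dim_le_ker_im F _ _ _ L).
- exact: homs_subspace.
- by move=> a f g _ _; apply/rowP => i; rewrite !mxE.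
- exists (fun=> 0) => f [[[sf fM] _] f0]; exists 0; rewrite lincomb0.
  apply: funext => x; have f1 : f 1%g = 0.
    by apply: (addrI (f 1%g)); rewrite -fM // mulg1 addr0.
  have /(_ x I) : setT `<=` [set x | f x = 0]; last by [].
  rewrite -gs; apply: closed_generated_sub.
  + split=> // [u v /= fu fv|u /= fu]; first by rewrite fM // fu fv addr0.
    by apply: (addrI (f u)); rewrite -fM // mulgV f1 fu addr0.
  + exact: (@smooth_closed _ f [set 0] sf).
  + move=> u /= us; have lu : (index u s < n)%N by rewrite index_mem.
    by have /rowP/(_ (Ordinal lu)) := f0; rewrite !mxE /= nth_index.
- exists (fun i => delta_mx 0 i) => u _; exists u; exact: row_sum_delta.
Qed.

End Cochains.

(** * Comparison of indices *)

Local Open Scope group_scope.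

Definition big_factor (p : nat) (E : topGroupType) (N : nat -> set E) :=
  @H2_le1 p E N setT /\
  ((@cup_nondegenerate p E N setT /\ dim_ge (@homs p E N setT) 3) \/
   (@H2_zero p E N setT /\ dim_ge (@homs p E N setT) 2)).

Definition small_factor (p : nat) (E : topGroupType) (N : nat -> set E) :=
  forall U : set E, sgrp U -> (exists k, N k `<=` U) -> dim_le (@homs p E N U) 2.

(** [V] may vary with k: the second derived subgroup lies in every [N k]. *)
Lemma metabelian_soluble (E : topGroupType) (N : nat -> set E) : is_filtration N ->
  (forall k, exists V : set E, [/\ sgrp V, forall x y, V [~ x, y] &
    forall a b, V a -> V b -> N k [~ a, b]]) -> soluble E.
Proof.
move=> filN h; exists 2%N; apply/predeqP => z; split=> [|->]; last first.
  by move=> H [[]].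
move=> dz; apply: (filtration_sep filN) => k; have [V [gV VR VN]] := h k.
apply: dz; split; first exact: (chain_sgrp (filtration_chain filN) k).
move=> _ [a da [b db <-]]; apply: VN.
  by apply: da; split=> // _ [x _ [y _ <-]]; exact: VR.
by apply: db; split=> // _ [x _ [y _ <-]]; exact: VR.
Qed.

Section Factor.
Variables (p : nat) (E : topGroupType) (N : nat -> set E).
Hypothesis p_pr : prime p.
Hypothesis filN : is_filtration N.
Hypothesis ppE : pro_p E p.

Lemma pro_p_compact : compact [set: E].
Proof. by case: ppE => [[]]. Qed.

Lemma pro_p_images : p_images p N.
Proof. by case: ppE => [[cE _ _] h]; exact: (filtration_p_images cE filN h p_pr). Qed.

Lemma pro_p_indices : finite_indices N.
Proof. exact: (filtration_indices pro_p_compact filN). Qed.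

Let ncN := filtration_chain filN.
Let pimg := pro_p_images.
Let fidx := pro_p_indices.

Lemma H2_zero_le1 : @H2_zero p E N setT -> @H2_le1 p E N setT.
Proof. by move=> h c c' cc _ /(_ (h c cc)). Qed.

(** Let [r] be the dimension of H^1. By the rank formulas a free factor with r <= 1 has dim H^1(U)
    at most 1 for every open U, and a Demushkin factor with r <= 2 at most 2; in all other cases the
    factor is big. *)
Lemma factor_classification : topologically_fg E -> free_pro_p p E \/ demushkin E p ->
  big_factor p N \/ (soluble E /\ small_factor p N).
Proof.
move=> /(fg_homs p pro_p_compact filN)[n hn].
have [r [rn [v [Pv iv sv]]]] := basis_dim_le hn.
have dle : dim_le (@homs p E N setT) r by exists v.
have dge : dim_ge (@homs p E N setT) r by exists v.
have cyc : (r <= 1)%N -> soluble E.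
  move=> r1; apply: (metabelian_soluble filN) => k.
  by apply: (cyclic_metabelian p_pr ncN pimg fidx); exact: dim_le_leq r1 dle.
case=> [[_ [X [iota univ]]]|[_ _ _ h2 nd]].
  have h0 : @H2_zero p E N setT.
    by case: (ppE) => [[cE _ _] h]; exact: (free_H2_zero p_pr cE filN univ h).
  case: (ltnP 1 r) => r2.
    by left; split; [exact: H2_zero_le1 | right; split=> //; exact: dim_ge_leq r2 dge].
  right; split; first exact: cyc.
  move=> U gU oU; have [m [cs [t trv]]] := fidx gU oU.
  have := homs_dim_le_sub p_pr ncN pimg gU oU trv (dim_le_leq r2 dle).
  by apply: dim_le_leq; lia.
have {}h2 := dim_cohomology_H2_le1 pro_p_compact filN h2.
have {}nd := cup11_cup_nondegenerate pro_p_compact filN nd.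
case: (ltnP 2 r) => r3.
  by left; split=> //; left; split=> //; exact: dim_ge_leq r3 dge.
right; split; last first.
  move=> U gU oU; have [m [cs [t trv]]] := fidx gU oU.
  have := homs_dim_le_dual p_pr ncN pimg gU oU trv h2 nd (dim_le_leq r3 dle).
  by apply: dim_le_leq; lia.
case: (leqP r 1) => [/cyc //|r2].
apply: (metabelian_soluble filN) => k.
apply: (rank2_metabelian p_pr ncN pimg fidx) => //; last exact: dim_ge_leq r2 dge.
exact: dim_le_leq r3 dle.
Qed.

Lemma index_transversal (U : set E) m (cs : E -> 'I_m.+1) t :
  left_transversal U cs t -> is_subgroup U -> group_index setT U = m.+1.
Proof.
move=> trv gU; rewrite (@group_indexE E setT U _ cs [set: 'I_m.+1]%SET).
- by rewrite cardsT card_ord.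
- by move=> x y _ _; rewrite left_coset_eq //; split=> /(trv_eq trv).
- by move=> i; rewrite finset.in_setT; split=> // _; exists (t i); rewrite ?(trv_K trv).
Qed.

Hypothesis bigN : big_factor p N.

Lemma big_central_trivial z k : (forall y, N k y -> z * y = y * z) -> z = 1.
Proof.
have [h2 b] := bigN.
exact: (central_trivial p_pr ncN pimg fidx h2 b (@filtration_sep _ _ filN)).
Qed.

(** If [N k] were trivial, every element would centralise it, so the group would be trivial, against
    the rank of H^1. *)
Lemma big_nontrivial k : exists2 x, N k x & x <> 1.
Proof.
apply: contrapT => no.
have N1 y : N k y -> y = 1 by move=> Ny; apply: contrapT => y1; apply: no; exists y.
have E1 (z : E) : z = 1 by apply: (@big_central_trivial z k) => y /N1 ->; rewrite mulg1 mul1g.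
have [v [Pv iv]] : dim_ge (@homs p E N setT) 1.
  by case: bigN => _ [[_ /(dim_ge_leq (isT : 1 <= 3)%N)]|[_ /(dim_ge_leq (isT : 1 <= 2)%N)]].
have : (delta_mx 0%R 0%R : 'rV['F_p]_1) = 0%R.
  apply: iv; rewrite lincomb_delta; apply: funext => x; rewrite (E1 x).
  have [[_ fM] _] := Pv 0%R; apply: (addrI (v 0%R 1)).
  by have := fM 1 1 I I; rewrite mulg1 => <-; rewrite addr0.
by move/rowP/(_ 0%R)/eqP; rewrite !mxE eqxx oner_eq0.
Qed.

Hypothesis fgE : topologically_fg E.

Lemma big_quotients (U : set E) l : is_subgroup U -> (exists k, N k `<=` U) ->
  (4 * l <= group_index setT U)%N -> @has_quotients p E N U l.
Proof.
move=> gU oU; have [m [cs [t trv]]] := fidx gU oU.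
rewrite (index_transversal trv gU) => lm; have [h2 b] := bigN.
have [n hn] := fg_homs p pro_p_compact filN fgE.
exact: (big_has_quotients p_pr ncN pimg h2 b gU oU trv hn lm).
Qed.

End Factor.

(** Stated for relations so as to cover homs, projections and congruence modulo a normal subgroup
    alike. *)
Lemma eval_word_rel (G1 G2 : topGroupType) (R : G1 -> G2 -> Prop) w h h' :
  R 1 1 -> (forall x x' y y', R x x' -> R y y' -> R (x * y) (x' * y')) ->
  (forall x x', R x x' -> R x^-1 x'^-1) -> (forall k, R (h k) (h' k)) ->
  R (eval_word w h) (eval_word w h').
Proof.
move=> R1 RM RV Rh; apply: (big_ind2 R) => //.
by move=> [k []] _ /=; [exact: RV | exact: Rh].
Qed.

Definition word_values (G : topGroupType) (W : set word) (H : set G) : set G :=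
  [set g | exists2 w, W w & exists2 h, (forall k, H (h k)) & g = eval_word w h].

Section Comparison.
Variables (p : nat) (E1 E2 : topGroupType) (N : nat -> set E1) (N2 : nat -> set E2).
Hypothesis p_pr : prime p.
Hypotheses (filN : is_filtration N) (filN2 : is_filtration N2).
Hypotheses (pp1 : pro_p E1 p) (pp2 : pro_p E2 p).
Hypothesis fg1 : topologically_fg E1.
Hypothesis bigN : big_factor p N.

(* The subgroup [A] maps onto [(B / B')^K], and the verbal subgroup [A'] is in the
   kernel. *)
Lemma index_comparison (A A' : set E1) (B B' : set E2) (W : set word) K m :
  is_subgroup A -> (exists k, N k `<=` A) ->
  is_subgroup A' -> (exists k, N k `<=` A') ->
  A' `<=` closed_generated (word_values W A) ->
  is_subgroup B -> (exists k, N2 k `<=` B) ->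
  is_subgroup B' -> (exists k, N2 k `<=` B') -> is_normal B' ->
  word_values W B `<=` B' ->
  dim_le (@homs p E2 N2 B) m ->
  (4 * (K * m) <= group_index setT A)%N ->
  ((group_index B B') ^ K <= group_index A A')%N.
Proof.
move=> gA oA gA' oA' A'gen gB oB gB' oB' nB' WB dB KmA.
have quo := big_quotients p_pr filN pp1 bigN fg1 gA oA KmA.
have ncN2 := filtration_chain filN2.
have [gT [pi [P0 [piM piK spi pP0 [piP0 piOnto]]]]] :=
  finite_quotient (pro_p_images p_pr filN2 pp2) (pro_p_indices filN2 pp2) gB' oB' nB'.
have pi1 : pi 1 = 1 by apply/piK; case: gB'.
have piV c : pi c^-1 = (pi c)^-1 by apply: (@mulgI _ (pi c)); rewrite -piM !mulgV.
have [B1 BM BV] := gB.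
pose Pset : {set gT} := [set h | `[< exists2 b, B b & pi b = h >]]%SET.
have inP h : h \in Pset <-> exists2 b, B b & pi b = h.
  by rewrite finset.in_set; split=> /asboolP.
have gP : group_set Pset.
  apply/group_setP; split; first by apply/inP; exists 1.
  move=> x y /inP[b Bb <-] /inP[c Bc <-]; apply/inP.
  by exists (b * c); [exact: BM | rewrite piM].
pose P := group gP.
have pP : p.-group P.
  apply: pgroupS pP0; apply/fintype.subsetP => h /inP[b _ <-]; exact: piP0.
have [y [yP yg]] : exists y : 'I_m -> gT, (forall i, y i \in P) /\
    P \subset <<[set y i | i in 'I_m]%SET>>.
  apply: (image_generated_homs p_pr ncN2 gB oB pP spi) => //.
  - by move=> u Bu; apply/inP; exists u.
  - by move=> x /inP[b Bb <-]; exists b.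
have [phi [sphi phiM phiP phiO]] := power_quotient quo pP yP yg.
have [A1 AM AV] := gA.
have phi1 : phi 1 = fun=> 1.
  apply: funext => i; have := congr1 (fun f => f i) (phiM 1 1 A1 A1).
  by rewrite mulg1 /= -{1}[phi 1 i]mulg1 => /mulgI.
have phiV u : A u -> phi u^-1 = fun i => (phi u i)^-1.
  move=> Au; apply: funext => i; apply: (mulgI (phi u i)); rewrite mulgV.
  have := congr1 (fun f => f i) (phiM u u^-1 Au (AV _ Au)).
  by rewrite mulgV /= phi1 => <-.
have cE1 := pro_p_compact pp1.
have sA : smooth N A.
  have [k NA] := oA; exists k => x n /NA An; apply/propext; split=> [Axn|Ax].
    by rewrite -[x](mulgK n); apply: AM => //; exact: AV.
  exact: AM.
(* A closed subgroup containing the word values contains the verbal subgroup, so the kernel of [phi]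
   on [A] has to be closed. *)
have clA : closed (A `&` phi @^-1` [set fun=> 1]).
  apply: closedI; last exact: (smooth_closed cE1 filN).
  rewrite (_ : A = A @^-1` [set True]); first exact: (smooth_closed cE1 filN).
  by apply/predeqP => x; split=> [Ax|/= ->]; first exact/propext.
have A'phi u : A' u -> A u /\ phi u = fun=> 1.
  move=> /A'gen; apply: (closed_generated_sub (H := A `&` phi @^-1` [set fun=> 1])) => //.
    split=> // [v w [Av v1] [Aw w1]|v [Av v1]].
      split; [exact: AM | rewrite /preimage /= phiM // v1 w1].
      by apply: funext => i; rewrite mulg1.
    split; [exact: AV | rewrite /preimage /= phiV // v1].
    by apply: funext => i; rewrite invg1.
  move=> _ [w Ww [h Ah ->]].
  (* Each coordinate of [phi (h l)] comes from an element of [B]. The word takes a value in [B'] on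
     these elements, and [pi] kills it. *)
  have [b bE] : exists b : 'I_K -> nat -> E2, forall i l, B (b i l) /\ pi (b i l) = phi (h l) i.
    have /choice[b bE] : forall il : 'I_K * nat, exists c, B c /\ pi c = phi (h il.2) il.1.
      by move=> [i l] /=; have /inP[c Bc pc] := phiP (h l) i (Ah l); exists c.
    by exists (fun i l => b (i, l)) => i l; exact: (bE (i, l)).
  have key i : [/\ A (eval_word w h), B (eval_word w (b i)) &
      pi (eval_word w (b i)) = phi (eval_word w h) i].
    apply: (@eval_word_rel E1 E2 (fun u c => [/\ A u, B c & pi c = phi u i])).
    - by split=> //; rewrite pi1 phi1.
    - move=> x x' z z' [Ax Bx xx] [Az Bz zz].
      by split; [exact: AM | exact: BM | rewrite piM phiM // xx zz].
    - by move=> x x' [Ax Bx xx]; split; [exact: AV | exact: BV | rewrite piV phiV // xx].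
    - by move=> k; have [] := bE i k; split.
  split.
    rewrite /eval_word; elim/big_ind: _ => // -[l []] _ /=; [exact: AV | exact: Ah].
  apply: funext => i; have [_ Bw <-] := key i; apply/piK; apply: WB.
  by exists w => //; exists (b i) => // k; case: (bE i k).
have -> : group_index B B' = #|P|.
  apply: (@group_indexE _ _ _ _ pi) => [x z _ _|i]; last exact: inP.
  rewrite left_coset_eq // -piK piM piV; split=> [e|->]; last by rewrite mulVg.
  by apply: (mulgI (pi x)^-1); rewrite mulVg.
have [m' [cs [t trv]]] := pro_p_indices filN pp1 gA' oA'.
pose C := [set i | `[< exists2 x, A x & cs x = i >]]%SET.
have inC i : i \in C <-> exists2 x, A x & cs x = i.
  by rewrite finset.in_set; split=> /asboolP.
rewrite (@group_indexE _ A A' _ cs C) //; last first.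
  by move=> x z _ _; rewrite left_coset_eq //; split=> /(trv_eq trv).
(* [phi] is constant on cosets of [A'], so the cosets in [A] map onto the K-th power of [P]. *)
have phit x : A x -> phi (t (cs x)) = phi x.
  move=> Ax; have A'u : A' (x^-1 * t (cs x)).
    by apply/(trv_eq trv); rewrite (trv_K trv).
  have [Au u1] := A'phi _ A'u.
  have -> : t (cs x) = x * (x^-1 * t (cs x)) by rewrite mulgA mulgV mul1g.
  by rewrite phiM // u1; apply: funext => i; rewrite mulg1.
pose f i := [ffun j => phi (t i) j] : {ffun 'I_K -> gT}.
have <- : #|(ffun_on (mem P) : pred {ffun 'I_K -> gT})| = (#|P| ^ K)%N.
  by rewrite card_ffun_on card_ord.
apply: leq_trans (leq_imset_card f C).
apply: subset_leq_card; apply/fintype.subsetP => g /ffun_onP gP'.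
have [u Au ug] := phiO g gP'.
apply/imsetP; exists (cs u); first by apply/inC; exists u.
by apply/ffunP => j; rewrite ffunE phit // ug.
Qed.

End Comparison.

Lemma set_mul_subgroup (E : topGroupType) (M N : set E) : is_subgroup M -> is_subgroup N ->
  is_normal N -> is_subgroup (set_mul M N).
Proof.
move=> [M1 MM MV] [N1 NM NV] nN; split.
- by exists 1 => //; exists 1; rewrite ?mulg1.
- move=> _ _ [m Mm [n Nn <-]] [m' Mm' [n' Nn' <-]].
  exists (m * m'); first exact: MM.
  exists (n ^ m' * n'); first by apply: NM => //; exact: nN.
  by rewrite /conjg !mulgA mulgK.
- move=> _ [m Mm [n Nn <-]]; exists m^-1; first exact: MV.
  exists (n^-1 ^ m^-1); first by apply: nN; exact: NV.
  by rewrite /conjg invgK invMg !mulgA mulVg mul1g.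
Qed.

Lemma set_mul_normal (E : topGroupType) (M N : set E) : is_normal M -> is_normal N ->
  is_normal (set_mul M N).
Proof.
move=> nM nN _ g [m Mm [n Nn <-]]; rewrite conjMg.
by exists (m ^ g); [exact: nM | exists (n ^ g); [exact: nN |]].
Qed.

Lemma word_values_sub (E : topGroupType) (W : set word) (H : set E) :
  word_values W H `<=` closed_generated (word_values W H).
Proof. exact: sub_smallest. Qed.

(** * Indices of open subgroups *)

Section Index.
Variable E : topGroupType.
Hypothesis cptE : compact [set: E].
Implicit Types A B K : set E.

Definition coset_map T K (cs : E -> T) := forall x y, cs x = cs y <-> K (x^-1 * y).

Lemma coset_map_exists K : is_subgroup K -> open K ->
  exists m (cs : E -> 'I_m.+1), coset_map K cs.
Proof.
move=> gK oK; have [m [cs [t trv]]] := finite_transversal cptE gK oK.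
by exists m, cs; exact: (trv_eq trv).
Qed.

Definition coset_set (T : finType) (cs : E -> T) A : {set T} :=
  [set i | `[< exists2 x, A x & cs x = i >]]%SET.

Lemma coset_setP (T : finType) (cs : E -> T) A i :
  i \in coset_set cs A <-> exists2 x, A x & cs x = i.
Proof. by rewrite finset.in_set; split=> /asboolP. Qed.

Lemma index_cosets (T : finType) (cs : E -> T) A K : is_subgroup K -> coset_map K cs ->
  group_index A K = #|coset_set cs A|.
Proof.
move=> gK csP; apply: group_indexE; last by move=> i; exact: coset_setP.
by move=> x y _ _; rewrite left_coset_eq //; split=> /csP.
Qed.

Section Open.
Variable K : set E.
Hypotheses (gK : is_subgroup K) (oK : open K).

Lemma group_index_le A B : A `<=` B -> (group_index A K <= group_index B K)%N.
Proof.
move=> AB; have [m [cs csP]] := coset_map_exists gK oK; rewrite !(index_cosets _ gK csP).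
apply: subset_leq_card; apply/fintype.subsetP => i /coset_setP[x Ax xi].
by apply/coset_setP; exists x => //; exact: AB.
Qed.

Lemma group_index_ge A c (v : 'I_c -> E) : (forall i, A (v i)) ->
  (forall i j, K ((v i)^-1 * v j) -> i = j) -> (c <= group_index A K)%N.
Proof.
move=> Av vK; have [m [cs csP]] := coset_map_exists gK oK; rewrite (index_cosets _ gK csP).
rewrite -[X in (X <= _)%N]card_ord -cardsT.
have <- : #|[set cs (v i) | i in [set: 'I_c]%SET]%SET| = #|[set: 'I_c]%SET|.
  by apply: card_imset => i j /csP/vK.
apply: subset_leq_card; apply/fintype.subsetP => _ /imsetP[i _ ->].
by apply/coset_setP; exists (v i).
Qed.

Lemma group_index_gt0 A x : A x -> (0 < group_index A K)%N.
Proof.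
move=> Ax; apply: (@group_index_ge A 1 (fun=> x)) => // i j _.
by rewrite !ord1.
Qed.

Lemma group_index_set_mul A : group_index (set_mul A K) K = group_index A K.
Proof.
have [m [cs csP]] := coset_map_exists gK oK; rewrite !(index_cosets _ gK csP).
congr #|pred_of_set _|; apply/finset.setP => i; apply/idP/idP => /coset_setP[x].
  move=> [a Aa [k Kk <-]] <-; apply/coset_setP; exists a => //.
  by apply/csP; rewrite mulKg.
move=> Ax <-; apply/coset_setP; exists x => //.
by exists x => //; exists 1; [case: gK | rewrite mulg1].
Qed.

End Open.

Lemma group_index_mul K L : is_subgroup K -> open K -> is_subgroup L -> open L -> L `<=` K ->
  group_index setT L = (group_index setT K * group_index K L)%N.
Proof.
move=> gK oK gL oL LK; have [m [cs [t trv]]] := finite_transversal cptE gK oK.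
have [l [ds dsP]] := coset_map_exists gL oL.
have [_ KM KV] := gK.
have Kt x : K ((t (cs x))^-1 * x) by apply/(trv_eq trv); rewrite (trv_K trv).
pose f x := (cs x, ds ((t (cs x))^-1 * x)).
rewrite (@index_cosets _ cs setT K) //; last exact: (trv_eq trv).
rewrite (index_cosets K gL dsP).
rewrite (@index_cosets _ f setT L) //.
  rewrite -cardsX; congr #|pred_of_set _|; apply/finset.setP => -[i j]; rewrite finset.in_setX.
  apply/idP/andP => [/coset_setP[x _ [<- <-]]|[_ /coset_setP[x Kx xj]]].
    by split; apply/coset_setP; [exists x | exists ((t (cs x))^-1 * x)].
  apply/coset_setP; exists (t i * x) => //; rewrite /f.
  have -> : cs (t i * x) = i.
    rewrite -[RHS](trv_K trv i); apply/esym; apply/(trv_eq trv); by rewrite mulKg.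
  by rewrite mulKg xj.
move=> x y; rewrite /f; split=> [[e /dsP]|Lxy].
  by rewrite e invMg invgK !mulgA mulgK.
have e : cs x = cs y by apply/(trv_eq trv); exact: LK.
by rewrite e; congr (_, _); apply/dsP; rewrite invMg invgK !mulgA mulgK.
Qed.

End Index.

Section Chains.
Variables (E : topGroupType) (N : nat -> set E).
Hypothesis cptE : compact [set: E].
Hypothesis filN : is_filtration N.
Let ncN := filtration_chain filN.

Lemma chain_open (U : set E) k : is_subgroup U -> N k `<=` U -> open U.
Proof.
move=> [_ UM _] NU; rewrite openE => x Ux; apply/(nbhs_chain cptE filN).
by exists k => n /NU; exact: UM.
Qed.

Lemma index_unbounded (M : set E) : is_subgroup M ->
  (forall k, exists v, [/\ M v, N k v & v <> 1]) ->
  forall c, exists k0, forall k, (k0 <= k)%N -> (c <= group_index M (N k))%N.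
Proof.
move=> [M1 MM MV] Mv c.
suff [k0 [v [Av vN]]] : exists k0 (v : 'I_c -> E), (forall i, M (v i)) /\
    forall i j, N k0 ((v i)^-1 * v j) -> i = j.
  exists k0 => k kk; apply: (group_index_ge cptE (chain_sgrp ncN k) (filtration_open filN k) Av).
  by move=> i j /(chain_le ncN kk); exact: vN.
elim: c => [|[_|c [k0 [v [Av vN]]]]]; first by exists 0%N, (fun=> 1); split=> [[]|[]].
  by exists 0%N, (fun=> 1); split=> // i j _; rewrite !ord1.
have [w [Mw Nw w1]] := Mv k0.
have [k1 nNw] : exists k1, ~ N k1 w.
  apply: contrapT => h; apply: w1; apply: (filtration_sep filN) => k.
  by apply: contrapT => nk; apply: h; exists k.
have k01 : (k0 <= k1)%N.
  by rewrite leqNgt; apply/negP => /ltnW k10; apply: nNw; exact: chain_le Nw.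
(* The new element agrees with [v ord0] modulo [N k0], hence differs from the others; from [v ord0]
   it differs modulo [N k1], as [w] is not in [N k1]. *)
pose u := v ord0 * w.
have [_ NM NV] := chain_sgrp ncN k0.
have [_ _ NV1] := chain_sgrp ncN k1.
have uP i : ~ N k1 (u^-1 * v i).
  move=> Nu; have := NM _ _ Nw (chain_le ncN k01 Nu).
  rewrite /u invMg mulgA mulKVg => /vN i0; move: Nu.
  by rewrite -i0 /u invMg -mulgA mulVg mulg1 => /NV1; rewrite invgK.
exists k1, (fcons u v); split=> [i|i j].
  by case: (unliftP ord0 i) => [i'|] ->; rewrite ?fcons0 ?fconsS //; exact: MM.
case: (unliftP ord0 i) => [i'|] ->; case: (unliftP ord0 j) => [j'|] ->;
  rewrite ?fcons0 ?fconsS //.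
- by move=> /(chain_le ncN k01)/vN ->.
- by move=> /NV1; rewrite invMg invgK => /uP.
- by move=> /uP.
Qed.

End Chains.

(** * Comparisons along verbal filtrations *)

Section BigComparisons.
Variables (p : nat) (E : topGroupType) (N : nat -> set E) (W : nat -> set word).
Hypothesis p_pr : prime p.
Hypothesis filN : is_filtration N.
Hypothesis ppE : pro_p E p.
Hypothesis fgE : topologically_fg E.
Hypothesis verbN : forall k, N k.+1 = closed_generated (word_values (W k) (N k)).
Hypothesis bigN : big_factor p N.
Let ncN := filtration_chain filN.
Let cptE := pro_p_compact ppE.

Lemma big_index_unbounded c : exists k0, forall k, (k0 <= k)%N ->
  (c <= group_index setT (N k))%N.
Proof.
apply: (index_unbounded cptE filN) => // k.
by have [x Nx x1] := big_nontrivial p_pr filN ppE bigN k; exists x.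
Qed.

Lemma big_comparison (E2 : topGroupType) (N2 : nat -> set E2) K m k : is_filtration N2 ->
  pro_p E2 p -> (forall k, N2 k.+1 = closed_generated (word_values (W k) (N2 k))) ->
  dim_le (@homs p E2 N2 (N2 k)) m -> (4 * (K * m) <= group_index setT (N k))%N ->
  (group_index (N2 k) (N2 k.+1) ^ K <= group_index (N k) (N k.+1))%N.
Proof.
move=> filN2 pp2 verb2 dN2 KmN; have nc2 := filtration_chain filN2.
apply: (index_comparison p_pr filN filN2 ppE pp2 fgE bigN (W := W k) (m := m)) => //.
- exact: chain_sgrp ncN k.
- by exists k.
- exact: chain_sgrp ncN k.+1.
- by exists k.+1.
- by rewrite verbN.
- exact: chain_sgrp nc2 k.
- by exists k.
- exact: chain_sgrp nc2 k.+1.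
- by exists k.+1.
- exact: (@chain_normal _ _ nc2 k.+1).
- by rewrite verb2; exact: word_values_sub.
Qed.

Lemma homs_index_bound (E2 : topGroupType) (N2 : nat -> set E2) : is_filtration N2 ->
  pro_p E2 p -> topologically_fg E2 -> exists n, forall U : set E2, is_subgroup U ->
    (exists k, N2 k `<=` U) -> dim_le (@homs p E2 N2 U) (n * group_index setT U).
Proof.
move=> filN2 pp2 fg2; have [n hn] := fg_homs p (pro_p_compact pp2) filN2 fg2.
exists n => U gU oU; have [m [cs [t trv]]] := pro_p_indices filN2 pp2 gU oU.
rewrite (index_transversal trv gU).
exact: (homs_dim_le p_pr (filtration_chain filN2) (pro_p_images p_pr filN2 pp2) gU oU trv hn).
Qed.

(** The comparison inside one group, with B = M N_k. At most n |E : M N_k| generators are needed for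
    B, and |E : N_k| exceeds |E : M N_k| by the factor |M N_k : N_k|, which is unbounded and so
    eventually beats 4 K n. *)
Lemma big_normal_comparison (M : set E) : is_subgroup M -> is_normal M ->
  (forall k, exists v, [/\ M v, N k v & v <> 1]) ->
  forall K, exists k0, forall k, (k0 <= k)%N ->
  (group_index (set_mul M (N k)) (set_mul M (N k.+1)) ^ K <= group_index (N k) (N k.+1))%N.
Proof.
move=> gM nM Mv K; have [n hn] := homs_index_bound filN ppE fgE.
have [k0 hk0] := index_unbounded cptE filN gM Mv (4 * (K * n)).
have gMN k : is_subgroup (set_mul M (N k)).
  apply: set_mul_subgroup => //; [exact: (chain_sgrp ncN k) | exact: (@chain_normal _ _ ncN k)].
have NMN k : N k `<=` set_mul M (N k).
  by move=> x Nx; case: gM => M1 _ _; exists 1 => //; exists x => //; rewrite mul1g.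
exists k0 => k kk.
apply: (index_comparison p_pr filN filN ppE ppE fgE bigN (W := W k)
  (m := (n * group_index setT (set_mul M (N k)))%N)) => //.
- exact: chain_sgrp ncN k.
- by exists k.
- exact: chain_sgrp ncN k.+1.
- by exists k.+1.
- by rewrite verbN.
- by exists k.
- by exists k.+1.
- by apply: set_mul_normal => //; exact: (@chain_normal _ _ ncN k.+1).
- move=> _ [w Ww [h hMN ->]].
  (* Modulo [M] the elements [h l] of M N_k may be replaced by elements of N_k, whose word values
     lie in the next term. *)
  have /choice[n' n'P] : forall l, exists n', N k n' /\ M (h l * n'^-1).
    by move=> l; have [m Mm [n' Nn' <-]] := hMN l; exists n'; rewrite mulgK.
  have [M1 MM MV] := gM.
  have : M (eval_word w h * (eval_word w n')^-1).
    apply: (@eval_word_rel E E (fun x y => M (x * y^-1))).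
    - by rewrite invg1 mulg1.
    - move=> x x' y y' Mx My.
      have -> : x * y * (x' * y')^-1 = (x * x'^-1) * (y * y'^-1) ^ x'^-1.
        by rewrite /conjg invgK invMg !mulgA mulgKV.
      by apply: MM => //; exact: nM.
    - move=> x x' /MV; rewrite invMg invgK => /(nM _ x').
      by rewrite /conjg !mulgA mulVg mul1g.
    - by move=> l; case: (n'P l).
  move=> Mw; exists (eval_word w h * (eval_word w n')^-1) => //.
  exists (eval_word w n'); last by rewrite mulgKV.
  rewrite verbN; apply: word_values_sub; exists w => //; exists n' => // l.
  by case: (n'P l).
- by apply: hn => //; exists k.
have -> : group_index setT (N k) =
    (group_index setT (set_mul M (N k)) * group_index M (N k))%N.
  rewrite -(group_index_set_mul cptE (chain_sgrp ncN k) (filtration_open filN k) M).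
  apply: (group_index_mul cptE) => //.
  + exact: (chain_open cptE filN (k := k)).
  + exact: (chain_sgrp ncN k).
  + exact: (filtration_open filN).
have := hk0 k kk; move: (group_index _ _) (group_index _ _) => a b; nia.
Qed.

End BigComparisons.

(** * Verbal subgroups of direct products *)

Section ClosedGenerated.
Variable E : topGroupType.

Lemma closed_generated_subgroup (S : set E) : is_subgroup (closed_generated S).
Proof.
split=> [H [[[]]] //|x y Sx Sy H HS|x Sx H HS].
  by have [[[_ HM _] _] _] := HS; apply: HM; [exact: Sx | exact: Sy].
by have [[[_ _ HV] _] _] := HS; apply: HV; exact: Sx.
Qed.

Lemma closed_generated_closed (S : set E) : closed (closed_generated S).
Proof. by apply: closed_bigI => H [[_]]. Qed.

End ClosedGenerated.

Section Product.
Variables (r : nat) (E : 'I_r -> topGroupType).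
Local Notation G := (prod_topology E).

Definition factor_inj (j : 'I_r) (x : E j) : G := dfwith (fun i => 1 : E i) j x.

Lemma factor_injE j (x : E j) : factor_inj x j = x.
Proof. exact: dfwithin. Qed.

Lemma factor_inj1 j (x : E j) i : i != j -> factor_inj x i = 1.
Proof. by move=> ij; apply: dfwithout; rewrite eq_sym. Qed.

Lemma factor_injM j : {morph @factor_inj j : x y / x * y}.
Proof.
move=> x y; apply: functional_extensionality_dep => i.
rewrite [RHS]/(factor_inj x i * factor_inj y i).
have [->|ij] := eqVneq i j; first by rewrite !factor_injE.
by rewrite !factor_inj1 //; exact/esym/mulg1.
Qed.

Lemma factor_inj_1 j : @factor_inj j 1 = 1.
Proof. by apply: (mulIg (@factor_inj j 1)); rewrite -factor_injM !mul1g. Qed.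

Lemma factor_injV j : {morph @factor_inj j : x / x^-1}.
Proof.
by move=> x; apply: (mulIg (@factor_inj j x)); rewrite -factor_injM !mulVg factor_inj_1.
Qed.

Lemma factor_inj_continuous j : continuous (@factor_inj j).
Proof.
apply: prod_continuous => i; have [->|ij] := eqVneq i j.
  rewrite (_ : (fun t => _) = id); first by move=> x; exact: cvg_id.
  by apply: funext => x; rewrite factor_injE.
rewrite (_ : (fun t => _) = cst 1); first by move=> x; exact: cvg_cst.
by apply: funext => x; rewrite factor_inj1.
Qed.

Lemma eval_word_coord w (h : nat -> G) j :
  eval_word w h j = eval_word w (fun l => h l j).
Proof. by apply: (@eval_word_rel G (E j) (fun x y => x j = y)) => // [x ? y ? <- <-|x ? <-]. Qed.

Lemma eval_word_inj j w (h : nat -> E j) :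
  factor_inj (eval_word w h) = eval_word w (fun l => factor_inj (h l)).
Proof.
apply: (@eval_word_rel (E j) G (fun x y => factor_inj x = y)) => //.
- exact: factor_inj_1.
- by move=> x ? y ? <- <-; rewrite factor_injM.
- by move=> x ? <-; rewrite factor_injV.
Qed.

Definition set_prod (A : forall j, set (E j)) : set G := [set x | forall j, A j (x j)].

Lemma set_prod_subgroup A : (forall j, is_subgroup (A j)) -> is_subgroup (set_prod A).
Proof.
move=> gA; split=> [j|x y Ax Ay j|x Ax j].
- by have [] := gA j.
- by have [_ AM _] := gA j; exact: (AM (x j) (y j) (Ax j) (Ay j)).
- by have [_ _ AV] := gA j; exact: (AV (x j) (Ax j)).
Qed.

Lemma set_prod_normal A : (forall j, is_normal (A j)) -> is_normal (set_prod A).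
Proof. by move=> nA x g Ax j; exact: (nA j (x j) (g j) (Ax j)). Qed.

Lemma set_prod_closed A : (forall j, closed (A j)) -> closed (set_prod A).
Proof.
move=> cA; rewrite (_ : set_prod A = \bigcap_(j in setT) ((fun x : G => x j) @^-1` A j)).
  by apply: closed_bigI => j _; apply: closed_comp => // x _; exact: coord_continuous.
by apply/predeqP => x; split=> [Ax j _|Ax j]; exact: Ax.
Qed.

Lemma mem_factor_inj (H : set G) (x : G) : is_subgroup H ->
  (forall j, H (factor_inj (x j))) -> H x.
Proof.
move=> [H1 HM _] Hx.
pose trunc n : G := fun i => if (i < n)%N then x i else 1.
suff Ht n : (n <= r)%N -> H (trunc n).
  have -> : x = trunc r by apply: functional_extensionality_dep => i; rewrite /trunc ltn_ord.
  exact: Ht.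
elim: n => [_|n IH nr].
  by have -> : trunc 0%N = 1 by apply: functional_extensionality_dep.
pose j := Ordinal nr.
have -> : trunc n.+1 = trunc n * factor_inj (x j).
  apply: functional_extensionality_dep => i.
  rewrite [RHS]/(trunc n i * factor_inj (x j) i) /trunc ltnS.
  have [->|ij] := eqVneq i j; first by rewrite factor_injE /= leqnn ltnn; exact/esym/mul1g.
  transitivity (if (i < n)%N then x i else 1); last by rewrite factor_inj1 //; exact/esym/mulg1.
  rewrite leq_eqVlt.
  by rewrite -[n]/(val j) (inj_eq val_inj) (negbTE ij).
by apply: HM; [apply: IH; exact: ltnW | exact: Hx].
Qed.

(** As 1 lies in every [A j], words can be evaluated in one coordinate with the others trivial. So
    the verbal subgroup of the product contains that of each factor. *)
Lemma set_prod_generated (A : forall j, set (E j)) W : (forall j, A j 1) ->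
  closed_generated (word_values W (set_prod A)) =
  set_prod (fun j => closed_generated (word_values W (A j))).
Proof.
move=> A1; apply/seteqP; split.
  apply: closed_generated_sub.
  - by apply: set_prod_subgroup => j; exact: closed_generated_subgroup.
  - by apply: set_prod_closed => j; exact: closed_generated_closed.
  move=> _ [w Ww [h Ah ->]] j; rewrite eval_word_coord.
  by apply: word_values_sub; exists w => //; exists (fun l => h l j) => // l; exact: Ah.
move=> x Vx; have gS := closed_generated_subgroup (word_values W (set_prod A)).
apply: mem_factor_inj => // j.
apply: (closed_generated_sub (H := @factor_inj j @^-1` closed_generated (word_values W (set_prod A)))
  _ _ _ (Vx j)).
- have [S1 SM SV] := gS; split=> [|u v Su Sv|u Su]; rewrite /preimage /=.
  + by rewrite factor_inj_1.
  + by rewrite factor_injM; exact: SM.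
  + by rewrite factor_injV; exact: SV.
- apply: closed_comp; first by move=> u _; exact: factor_inj_continuous.
  exact: closed_generated_closed.
move=> _ [w Ww [h Ah ->]]; rewrite /preimage /= eval_word_inj.
apply: word_values_sub; exists w => //; exists (fun l => factor_inj (h l)) => // l i.
have [->|ij] := eqVneq i j; first by rewrite factor_injE.
by rewrite factor_inj1.
Qed.

(** The same words [W k] define the next term in all factors, which is what makes different factors
    comparable. *)
Lemma verbal_factors (S : nat -> set G) : iterated_verbal_filtration S ->
  exists (W : nat -> set word) (N : forall j, nat -> set (E j)),
    (forall k, S k = set_prod (fun j => N j k)) /\
    forall j k, N j k.+1 = closed_generated (word_values (W k) (N j k)).
Proof.
move=> [_ S0 /choice[W WE]].
pose N j := nat_rect (fun=> set (E j)) setT (fun k A => closed_generated (word_values (W k) A)).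
exists W, N; split=> // k.
elim: k => [|k IH]; first by rewrite S0; apply/predeqP.
rewrite WE IH set_prod_generated // => j.
by case: k {IH} => // k; have [] := closed_generated_subgroup (word_values (W k) (N j k)).
Qed.

Lemma factor_filtration (S : nat -> set G) (N : forall j, nat -> set (E j)) :
  is_filtration S -> (forall k, S k = set_prod (fun j => N j k)) ->
  forall j, is_filtration (N j).
Proof.
move=> filS SE j; have [Sg Sd Si] := filS.
have N1 k i : N i k 1.
  have [[S1 _ _] _ _] := Sg k; rewrite SE in S1; exact: (S1 i).
have NE k x : N j k x <-> S k (factor_inj x).
  rewrite SE; split=> [Nx i|/(_ j)]; last by rewrite factor_injE.
  have [->|ij] := eqVneq i j; first by rewrite factor_injE.
  by rewrite factor_inj1.
split.
- move=> k; have [[S1 SM SV] nS oS] := Sg k; split.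
  + split=> // [x y /NE Sx /NE Sy|x /NE Sx]; apply/NE.
      by rewrite factor_injM; exact: SM.
    by rewrite factor_injV; exact: SV.
  + move=> x g /NE Sx; apply/NE.
    by rewrite /conjg !factor_injM factor_injV; exact: nS.
  + rewrite (_ : N j k = @factor_inj j @^-1` S k); last by apply/predeqP => x; exact: NE.
    by apply: open_comp => // x _; exact: factor_inj_continuous.
- by move=> k x /NE Sx; apply/NE; exact: Sd.
- apply/predeqP => x; split=> [Nx|-> k _]; last exact: N1.
  have : factor_inj x = 1.
    by rewrite -[_ = 1]/([set 1] (factor_inj x)) -Si => k _; apply/NE; exact: Nx.
  by move/(congr1 (fun y : G => y j)); rewrite factor_injE.
Qed.

Hypothesis cptE : forall j, compact [set: E j].

Lemma index_set_prod (A K : forall j, set (E j)) : (forall j, is_subgroup (K j)) ->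
  (forall j, open (K j)) ->
  group_index (set_prod A) (set_prod K) = (\prod_j group_index (A j) (K j))%N.
Proof.
move=> gK oK.
have /choice[m mP] : forall j, exists m, exists cs : E j -> 'I_m.+1, coset_map (K j) cs.
  by move=> j; exact: coset_map_exists.
pose M := \max_j m j.
have /fin_all_exists[cs csP] : forall j, exists cs : E j -> 'I_M.+1, coset_map (K j) cs.
  move=> j; have [cs csP] := mP j; exists (fun x => inord (cs x)) => x y.
  have lt (i : 'I_(m j).+1) : (i < M.+1)%N.
    by rewrite ltnS (leq_trans (ltn_ord i : i <= m j)%N) // /M; exact: leq_bigmax.
  rewrite -csP; split=> [|->] //.
  by move/(congr1 val); rewrite /= !inordK // => /val_inj.
pose f (x : G) := [ffun j => cs j (x j)].
rewrite (@index_cosets _ _ f (set_prod A) (set_prod K)); first last.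
- move=> x y; split=> [/ffunP e j|Kxy].
    by have := e j; rewrite !ffunE => /csP.
  by apply/ffunP => j; rewrite !ffunE; apply/csP; exact: (Kxy j).
- exact: set_prod_subgroup.
rewrite (eq_bigr (fun j => #|coset_set (cs j) (A j)|)); last first.
  by move=> j _; exact: index_cosets.
transitivity #|family (fun j => mem (coset_set (cs j) (A j)))|; last first.
  by rewrite card_family foldrE big_image.
apply: eq_card => g; apply/idP/idP.
  move=> /coset_setP[x Ax <-]; apply/familyP => j; rewrite ffunE.
  by apply/coset_setP; exists (x j) => //; exact: Ax.
move=> /familyP gA; apply/coset_setP.
have /fin_all_exists2[x Ax xg] : forall j, exists2 x, A j x & cs j x = g j.
  by move=> j; apply/coset_setP; exact: gA.
by exists x => //; apply/ffunP => j; rewrite ffunE xg.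
Qed.

End Product.

(** * Growth of sequences *)

Local Open Scope ring_scope.

Section Ratios.
Variable R : realType.
Implicit Types b x y : nat -> R.

Definition unbounded x := forall A, exists k0, forall k, (k0 <= k)%N -> A <= x k.

Lemma increments_le b x (c : R) k0 :
  (forall k, (k0 <= k)%N -> c * (b k.+1 - b k) <= x k.+1 - x k) ->
  forall k, (k0 <= k)%N -> c * (b k - b k0) <= x k - x k0.
Proof.
move=> h k /subnK <-; elim: (k - k0)%N => [|i IH]; first by rewrite add0n !subrr mulr0.
rewrite addSn; have := h (i + k0)%N (leq_addl _ _); move: IH.
by set u := b _; set v := b _; set w := b _; lra.
Qed.

Lemma ratio_cvg0 b x : (forall k, 0 <= b k) -> (forall k, 0 <= x k) -> unbounded x ->
  (forall K : nat, exists k0, forall k, (k0 <= k)%N ->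
    K%:R * (b k.+1 - b k) <= x k.+1 - x k) ->
  (fun k => b k / x k) @ \oo --> (0 : R).
Proof.
move=> b0 x0 ux h; apply/cvgrPdist_le => e e0.
(* Half of [e] is spent on the growth of [b] beyond [k0], the other half on the constant [b k0]. *)
pose K := (Num.bound (2 / e)).
have Ke : 2 / e < K%:R.
  by apply: archi_boundP; apply: divr_ge0; lra.
have [k0 /increments_le hk0] := h K.
have [k1 hk1] := ux (1 + 2 * b k0 / e).
near=> k.
have k0k : (k0 <= k)%N by near: k; exact: nbhs_infty_ge.
have k1k : (k1 <= k)%N by near: k; exact: nbhs_infty_ge.
have {}hk0 := hk0 k k0k; have {}hk1 := hk1 k k1k.
have xk0 : 0 < x k.
  have : 0 <= b k0 / e by apply: divr_ge0 => //; lra.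
  lra.
rewrite sub0r normrN ger0_norm ?divr_ge0 // ler_pdivrMr //.
have b1 : 2 * b k0 <= e * x k.
  have : e * (1 + 2 * b k0 / e) <= e * x k by rewrite ler_pM2l.
  have -> : e * (1 + 2 * b k0 / e) = e + 2 * b k0 by field; lra.
  lra.
have b2 : 2 * (b k - b k0) <= e * x k.
  have [bk|bk] := leP (b k) (b k0); first by nra.
  have e1 : 2 < e * K%:R by move: Ke; rewrite ltr_pdivrMr // mulrC.
  have : e * (K%:R * (b k - b k0)) <= e * x k.
    by rewrite ler_pM2l //; have := x0 k0; lra.
  nra.
lra.
Unshelve. all: by end_near. Qed.

Lemma cvgn_unique (f : nat -> R) (a b : R) : f @ \oo --> a -> f @ \oo --> b -> a = b.
Proof. by move=> /(cvg_lim (@Rhausdorff R)) <- /(cvg_lim (@Rhausdorff R)). Qed.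

Lemma cvgn_sum (I : finType) (P : pred I) (f : I -> nat -> R) (l : I -> R) :
  (forall i, P i -> f i @ \oo --> l i) ->
  (fun k => \sum_(i | P i) f i k) @ \oo --> \sum_(i | P i) l i.
Proof.
move=> fl; elim: (index_enum I) => [|i s IH].
  rewrite big_nil; under eq_fun do rewrite big_nil; exact: cvg_cst.
rewrite big_cons; under eq_fun do rewrite big_cons.
by case: ifP => // Pi; apply: cvgD => //; exact: fl.
Qed.

Lemma cvg_eventually (f g : nat -> R) (l : R) k0 : (forall k, (k0 <= k)%N -> f k = g k) ->
  f @ \oo --> l -> g @ \oo --> l.
Proof.
move=> fg; apply: cvg_trans; apply: near_eq_cvg; near=> k.
by apply: fg; near: k; exact: nbhs_infty_ge.
Unshelve. all: by end_near. Qed.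

Lemma ratio_cvg1 x y c : unbounded x -> (forall k, `|x k - y k| <= c) ->
  (fun k => y k / x k) @ \oo --> (1 : R).
Proof.
move=> ux xy; apply/cvgrPdist_le => e e0.
have [k1 hk1] := ux (1 + `|c| / e).
near=> k.
have {}hk1 : 1 + `|c| / e <= x k by apply: hk1; near: k; exact: nbhs_infty_ge.
have ce : 0 <= `|c| / e by apply: divr_ge0 => //; lra.
have xk0 : 0 < x k by lra.
have -> : 1 - y k / x k = (x k - y k) / x k by field; lra.
rewrite normrM normfV (gtr0_norm xk0) ler_pdivrMr //.
apply: (le_trans (xy k)); apply: (le_trans (ler_norm _)).
have -> : `|c| = e * (`|c| / e) by field; lra.
by rewrite ler_pM2l //; lra.
Unshelve. all: by end_near. Qed.

(* Once [x] is ahead of [y] by the constant for [K = 2] it stays ahead, and the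
   distance grows at least like [y]. *)
Definition dominates x y := forall K : nat, exists c, forall k, c + y k <= x k ->
  K%:R * (y k.+1 - y k) <= x k.+1 - x k.

Lemma dominates_ratio x y k : (forall k, 0 <= x k) -> (forall k, 0 <= y k) ->
  unbounded x -> unbounded y -> (forall k, y k <= y k.+1) -> dominates x y ->
  (forall c, (forall k, c + y k <= x k -> 2%:R * (y k.+1 - y k) <= x k.+1 - x k) ->
    c + y k <= x k -> (fun k => y k / x k) @ \oo --> (0 : R)).
Proof.
move=> x0 y0 ux uy ym dxy c hc ck.
have hd l : (k <= l)%N -> c + y l <= x l /\ x k - y k + (y l - y k) <= x l - y l.
  move=> /subnK <-; elim: (l - k)%N => [|i [IH1 IH2]]; first by rewrite add0n; lra.
  by rewrite addSn; have := hc _ IH1; have := ym (i + k)%N; lra.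
apply: ratio_cvg0 => // K; have [cK hcK] := dxy K.
have [k1 hk1] := uy (cK + y k - (x k - y k)).
exists (maxn k k1) => l; rewrite geq_max => /andP[/hd[_ h2] /hk1 h1].
by apply: hcK; lra.
Qed.

(** If neither sequence ever leads by the constant belonging to K = 2, their difference is
    bounded. *)
Lemma ratio_trichotomy x y : (forall k, 0 <= x k) -> (forall k, 0 <= y k) ->
  (forall k, x k <= x k.+1) -> (forall k, y k <= y k.+1) ->
  unbounded x -> unbounded y -> dominates x y -> dominates y x ->
  [\/ (fun k => y k / x k) @ \oo --> (0 : R), (fun k => x k / y k) @ \oo --> (0 : R) |
      (fun k => y k / x k) @ \oo --> (1 : R)].
Proof.
move=> x0 y0 xm ym ux uy dxy dyx.
have [c hc] := dxy 2%N; have [d hd] := dyx 2%N.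
have [[k ck]|nc] := pselect (exists k, c + y k <= x k).
  by apply: Or31; exact: (dominates_ratio x0 y0 ux uy ym dxy hc ck).
have [[k dk]|nd] := pselect (exists k, d + x k <= y k).
  by apply: Or32; exact: (dominates_ratio y0 x0 uy ux xm dyx hd dk).
apply: Or33; apply: (@ratio_cvg1 _ _ (`|c| + `|d|)) => // k.
have c1 : x k < c + y k by rewrite ltNge; apply/negP => ?; apply: nc; exists k.
have d1 : y k < d + x k by rewrite ltNge; apply/negP => ?; apply: nd; exists k.
have := ler_norm c; have := ler_norm d; have := normr_ge0 c; have := normr_ge0 d.
by rewrite ler_norml => *; apply/andP; split; lra.
Qed.

(** * Limits of the shares in a sum *)

Section Proportions.
Variables (I : finType) (B : pred I) (x : I -> nat -> R).
Hypothesis x_ge0 : forall i k, 0 <= x i k.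
Hypothesis x_unb : forall i, B i -> unbounded (x i).
Hypothesis x_tri : forall i j, B i -> B j ->
  [\/ (fun k => x j k / x i k) @ \oo --> (0 : R), (fun k => x i k / x j k) @ \oo --> (0 : R) |
      (fun k => x j k / x i k) @ \oo --> (1 : R)].
Hypothesis x_small : forall i j, B i -> ~~ B j -> (fun k => x j k / x i k) @ \oo --> (0 : R).
Variable i0 : I.
Hypothesis Bi0 : B i0.

Let ratio i j k := x i k / x j k.

Lemma ratio_comp i j l (a b : R) : B j -> ratio i j @ \oo --> a -> ratio j l @ \oo --> b ->
  ratio i l @ \oo --> a * b.
Proof.
move=> Bj ca cb; have [k0 hk0] := x_unb Bj 1.
apply: (@cvg_eventually (fun k => ratio i j k * ratio j l k) _ _ k0); last exact: cvgM.
move=> k /hk0 h; rewrite /ratio mulrA mulfVK //.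
by apply: lt0r_neq0; lra.
Qed.

Lemma ratio_self i : B i -> ratio i i @ \oo --> (1 : R).
Proof.
move=> Bi; have [k0 hk0] := x_unb Bi 1.
apply: (@cvg_eventually (fun=> 1) _ _ k0); last exact: cvg_cst.
by move=> k /hk0 h; rewrite /ratio divff //; apply: lt0r_neq0; lra.
Qed.

(** Take [m] with the most sequences negligible against it. A big [j] that outgrew [m] would have
    all of these below it, and [m] as well. *)
Lemma maximal_growth : exists2 m, B m & forall j, exists2 l : R, 0 <= l & ratio j m @ \oo --> l.
Proof.
pose below i := [set j | B j && `[< ratio j i @ \oo --> (0 : R) >]]%SET.
pose m := [arg max_(i > i0 | B i) #|below i|].
have [m' Bm' maxm] : exists2 m', B m' & forall j, B j -> (#|below j| <= #|below m'|)%N.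
  by case: (@arg_maxnP I i0 B (fun i => #|below i|) Bi0) => m' Bm' h; exists m'.
exists m' => // j; have [Bj|nBj] := boolP (B j); last by exists 0 => //; exact: x_small.
have [h|h|h] := x_tri Bm' Bj; [by exists 0| |by exists 1].
exfalso; have := maxm j Bj; apply/negP; rewrite -ltnNge; apply: proper_card.
have inb i l : (i \in below l) <-> B i /\ ratio i l @ \oo --> (0 : R).
  by rewrite finset.in_set; split=> [/andP[Bi /asboolP]|[Bi il]] //; rewrite Bi; apply/asboolP.
rewrite fintype.properE; apply/andP; split.
  apply/fintype.subsetP => i /inb[Bi im]; apply/inb; split=> //.
  by rewrite -[0](mul0r 0); exact: (ratio_comp Bm').
apply/negP => /fintype.subsetP/(_ m').
have mj : m' \in below j by apply/inb.
move=> /(_ mj)/inb[_ c0]; have /eqP := cvgn_unique (ratio_self Bm') c0.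
by rewrite oner_eq0.
Qed.

(** After division by the fastest sequence [x m] everything converges, and the limit of the total is
    at least 1 because [m] contributes 1. *)
Lemma proportions : exists2 l : I -> R, (forall j, ~~ B j -> l j = 0) &
  forall j, (fun k => x j k / \sum_i x i k) @ \oo --> l j.
Proof.
have [m Bm /fin_all_exists2[l l0 lE]] := maximal_growth.
have lm : l m = 1.
  by apply: cvgn_unique (lE m) _; exact: ratio_self.
pose L := \sum_i l i.
have L0 : L != 0.
  apply: lt0r_neq0; rewrite /L (bigD1 m) //= lm.
  have : 0 <= \sum_(i | i != m) l i by apply: sumr_ge0.
  lra.
have cL : (fun k => (\sum_i x i k) / x m k) @ \oo --> L.
  rewrite (_ : (fun k => _) = (fun k => \sum_i ratio i m k)).
    by apply: cvgn_sum => i _; exact: lE.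
  by apply: funext => k; rewrite mulr_suml.
have [k0 hk0] := x_unb Bm 1.
have cj j : (fun k => x j k / \sum_i x i k) @ \oo --> l j / L.
  apply: (@cvg_eventually (fun k => ratio j m k / ((\sum_i x i k) / x m k)) _ _ k0).
    move=> k /hk0 h; have xm : x m k != 0 by apply: lt0r_neq0; lra.
    have sx : \sum_i x i k != 0.
      apply: lt0r_neq0; rewrite (bigD1 m) //=.
      have : 0 <= \sum_(i | i != m) x i k by apply: sumr_ge0.
      lra.
    by rewrite /ratio; field; rewrite xm sx.
  by apply: cvgM => //; apply: cvgV.
exists (fun j => l j / L) => // j nBj.
have -> : l j = 0; last by rewrite mul0r.
exact: cvgn_unique (lE j) (x_small Bm nBj).
Qed.

End Proportions.
End Ratios.

(** * Hausdorff dimensions *)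

Section Logarithms.
Variables (R : realType) (p : nat).
Hypothesis p_pr : prime p.
Local Notation lg n := (logp p (n%:R : R)).

Let lnp_gt0 : 0 < ln (p%:R : R).
Proof. by apply: ln_gt0; rewrite ltr1n prime_gt1. Qed.

Let nat_pos n : (0 < n)%N -> (n%:R : R) \is Num.pos.
Proof. by rewrite qualifE /= ltr0n. Qed.

Lemma logp_natM a b : (0 < a)%N -> (0 < b)%N -> lg (a * b) = lg a + lg b.
Proof. by move=> a0 b0; rewrite /logp natrM (lnM (nat_pos a0) (nat_pos b0)) mulrDl. Qed.

Lemma logp_natX a K : (0 < a)%N -> lg (a ^ K) = K%:R * lg a.
Proof.
by move=> a0; rewrite /logp natrX lnXn ?ltr0n // -[ln _ *+ K]mulr_natl -mulrA.
Qed.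

Lemma logp_nat_le a b : (0 < a)%N -> (0 < b)%N -> (lg a <= lg b) = (a <= b)%N.
Proof.
by move=> a0 b0; rewrite /logp ler_pM2r ?invr_gt0 // (ler_ln (nat_pos a0) (nat_pos b0)) ler_nat.
Qed.

Lemma logp_nat_ge0 a : 0 <= lg a.
Proof.
apply: mulr_ge0; last by rewrite invr_ge0 ltW.
by case: a => [|a]; [rewrite ln0 | rewrite ln_ge0 // ler1n].
Qed.

Lemma logp_nat1 : lg 1 = 0.
Proof. by rewrite /logp ln1 mul0r. Qed.

Lemma logp_nat_prod (I : finType) (f : I -> nat) : (forall i, 0 < f i)%N ->
  lg (\prod_i f i)%N = \sum_i lg (f i).
Proof.
move=> f0; elim: (index_enum I) => [|i s IH]; first by rewrite !big_nil logp_nat1.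
rewrite !big_cons logp_natM ?IH //.
by elim: s {IH} => [|j s IH]; rewrite ?big_nil ?big_cons // muln_gt0 f0.
Qed.

Lemma logp_unbounded (f : nat -> nat) :
  (forall c, exists k0, forall k, (k0 <= k)%N -> (c <= f k)%N) ->
  unbounded (fun k => lg (f k)).
Proof.
move=> h A; pose c := Num.bound (expR (A * ln p%:R)).
have [k0 hk0] := h c; exists k0 => k /hk0 ck.
have ec : expR (A * ln p%:R) < c%:R by apply: archi_boundP; exact: expR_ge0.
have fp : 0 < (f k)%:R :> R.
  by apply: lt_le_trans (expR_gt0 (A * ln p%:R)) _; apply: (le_trans (ltW ec)); rewrite ler_nat.
rewrite /logp ler_pdivlMr // -[A * _]expRK ler_ln ?qualifE //= ?expR_gt0 //.
by apply: (le_trans (ltW ec)); rewrite ler_nat.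
Qed.

End Logarithms.

(** * The normal Hausdorff spectrum *)

Section Final.
Variables (R : realType) (p r : nat) (E : 'I_r -> topGroupType).
Local Notation G := (prod_topology E).
Variables (S : nat -> set G) (W : nat -> set word) (N : forall j, nat -> set (E j)).
Arguments N : clear implicits.
Hypothesis p_pr : prime p.
Hypothesis fgE : forall j, topologically_fg (E j).
Hypothesis freeE : forall j, free_pro_p p (E j) \/ demushkin (E j) p.
Hypothesis filS : is_filtration S.
Hypothesis SE : forall k, S k = @set_prod r E (fun j => N j k).
Hypothesis verbN : forall j k, N j k.+1 = closed_generated (word_values (W k) (N j k)).
Local Notation lg n := (logp p (n%:R : R)).

Let ppE j : pro_p (E j) p.
Proof. by case: (freeE j) => [[]|[]]. Qed.

Let filN j : is_filtration (N j) := factor_filtration filS SE j.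
Let cptE j : compact [set: E j] := pro_p_compact (ppE j).
Arguments cptE : clear implicits.
Let gN j k : is_subgroup (N j k) := chain_sgrp (filtration_chain (filN j)) k.
Let oN j k : open (N j k) := filtration_open (filN j) k.
Let NS j k : N j k.+1 `<=` N j k := @chain_dec _ _ (filtration_chain (filN j)) k.

Let cptG : compact [set: G].
Proof.
have := tychonoff cptE; congr compact; by apply/predeqP.
Qed.

Let gS k : is_subgroup (S k) := chain_sgrp (filtration_chain filS) k.
Let oS k : open (S k) := filtration_open filS k.

Definition loc_log j (k : nat) : R := lg (group_index setT (N j k)).

Lemma index_gt0 j (A B : set (E j)) : is_subgroup A -> is_subgroup B -> open B ->
  (0 < group_index A B)%N.
Proof. by move=> [A1 _ _] gB oB; exact: (group_index_gt0 (cptE j) gB oB A1). Qed.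

Lemma loc_log_ge0 j k : 0 <= loc_log j k.
Proof. exact: logp_nat_ge0. Qed.

Lemma loc_logS j k : loc_log j k.+1 - loc_log j k = lg (group_index (N j k) (N j k.+1)).
Proof.
rewrite /loc_log (group_index_mul (cptE j) (gN j k) (oN j k)) //.
rewrite logp_natM //; first by rewrite addrC addKr.
  by apply: index_gt0 => //; exact: sgrpT.
by apply: index_gt0.
Qed.

Let big j := `[< big_factor p (N j) >].

Lemma loc_log_unbounded j : big j -> unbounded (loc_log j).
Proof.
move=> /asboolP bj; apply: (@logp_unbounded R p p_pr (fun k => group_index setT (N j k))).
exact: (big_index_unbounded p_pr (filN j) (ppE j) bj).
Qed.

Lemma log_comparison i j m K k : big i -> dim_le (@homs p (E j) (N j) (N j k)) m ->
  (4 * (K * m) <= group_index setT (N i k))%N ->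
  K%:R * (loc_log j k.+1 - loc_log j k) <= loc_log i k.+1 - loc_log i k.
Proof.
move=> /asboolP bi dm h; rewrite !loc_logS.
have jk0 : (0 < group_index (N j k) (N j k.+1))%N by apply: index_gt0.
have ik0 : (0 < group_index (N i k) (N i k.+1))%N by apply: index_gt0.
rewrite -logp_natX // logp_nat_le ?expn_gt0 ?jk0 //.
exact: (big_comparison p_pr (filN i) (ppE i) (fgE i) (verbN i) bi (filN j) (ppE j) (verbN j) dm h).
Qed.

Lemma loc_log_dominates i j : big i -> dominates (loc_log i) (loc_log j).
Proof.
move=> bi K; have [n hn] := homs_index_bound p_pr (filN j) (ppE j) (fgE j).
(* A lead by this constant makes the index of [N i k] exceed 4 K times the generator bound for
   [N j k]. The successor keeps the logarithm meaningful when [K] or [n] is 0. *)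
exists (lg (4 * (K * n)).+1) => k h.
apply: (@log_comparison i j (n * group_index setT (N j k))%N) => //.
  by apply: hn => //; exists k.
have j0 : (0 < group_index setT (N j k))%N by apply: index_gt0 => //; exact: sgrpT.
have i0 : (0 < group_index setT (N i k))%N by apply: index_gt0 => //; exact: sgrpT.
move: h; rewrite /loc_log -logp_natM // logp_nat_le // ?muln_gt0 //; apply: leq_trans.
by rewrite !mulnA leq_mul.
Qed.

Lemma small_ratio i j : big i -> ~~ big j ->
  (fun k => loc_log j k / loc_log i k) @ \oo --> (0 : R).
Proof.
move=> bi nbj; have [bj|[_ sj]] := factor_classification p_pr (filN j) (ppE j) (fgE j) (freeE j).
  by case/negP: nbj; apply/asboolP.
apply: ratio_cvg0; [exact: loc_log_ge0 | exact: loc_log_ge0 | exact: loc_log_unbounded |].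
move=> K; have /asboolP bi' := bi.
have [k0 hk0] := big_index_unbounded p_pr (filN i) (ppE i) bi' (4 * (K * 2)).
exists k0 => k kk; apply: (log_comparison bi) (hk0 k kk).
by apply: sj; [exact: gN | exists k].
Qed.

Lemma big_ratio i j : big i -> big j ->
  [\/ (fun k => loc_log j k / loc_log i k) @ \oo --> (0 : R),
      (fun k => loc_log i k / loc_log j k) @ \oo --> (0 : R) |
      (fun k => loc_log j k / loc_log i k) @ \oo --> (1 : R)].
Proof.
move=> bi bj; apply: ratio_trichotomy; try exact: loc_log_ge0;
  try exact: loc_log_unbounded; try exact: loc_log_dominates.
  by move=> k; rewrite -subr_ge0 loc_logS logp_nat_ge0.
by move=> k; rewrite -subr_ge0 loc_logS logp_nat_ge0.
Qed.

Lemma log_index_S k : lg (group_index setT (S k)) = \sum_j loc_log j k.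
Proof.
rewrite SE (_ : setT = @set_prod r E (fun j => [set: E j])); last by apply/predeqP.
rewrite index_set_prod // logp_nat_prod // => j.
by apply: index_gt0 => //; exact: sgrpT.
Qed.

Definition subproduct (J : {set 'I_r}) : set G :=
  @set_prod r E (fun j => if j \in J then setT else [set 1%g]).

Lemma index_set1 j k : group_index [set 1%g] (N j k) = 1%N.
Proof.
apply/eqP; rewrite eqn_leq index_gt0 ?andbT //; last by split=> [|x y -> ->|x ->]; rewrite ?mulg1 ?invg1.
rewrite (@group_indexE _ [set 1%g] (N j k) unit (fun=> tt) [set: unit]%SET) ?cardsT ?card_unit //.
  by move=> x y -> ->.
by move=> []; rewrite finset.in_setT; split=> // _; exists 1%g.
Qed.

Variable l : 'I_r -> R.
Hypothesis l_small : forall j, ~~ big j -> l j = 0.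
Hypothesis l_cvg : forall j, (fun k => loc_log j k / \sum_i loc_log i k) @ \oo --> l j.

(** For small [j] the quotient is squeezed between 0 and a sequence tending to 0. For big [j] the
    logarithmic index of [M] falls short of that of the whole factor by [b], which
    [big_normal_comparison] makes negligible. *)
Lemma normal_log_cvg j (M : set (E j)) : is_subgroup M ->
  (big j -> is_normal M /\ forall k, exists v, [/\ M v, N j k v & v <> 1%g]) ->
  (fun k => lg (group_index M (N j k)) / \sum_i loc_log i k) @ \oo --> l j.
Proof.
move=> gM bM; have [bj|nbj] := boolP (big j); last first.
  apply: (squeeze_cvgr (f := fun=> 0) (h := fun k => loc_log j k / \sum_i loc_log i k)).
  - near=> k; have X0 : 0 <= \sum_i loc_log i k by apply: sumr_ge0 => i _; exact: loc_log_ge0.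
    rewrite divr_ge0 ?logp_nat_ge0 //= ler_wpM2r ?invr_ge0 // logp_nat_le //.
    + exact: (group_index_le (cptE j)).
    + exact: index_gt0.
    + by apply: index_gt0 => //; exact: sgrpT.
  - by rewrite l_small //; exact: cvg_cst.
  - exact: l_cvg.
have [nM Mv] := bM bj; have /asboolP bj' := bj.
pose MN k := set_mul M (N j k).
have gMN k : is_subgroup (MN k).
  by apply: set_mul_subgroup => //; exact: (@chain_normal _ _ (filtration_chain (filN j)) k).
have NMN k : N j k `<=` MN k.
  by move=> x Nx; case: gM => M1 _ _; exists 1%g => //; exists x => //; rewrite mul1g.
have oMN k : open (MN k) by exact: (chain_open (cptE j) (filN j) (gMN k) (NMN k)).
pose b k : R := lg (group_index setT (MN k)).
have idx_M k : lg (group_index M (N j k)) = loc_log j k - b k.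
  rewrite -(group_index_set_mul (cptE j) (gN j k) (oN j k) M) /loc_log.
  rewrite (group_index_mul (cptE j) (gMN k) (oMN k) (gN j k) (oN j k) (NMN k)).
  rewrite logp_natM; [by rewrite addrC addKr | | exact: index_gt0].
  by apply: index_gt0 => //; exact: sgrpT.
have bx : (fun k => b k / loc_log j k) @ \oo --> (0 : R).
  apply: ratio_cvg0; [by move=> k; exact: logp_nat_ge0 | exact: loc_log_ge0 |
    exact: loc_log_unbounded |].
  move=> K; have [k0 hk0] :=
    big_normal_comparison p_pr (filN j) (ppE j) (fgE j) (verbN j) bj' gM nM Mv K.
  exists k0 => k kk; rewrite loc_logS /b.
  have MNS : MN k.+1 `<=` MN k.
    by move=> _ [m Mm [n /NS Nn <-]]; exists m => //; exists n.
  rewrite (group_index_mul (cptE j) (gMN k) (oMN k) (gMN k.+1) (oMN k.+1) MNS).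
  have MM0 : (0 < group_index (MN k) (MN k.+1))%N by exact: index_gt0.
  rewrite logp_natM //; last by apply: index_gt0 => //; exact: sgrpT.
  rewrite addrAC subrr add0r -logp_natX // logp_nat_le ?expn_gt0 ?MM0 //; first exact: hk0.
  exact: index_gt0.
have [k0 hk0] := loc_log_unbounded bj 1.
apply: (@cvg_eventually _ (fun k => (1 - b k / loc_log j k) * (loc_log j k / \sum_i loc_log i k)) _ _ k0).
  move=> k /hk0 h; rewrite idx_M mulrA mulrBl mul1r divfK //.
  by apply: lt0r_neq0; lra.
have c1 : (fun k => 1 - b k / loc_log j k) @ \oo --> (1 - 0 : R).
  by apply: cvgB; [exact: cvg_cst | exact: bx].
by rewrite -[l j]mul1r; rewrite subr0 in c1; exact: (cvgM c1 (@l_cvg j)).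
Unshelve. all: by end_near. Qed.

(** Lower limits are not additive; here the quotients lie between two sums with the same limit, so
    the lower limit is a true limit and splits over the factors. *)
Lemma hdim_between (H : set G) (J : {set 'I_r}) (M : forall j, set (E j)) :
  (forall j, is_subgroup (M j)) ->
  (forall j, j \in J -> big j ->
    is_normal (M j) /\ forall k, exists v, [/\ M j v, N j k v & v <> 1%g]) ->
  set_prod M `<=` H -> H `<=` subproduct J -> hdim R p S H = \sum_(j in J) l j.
Proof.
move=> gM bM MH HJ; apply: (cvg_limn_inf_sup _).1.
apply: (squeeze_cvgr
  (f := fun k => \sum_(j in J) (lg (group_index (M j) (N j k)) / \sum_i loc_log i k))
  (h := fun k => \sum_(j in J) (loc_log j k / \sum_i loc_log i k))); last first.
- by apply: cvgn_sum => j _; exact: l_cvg.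
- by apply: cvgn_sum => j jJ; apply: normal_log_cvg => // bj; exact: bM.
near=> k; rewrite log_index_S group_index_set_mul //.
have X0 : 0 <= (\sum_i loc_log i k)^-1.
  by rewrite invr_ge0; apply: sumr_ge0 => i _; exact: loc_log_ge0.
have gt0M j : (0 < group_index (M j) (N j k))%N by exact: index_gt0.
have prodP (f : 'I_r -> nat) : (forall j, 0 < f j)%N -> (0 < \prod_j f j)%N.
  by move=> f0; elim/big_ind: _ => // a b a0 b0; rewrite muln_gt0 a0.
have MS : group_index (set_prod M) (S k) = (\prod_j group_index (M j) (N j k))%N.
  by rewrite SE index_set_prod.
have JS : group_index (subproduct J) (S k) =
    (\prod_j (if j \in J then group_index setT (N j k) else 1))%N.
  rewrite SE index_set_prod //; apply: eq_bigr => j _.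
  by case: ifP => // _; exact: index_set1.
have H0 : (0 < group_index H (S k))%N.
  by apply: leq_trans (group_index_le cptG (gS k) (oS k) MH); rewrite MS; exact: prodP.
have sumE (f : 'I_r -> R) :
    \sum_(j in J) (f j / \sum_i loc_log i k) = (\sum_(j in J) f j) / \sum_i loc_log i k.
  by rewrite mulr_suml.
rewrite (sumE (fun j => lg (group_index (M j) (N j k)))) (sumE (fun j => loc_log j k)).
apply/andP; split; apply: ler_wpM2r => //.
  apply: (@le_trans _ _ (lg (group_index (set_prod M) (S k)))).
    rewrite MS logp_nat_prod // [leRHS](bigID (mem J))  /= lerDl.
    by apply: sumr_ge0 => j _; exact: logp_nat_ge0.
  by rewrite logp_nat_le ?MS ?prodP // -MS; exact: (group_index_le cptG).
apply: (@le_trans _ _ (lg (group_index (subproduct J) (S k)))).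
  rewrite logp_nat_le //; first exact: (group_index_le cptG).
  by apply: leq_trans H0 _; exact: (group_index_le cptG).
rewrite JS logp_nat_prod //; last first.
  by move=> j; case: ifP => // _; apply: index_gt0 => //; exact: sgrpT.
rewrite (bigID (mem J)) /= [X in _ + X]big1 ?addr0; last first.
  by move=> j /negbTE ->; exact: logp_nat1.
by apply: ler_sum => j ->.
Unshelve. all: by end_near. Qed.

Lemma set1_subgroup (H : topGroupType) : is_subgroup [set 1%g : H].
Proof. by split=> [|x y -> ->|x ->]; rewrite ?mulg1 ?invg1. Qed.

Lemma subproduct_subgroup (J : {set 'I_r}) : is_subgroup (subproduct J).
Proof.
by apply: set_prod_subgroup => j; case: ifP => _; [exact: sgrpT | exact: set1_subgroup].
Qed.

Lemma hdim_subproduct (J : {set 'I_r}) : hdim R p S (subproduct J) = \sum_(j in J) l j.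
Proof.
apply: (@hdim_between _ J (fun j => if j \in J then setT else [set 1%g])) => //.
  by move=> j; case: ifP => _; [exact: sgrpT | exact: set1_subgroup].
move=> j -> /asboolP bj; split=> // k.
by have [x Nx x1] := big_nontrivial p_pr (filN j) (ppE j) bj k; exists x.
Qed.

Lemma hdim_direct_factor j : hdim R p S (direct_factor E j) = l j.
Proof.
rewrite -[RHS](@big_set1 R 0 +%R _ j l) -hdim_subproduct; congr (hdim R p S _).
apply/predeqP => x; split=> h i; have := h i.
  by rewrite finset.in_set1; case: eqVneq => [//|/eqP ij]; exact.
by rewrite finset.in_set1; case: eqVneq.
Qed.

Lemma subproduct_normal_closed J : is_normal (subproduct J) /\ closed (subproduct J).
Proof.
split.
  by apply: set_prod_normal => j; case: ifP => _ // x g ->; rewrite /= conj1g.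
apply: set_prod_closed => j; case: ifP => _; first exact: closedT.
apply/accessible_closed_set1/hausdorff_accessible.
by case: (ppE j) => [[]].
Qed.

Lemma hdim_normal (H : set G) : is_subgroup H -> is_normal H ->
  exists J : {set 'I_r}, hdim R p S H = \sum_(j in J) l j.
Proof.
move=> gH nH; have [H1 HM HV] := gH.
(* All small factors are put into [J]: their share is 0, so no information about the projection to
   them is needed. *)
pose J := [set j | ~~ big j || `[< exists2 x, H x & x j <> 1%g >]]%SET.
pose M j : set (E j) := [set v | H (factor_inj v)].
exists J; apply: (@hdim_between H J M).
- move=> j; split; first by rewrite /M /= factor_inj_1.
    by move=> x y Mx My; rewrite /M /= factor_injM; exact: HM.
  by move=> x Mx; rewrite /M /= factor_injV; exact: HV.
- move=> j; rewrite finset.in_set => /orP[/negP //|/asboolP[x Hx xj] /asboolP bj].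
  split.
    move=> v g Mv; rewrite /M /= /conjg !factor_injM factor_injV; exact: nH.
  move=> k.
  have [y Ny xy] : exists2 y, N j k y & (x j * y <> y * x j)%g.
    apply: contrapT => no; apply: xj.
    apply: (big_central_trivial p_pr (filN j) (ppE j) bj (k := k)) => y Ny.
    by apply: contrapT => xy; apply: no; exists y.
  have [_ NM NV] := gN j k.
  exists [~ x j, y]%g; split.
  (* The commutator of [x] with an element of a single factor lies in that factor and, by normality,
     in [H]. *)
  + rewrite /M /=; have -> : factor_inj [~ x j, y]%g = (x^-1 * x ^ factor_inj y)%g :> G.
      apply: functional_extensionality_dep => i.
      rewrite [RHS]/((x i)^-1 * ((factor_inj y i)^-1 * (x i * factor_inj y i)))%g.
      have [->|ij] := eqVneq i j; first by rewrite !factor_injE.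
      have comm1 (u : E i) : (1 = u^-1 * (1^-1 * (u * 1)))%g.
        by rewrite invg1 mulg1 mul1g mulVg.
      by rewrite !factor_inj1 //; exact: comm1.
    by apply: HM; [exact: HV | exact: nH].
  + have -> : [~ x j, y]%g = ((y^-1 ^ x j) * y)%g by rewrite /commg /conjg !mulgA.
    by apply: NM => //; apply: (@chain_normal _ _ (filtration_chain (filN j)) k); exact: NV.
  + by move/eqP/commgP.
- by move=> x Mx; apply: mem_factor_inj => // j; exact: Mx.
move=> x Hx j; case: ifPn => //; rewrite finset.in_set negb_or => /andP[_ /asboolP no].
by rewrite /=; apply: contrapT => xj; apply: no; exists x.
Qed.

Lemma normal_hspec_eq : normal_hspec R p S =
  [set \sum_(j in J) hdim R p S (direct_factor E j) | J in [set: {set 'I_r}]].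
Proof.
have lE J : \sum_(j in J) hdim R p S (direct_factor E j) = \sum_(j in J) l j.
  by apply: eq_bigr => j _; exact: hdim_direct_factor.
apply/seteqP; split=> [_ [H [gH nH _] <-]|_ [J _ <-]].
  by have [J ->] := hdim_normal gH nH; exists J.
exists (subproduct J); last by rewrite lE hdim_subproduct.
by have [nJ cJ] := subproduct_normal_closed J; split=> //; exact: subproduct_subgroup.
Qed.

End Final.

Theorem theorem1p8 (R : realType) (p : nat) (r : nat) (E : 'I_r -> topGroupType)
  (S : nat -> set (prod_topology E)) :
  prime p ->
  (forall j, topologically_fg (E j)) ->
  (forall j, free_pro_p p (E j) \/ demushkin (E j) p) ->
  (exists j, ~ soluble (E j)) ->
  iterated_verbal_filtration S ->
  let alpha (j : 'I_r) : R := hdim R p S (direct_factor E j) in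
  normal_hspec R p S = [set \sum_(j in J) alpha j | J in [set: {set 'I_r}]].
Proof.
move=> p_pr fgE freeE [i0 nsol] verS alpha.
have [filS _ _] := verS; have [W [N [SE verbN]]] := verbal_factors verS.
have filN := factor_filtration filS SE.
have ppE j : pro_p (E j) p by case: (freeE j) => [[]|[]].
(* The non-soluble factor is big, so the total logarithmic index is unbounded and the shares of the
   factors converge. *)
have bi0 : `[< big_factor p (N i0) >].
  apply/asboolP.
  by have [|[]] := factor_classification p_pr (filN i0) (ppE i0) (fgE i0) (freeE i0).
have [l l_small l_cvg] := proportions (@loc_log_ge0 R p r E N p_pr)
  (@loc_log_unbounded R p r E S N p_pr freeE filS SE)
  (@big_ratio R p r E S W N p_pr fgE freeE filS SE verbN)
  (@small_ratio R p r E S W N p_pr fgE freeE filS SE verbN) bi0.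
exact: (normal_hspec_eq p_pr fgE freeE filS SE verbN l_small l_cvg).
Qed.
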